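(* Let $\Gamma$ be a non-elementary word hyperbolic group, let $\mathbb{K}$ be $\mathbb{R}$ or $\mathbb{C}$, and let $V$ be a non-zero finite-dimensional vector space over $\mathbb{K}$. For any direct sum decomposition $\mathscr{U}$ of $V$, any non-empty subset $\emptyset\subsetneq\theta\subseteq\Delta_V$, and any block normalized representation $\zeta\colon\Gamma\to N_{\mathscr{U}}$, the set $A^{\mathscr{U}}_\theta(\zeta)$ is a convex and bounded open subset of the finite-dimensional real vector space $\mathrm{Hom}(\Gamma,D_{\mathscr{U}})$.
   Context: Direct sum decompositions: $\mathscr{U}=(U_j)_{j=1}^m$ is a finite sequence of subspaces of $V$ (possibly zero) with $V=\bigoplus_{j=1}^m U_j$. $\mathrm{Aut}_{\mathbb{K}}(\mathscr{U})$ is the group of $A\in\mathrm{GL}(V)$ with $A(U_j)=U_j$ for all $j$; write $A=\bigoplus_jA_j$ with $A_j=A|_{U_j}$. $$D_{\mathscr{U}}=\Big\{x\in\mathbb{R}^m:\sum_{j=1}^m\dim_{\mathbb{K}}(U_j)x_j=0,\ x_j=0\text{ whenever }U_j=\{0\}\Big\},$$ $$N_{\mathscr{U}}=\Big\{\bigoplus_jB_j\in\mathrm{Aut}_{\mathbb{K}}(\mathscr{U}):|\det(B_j)|=1\text{ for all }j\Big\}.$$ A block normalized representation is a homomorphism $\zeta\colon\Gamma\to N_{\mathscr{U}}$, with blocks $\zeta_j$. For homomorphisms $\delta\colon\Gamma\to\mathbb{R}$, $\varphi=(\varphi_j)_j\colon\Gamma\to D_{\mathscr{U}}$ and $\zeta\colon\Gamma\to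 N_{\mathscr{U}}$, define $\beta_{\mathscr{U}}(\delta,\varphi,\zeta)\colon\Gamma\to\mathrm{Aut}_{\mathbb{K}}(\mathscr{U})$ by $\gamma\mapsto\bigoplus_{j=1}^me^{\delta(\gamma)+\varphi_j(\gamma)}\zeta_j(\gamma)$. For a linear endomorphism $A$ of $V$, $\lambda_1(A)\ge\dots\ge\lambda_{\dim V}(A)$ are the magnitudes of the complex roots of the characteristic polynomial, counted with multiplicity. $\Delta_V=\{1,\dots,\dim_{\mathbb{K}}(V)-1\}$. For a finite generating set $\Sigma$ of $\Gamma$, $\|\gamma\|_\Sigma$ is the minimal word length of a conjugate of $\gamma$. A representation $\rho\colon\Gamma\to\mathrm{GL}(V)$ is $P_\theta$-Anosov ($\theta\subseteq\Delta_V$) if for each $k\in\theta$ there are constants $a_k>0$, $b_k\ge0$ with $\log(\lambda_k(\rho(\gamma))/\lambda_{k+1}(\rho(\gamma)))\ge a_k\|\gamma\|_\Sigma-b_k$ for all $\gamma\in\Gamma$ (independent of $\Sigma$). $A^{\mathscr{U}}_\theta(\zeta)$ is the set of $\varphi\in\mathrm{Hom}(\Gamma,D_{\mathscr{U}})$ such that $\beta_{\mathscr{U}}(\delta,\varphi,\zeta)$ is $P_\theta$-Anosov for all (equivalently, any) $\delta\in\mathrm{Hom}(\Gamma,\mathbb{R})$. *)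

(* Defs.v *)
From HB Require Import structures.
From mathcomp Require Import all_boot all_order all_algebra.
From mathcomp Require Import complex.
From mathcomp Require Import all_classical all_reals all_analysis.
Set Implicit Arguments.
Unset Strict Implicit.
Unset Printing Implicit Defensive.
Import Order.TTheory GRing.Theory Num.Theory.
Import numFieldNormedType.Exports.
Local Open Scope classical_set_scope.
Local Open Scope ring_scope.

Section Words.
Variable G : groupType.

(* Finite subsets of [G] are given as sequences. *)
Definition is_word (S : seq G) (n : nat) (g : G) : Prop :=
  exists w : seq G, [/\ size w = n,
    all (fun s => (s \in S) || (s^-1%g \in S)) w & g = (\prod_(s <- w) s)%g].

Definition generates (S : seq G) : Prop := forall g, exists n, is_word S n g.

(* The least element of [P]; it is 0 if [P] is empty. *)
Definition least (P : set nat) : nat :=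
  xget 0%N [set n | P n /\ forall k, P k -> (n <= k)%N].

Definition word_length (S : seq G) (g : G) : nat :=
  least [set n | is_word S n g].

Definition conj_length (S : seq G) (g : G) : nat :=
  least [set word_length S (g ^ h)%g | h in [set: G]].

Definition word_dist (S : seq G) (g h : G) : nat := word_length S (g^-1 * h)%g.

(* Finitely many cosets of a cyclic subgroup cover [G]. Finite groups are
   included, so a hyperbolic group is elementary iff this holds. *)
Definition virtually_cyclic : Prop :=
  exists (c : G) (T : seq G), forall g, exists2 t, t \in T &
    exists n : nat, g = (t * c ^+ n)%g \/ g = (t * c ^- n)%g.

End Words.

Section Hyperbolicity.
Variable R : realType.

Definition gromov_product (X : Type) (d : X -> X -> R) (w x y : X) : R :=
  (d x w + d y w - d x y) / 2.

Definition gromov_hyperbolic (X : Type) (d : X -> X -> R) : Prop :=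
  exists D : R, forall w x y z : X,
    Num.min (gromov_product d w x y) (gromov_product d w y z) - D
      <= gromov_product d w x z.

Definition word_hyperbolic (G : groupType) : Prop :=
  exists2 S : seq G, generates S &
    gromov_hyperbolic (fun g h : G => (word_dist S g h)%:R : R).

End Hyperbolicity.

Variant scalar_kind := RealScalars | ComplexScalars.

Definition scalars (R : realType) (k : scalar_kind) : numFieldType :=
  match k with RealScalars => R | ComplexScalars => R[i] end.

Definition scalar_of_real (R : realType) (k : scalar_kind) : R -> scalars R k :=
  match k with RealScalars => id | ComplexScalars => fun x => real_complex R x end.

Definition complex_of_scalar (R : realType) (k : scalar_kind) :
    scalars R k -> R[i] :=
  match k with RealScalars => fun x => real_complex R x | ComplexScalars => id end.

(* [passmx.mxof] acts on row vectors; determinant and characteristic polynomial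
   are unaffected by this transposition and by the choice of basis. *)
Definition end_mx (F : fieldType) (V : vectType F) (A : 'End(V)) :
    'M[F]_(\dim {:V}) :=
  passmx.mxof (vbasis {:V}) (vbasis {:V}) A.

Section Representations.
Variables (R : realType) (k : scalar_kind) (V : vectType (scalars R k)).

(* The values of [rho] are automatically invertible, so this is a homomorphism
   to GL(V). *)
Definition representation (G : groupType) (rho : G -> 'End(V)) : Prop :=
  rho 1%g = \1%VF /\ forall g h, rho (g * h)%g = (rho g \o rho h)%VF.

(* The complex roots of the characteristic polynomial, with multiplicity. *)
Definition eigenvalues (A : 'End(V)) : seq R[i] :=
  sval (closed_field_poly_normal
          (map_poly (@complex_of_scalar R k) (char_poly (end_mx A)))).

(* [lambda i A] is the [i]-th largest modulus of an eigenvalue, [i >= 1]. *)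
Definition lambda (i : nat) (A : 'End(V)) : R :=
  nth 0 (sort (fun x y => y <= x) [seq Normc.normc z | z <- eigenvalues A]) i.-1.

Definition anosov (G : groupType) (theta : set nat) (rho : G -> 'End(V)) : Prop :=
  representation rho /\
  forall S : seq G, generates S -> forall i, theta i ->
    exists a b : R, [/\ 0 < a, 0 <= b & forall g,
      a * (conj_length S g)%:R - b <= ln (lambda i (rho g) / lambda i.+1 (rho g))].

Record decomposition (m : nat) := Decomposition {
  summand :> 'I_m -> {vspace V};
  summand_sum : fullv = (\sum_(j < m) summand j)%VS;
  summand_direct : directv (\sum_(j < m) summand j)%VS }.

Variables (m : nat) (U : decomposition m).

(* [A] restricted to the [j]-th summand; meaningful when [A] preserves it. *)
Definition block (A : 'End(V)) (j : 'I_m) : 'End(subvs_of (U j)) :=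
  linfun (vsproj (U j) \o A \o vsval).

(* The direct sum of the [B j]; [sumv_pi_for] is the projection of [V] onto
   [U j] along the other summands. *)
Definition dsum_blocks (B : forall j : 'I_m, 'End(subvs_of (U j))) : 'End(V) :=
  \sum_(j < m) (linfun vsval \o B j \o linfun (vsproj (U j))
                  \o sumv_pi_for (summand_sum U) j)%VF.

Definition Aut_dec : set 'End(V) :=
  [set A | lker A = 0%VS /\ forall j, (A @: U j)%VS = U j].

Definition N_dec : set 'End(V) :=
  [set A | Aut_dec A /\ forall j, `|\det (end_mx (block A j))| = 1].

Definition D_dec : set 'rV[R]_m :=
  [set x | \sum_(j < m) (\dim (U j))%:R * x 0 j = 0 /\
           forall j, U j = 0%VS -> x 0 j = 0].

Variable G : groupType.

Definition block_normalized (zeta : G -> 'End(V)) : Prop :=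
  representation zeta /\ forall g, N_dec (zeta g).

Definition Hom_real : set (G -> R) :=
  [set delta : G -> R | {morph delta : g h / (g * h)%g >-> g + h}].

Definition Hom_D : set (G -> 'rV[R]_m) :=
  [set phi : G -> 'rV[R]_m | {morph phi : g h / (g * h)%g >-> g + h} /\ forall g, D_dec (phi g)].

Definition beta (delta : G -> R) (phi : G -> 'rV[R]_m) (zeta : G -> 'End(V))
    (g : G) : 'End(V) :=
  dsum_blocks (fun j =>
    scalar_of_real k (expR (delta g + phi g 0 j)) *: block (zeta g) j).

Definition anosov_twists (theta : set nat) (zeta : G -> 'End(V)) :
    set (G -> 'rV[R]_m) :=
  [set phi | Hom_D phi /\
     forall delta, Hom_real delta -> anosov theta (beta delta phi zeta)].

End Representations.

Arguments decomposition {R k} V m.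
Arguments Hom_real {R} G.
Arguments Hom_D {R k V m} U G.
Arguments block_normalized {R k V m} U {G} zeta.

Section FiniteDimensionalSubspaces.
Variables (R : realType) (E : lmodType R) (H : set E).

Definition linear_chart (n : nat) (L : {linear 'rV[R]_n -> E}) : Prop :=
  injective L /\ range L = H.

Definition finite_dimensional : Prop :=
  exists (n : nat) (L : {linear 'rV[R]_n -> E}), linear_chart L.

(* Open and bounded for the canonical topology of the finite-dimensional
   space [H], i.e. the one transported by any linear isomorphism R^n -> H. *)
Definition open_in (A : set E) : Prop :=
  forall (n : nat) (L : {linear 'rV[R]_n -> E}), linear_chart L ->
    open (L @^-1` A).

Definition bounded_in (A : set E) : Prop :=
  forall (n : nat) (L : {linear 'rV[R]_n -> E}), linear_chart L ->
    bounded_set (L @^-1` A).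

End FiniteDimensionalSubspaces.

(* Main.v *)
(** The moduli of the eigenvalues of a twist by phi are exp(phi_j) times those
    of the blocks zeta_j, and a gap of index k means that some set T of k
    eigenvalues is separated from the others by a factor exponential in the
    conjugacy length. The crux is that the number of elements of T in block j is the
    same for g and for g^-1 whenever some homomorphism psi to the reals has
    psi(g) <> 0. These numbers select coefficients of the polynomials
    prod_i det(1 + X^(N_i) zeta_i), which are matrix coefficients tau_i of
    representations of the group. Compare g^p eta^q, where psi(eta) = 0 and eta
    has large translation length: as psi(g^p eta^q) = p psi(g), the gap makes
    exactly one tau_i dominant for large p, uniformly in q. By Hilbert's
    cube lemma every coloring of a bounded window of exponents q has a color whose
    powers eta^q span all the others, so the dominant index does not depend on q;
    at q = 0 it is that of g, for q to infinity it is that of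
    eta. The same holds for g^-1 in place of g. The element eta is a commutator
    of a large power of g with an element moving both its fixed points at
    infinity.

    Convexity: if T and T' are the sets of two twists phi and phi' at g and
    differ, then, the twists being scalar on each block, T and T' meet some pair
    of blocks in different numbers, and comparing phi with phi' on these blocks
    gives a homomorphism that is positive at g and, the numbers being the same at
    g^-1, also at g^-1. Hence T = T', and
    logarithmic gaps with the same T are convex. Boundedness: equal numbers at g
    and g^-1 bound the differences phi_i - phi_j on generators, and the trace
    condition then bounds phi. Openness: homomorphisms are Lipschitz with respect
    to the conjugacy length. *)

Require Import Defs.
From HB Require Import structures.
From mathcomp Require Import all_boot all_order all_algebra all_fingroup.
From mathcomp Require Import complex mxtens.
From mathcomp Require Import all_classical all_reals all_analysis.
From mathcomp Require Import zify ring lra.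
Set Implicit Arguments.
Unset Strict Implicit.
Unset Printing Implicit Defensive.
Import Order.TTheory GRing.Theory Num.Theory.
Import numFieldNormedType.Exports.
Local Open Scope classical_set_scope.
Local Open Scope ring_scope.

(** * Spanning sets from colored powers *)

(** The obstacle is that no formula gives the eigenvalues of a product, and that index sets
    belonging to different group elements cannot be matched: only the numbers of their elements in
    the blocks are comparable. The coefficients [tau] see exactly these numbers. If the gap factor
    is [L], the product of the moduli over [T] exceeds the product over any other set of the same
    size by [L], while the number of sets is fixed; for large [L], cancellation therefore cannot
    hide the index of [T]. Dominance concerns one exponent at a time, and single values may vanish.
    Sums over a window of consecutive exponents are stable up to constant factors, because matrix
    coefficients along powers obey linear relations; a spanning color carries dominance from its
    exponents to the whole window. Roots of unity among the eigenvalue ratios can prevent a color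
    from spanning, hence the passage from [eta] to a power of it. As this power depends on the
    representation, all positive powers of [eta] must have large translation length. *)

Lemma finite_spanning_subset (F : fieldType) (V : vectType F) (X : V -> Prop) :
  exists2 s : seq V, (forall x, x \in s -> X x) & forall x, X x -> x \in << s >>%VS.
Proof.
pose P n := `[< exists2 s : seq V, (forall x, x \in s -> X x) & \dim << s >> = n >].
have P0 : exists n, P n by exists (\dim <<[::] : seq V>>); apply/asboolP; exists [::].
have Pb n : P n -> (n <= \dim {:V})%N.
  by move=> /asboolP[s _ <-]; apply: dimvS; apply: subvf.
case: (ex_maxnP P0 Pb) => n /asboolP[s sX sn] nmax.
exists s => // x Xx; have/nmax : P (\dim <<x :: s>>).
  by apply/asboolP; exists (x :: s) => // y; rewrite inE => /orP[/eqP->|/sX].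
rewrite -sn => le_dim.
have /eqP-> : (<< s >> == <<x :: s>>)%VS.
  by rewrite eqEdim le_dim andbT; apply: sub_span => y ys; rewrite inE ys orbT.
by apply: memv_span; rewrite mem_head.
Qed.

(** A Hilbert cube: [n0] plus all subset sums of the list [ss]. *)
Fixpoint cube (n0 : nat) (ss : seq nat) : seq nat :=
  if ss is s :: ss' then cube n0 ss' ++ map (addn s) (cube n0 ss') else [:: n0].

Lemma cube_shift a n0 ss : cube (a + n0) ss = map (addn a) (cube n0 ss).
Proof.
elim: ss => //= s ss ->; rewrite map_cat -!map_comp; congr (_ ++ _).
by apply: eq_map => x /=; rewrite addnCA.
Qed.

Lemma mem_cube0 n0 ss : n0 \in cube n0 ss.
Proof. by elim: ss => [|s ss IH]; rewrite ?inE //= mem_cat IH. Qed.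

Lemma mem_cubeS n0 ss s : s \in ss -> (n0 + s)%N \in cube n0 ss.
Proof.
elim: ss => //= t ss IH; rewrite inE mem_cat => /orP[/eqP->|/IH->//].
by rewrite addnC map_f ?orbT // mem_cube0.
Qed.

(** Induction on [d] by pigeonhole: among [#|T| + 1] consecutive intervals, each containing a
    monochromatic cube, two carry the same pattern, and their distance is the new step. The bound
    [L] is fixed before the coloring. *)
Lemma hilbert_cube (r d : nat) : exists L : nat, forall c : nat -> 'I_r,
  exists n0 ss, [/\ size ss = d, all (leq 1) ss, all (fun n => n <= L)%N (cube n0 ss) &
    forall n, n \in cube n0 ss -> c n = c n0].
Proof.
elim: d => [|d [L IH]].
  by exists 0%N => c; exists 0%N, [::]; split => // n; rewrite inE => /eqP->.
(* A pattern: base and steps of a cube relative to its interval, and its color. *)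
pose T : finType := ('I_L.+1 * d.-tuple 'I_L.+1 * 'I_r)%type.
exists (#|T|.+1 * L.+1)%N => c.
have /choice[pat patP] (t : 'I_#|T|.+1) : exists p : T,
    [/\ all (fun s : 'I__ => 1 <= s)%N p.1.2,
      all (fun n => n <= L)%N (cube p.1.1 (map val p.1.2)) &
      forall n, n \in cube p.1.1 (map val p.1.2) -> c (t * L.+1 + n)%N = p.2].
  have [n0 [ss [szs ss1 ssL cs]]] := IH (fun n => c (t * L.+1 + n)%N).
  have n0L : (n0 < L.+1)%N by rewrite ltnS (allP ssL) ?mem_cube0.
  have sL s : s \in ss -> (s < L.+1)%N.
    by move=> sss; have := allP ssL _ (mem_cubeS n0 sss); lia.
  have szt : size (map (inord : nat -> 'I_L.+1) ss) == d by rewrite size_map szs.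
  have mapK : map val (map (inord : nat -> 'I_L.+1) ss) = ss.
    rewrite -map_comp -[RHS]map_id; apply/eq_in_map => s sss /=.
    by rewrite inordK // sL.
  exists (Ordinal n0L, Tuple szt, c (t * L.+1 + n0)%N) => /=.
  rewrite mapK; split=> //.
  apply/allP => _ /mapP[s sss ->] /=; rewrite inordK ?sL //; exact: (allP ss1).
have /injectivePn[t1 [t2 t12 pat12]] : ~~ injectiveb pat.
  apply/negP => /injectiveP/leq_card; rewrite card_ord; lia.
wlog lt12 : t1 t2 t12 pat12 / (t1 < t2)%N.
  move=> W; case: (ltngtP t1 t2) => [| |/val_inj e]; first exact: W.
    by apply: W; rewrite // eq_sym.
  by rewrite e eqxx in t12.
have := patP t1; have := patP t2; rewrite -{}pat12; case: (pat t1) => -[n0 ss] k /=.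
move=> [ss1 ssL c2] [_ _ c1].
have e12 : ((t2 - t1) * L.+1 + t1 * L.+1 = t2 * L.+1)%N by rewrite -mulnDl subnK // ltnW.
exists (t1 * L.+1 + n0)%N, ((t2 - t1) * L.+1 :: map val ss)%N.
have cubeE n : n \in cube (t1 * L.+1 + n0) ((t2 - t1) * L.+1 :: map val ss)%N ->
    exists2 n', n' \in cube n0 (map val ss) & n = (t1 * L.+1 + n')%N \/ n = (t2 * L.+1 + n')%N.
  rewrite /= -cube_shift addnA e12 mem_cat !cube_shift.
  by case/orP=> /mapP[n' n's ->]; exists n'; auto.
split.
- by rewrite /= size_map size_tuple.
- rewrite /= muln_gt0 subn_gt0 lt12 /=.
  by apply/allP => _ /mapP[s sss ->]; exact: (allP ss1).
- apply/allP => n /cubeE[n' /(allP ssL) n'L].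
  have t1T := ltn_ord t1; have t2T := ltn_ord t2.
  have h t : (t < #|T|.+1)%N -> (t * L.+1 + n' <= #|T|.+1 * L.+1)%N by nia.
  by case=> ->; apply: h.
- move=> n /cubeE[n' n's nE]; rewrite (c1 n0) ?mem_cube0 //.
  by case: nE => ->; rewrite ?c1 ?c2.
Qed.

Section Orbits.
Variables (F : fieldType) (V : vectType F) (h : 'End(V)) (v : V).
Hypothesis hinj : lker h = 0%VS.

Definition orb n := iter n h v.

(** The span of an infinite family, given by its universal property because [<< >>] takes finite
    sequences. *)
Definition is_hull (N : nat) (W : {vspace V}) : Prop :=
  (forall n, orb (N * n) \in W) /\
  forall W' : {vspace V}, (forall n, orb (N * n) \in W') -> (W <= W')%VS.

Lemma hull_ex N : exists W, is_hull N W.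
Proof.
have [s sX Xs] := finite_spanning_subset (fun x => exists n, x = orb (N * n)).
exists << s >>%VS; split=> [n|W' WW']; first by apply: Xs; exists n.
by apply/span_subvP => x /sX[n ->].
Qed.

Lemma orbD a n : orb (a + n) = iter a h (orb n).
Proof. by rewrite /orb iterD. Qed.

Lemma iterh_linear a : exists2 g : 'End(V), lker g = 0%VS & forall x, g x = iter a h x.
Proof.
elim: a => [|a [g gker gE]].
  by exists \1%VF => [|x]; rewrite ?lker0_lfunE ?id_lfunE //; apply/eqP/lker0P => x y; rewrite !id_lfunE.
exists (h \o g)%VF => [|x]; last by rewrite comp_lfunE gE.
apply/eqP/lker0P => x y; rewrite !comp_lfunE.
by move/(lker0P (introT eqP hinj))/(lker0P (introT eqP gker)).
Qed.

(** A power of the injective [h] maps the span [W] into itself, hence onto itself, so leaving out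
    the first terms does not shrink the span. *)
Lemma hull_shift N W a (W' : {vspace V}) : is_hull N W ->
  (forall n, orb (a * N + N * n) \in W') -> (W <= W')%VS.
Proof.
move=> [WN Wmin] W'N; have [g gker gE] := iterh_linear (a * N).
have sub : (W <= g @^-1: W')%VS.
  by apply: Wmin => n; rewrite -memv_preim gE -orbD.
have gW : (g @: W <= W')%VS.
  by apply/subvP => _ /memv_imgP[x xW ->]; rewrite memv_preim (subvP sub).
have gWW : (g @: W <= W)%VS.
  have : (W <= g @^-1: W)%VS.
    by apply: Wmin => n; rewrite -memv_preim gE -orbD mulnC -mulnDr WN.
  by move=> sW; apply/subvP => _ /memv_imgP[x xW ->]; rewrite memv_preim (subvP sW).
have dimg : \dim (g @: W) = \dim W by apply: limg_dim_eq; rewrite gker capv0.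
suff -> : W = (g @: W)%VS by [].
by apply/esym/eqP; rewrite eqEdim gWW dimg leqnn.
Qed.

(** Passing to a power of [h] does not shrink the span of the orbit. This fails for
    [h = diag(1, -1)] and [v = (1, 1)], where coloring the exponents by parity leaves no spanning
    color. *)
Definition nondegenerate := forall M W, (0 < M)%N -> is_hull 1 W -> is_hull M W.

Hypothesis nd : nondegenerate.

(* Each step of the cube that does not enlarge the span makes it invariant under
   a power of [h], so that by nondegeneracy the span is already everything. *)
Lemma cube_span W n0 ss : is_hull 1 W -> all (leq 1) ss -> size ss = \dim W ->
  (W <= <<[seq orb n | n <- cube n0 ss]>>)%VS.
Proof.
move=> hW.
have W1 n : orb n \in W by have := hW.1 n; rewrite mul1n.
have Ysub t : (<<[seq orb n | n <- cube n0 t]>> <= W)%VS.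
  by apply/span_subvP => _ /mapP[n _ ->].
suff {}H : forall t, all (leq 1) t -> (W <= <<[seq orb n | n <- cube n0 t]>>)%VS \/
    (size t <= \dim (<<[seq orb n | n <- cube n0 t]>>))%N.
  move=> ss1 sz; have [//|] := H ss ss1; rewrite sz => le_dim.
  by have /eqP -> : (<<[seq orb n | n <- cube n0 ss]>> == W)%VS by rewrite eqEdim Ysub.
elim=> [|s t IH] /=; first by right.
move=> /andP[s1 t1]; set Y := <<_>>%VS in IH *; set Y' := <<_>>%VS.
have YY' : (Y <= Y')%VS by apply: sub_span => x; rewrite map_cat mem_cat => ->.
case: (IH t1) => [WY|szY]; first by left; apply: subv_trans YY'.
have [g gker gE] := iterh_linear s.
have gY' : (g @: Y <= Y')%VS.
  rewrite limg_span; apply: sub_span => _ /mapP[_ /mapP[n nt ->] ->].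
  rewrite gE -orbD map_cat mem_cat; apply/orP; right.
  by apply/map_f/map_f.
have [eqY|neY] := eqVneq Y Y'; last first.
  right; apply: leq_ltn_trans szY _; rewrite ltn_neqAle dimvS // andbT.
  by apply: contra neY => /eqP e; rewrite eqEdim YY' e leqnn.
left; apply: subv_trans YY'.
have Yg n : orb n \in Y -> orb (s + n) \in Y.
  by move=> oY; rewrite orbD -gE eqY (subvP gY') // memv_img.
have := nd s1 hW.
have Yn k : orb (n0 + s * k) \in Y.
  elim: k => [|k IHk]; last by rewrite mulnS addnCA; exact: Yg.
  by rewrite muln0 addn0; apply/memv_span/map_f/mem_cube0.
(* [Y] contains the image under [h^n0] of the orbit of [v] under [h^s], whose span is [W] by
   nondegeneracy; inside [W] this image of [W] is all of [W] by dimension. *)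
have [g0 g0ker g0E] := iterh_linear n0.
move=> [Ws Wsmin].
have sub : (W <= g0 @^-1: Y)%VS.
  by apply: Wsmin => k; rewrite -memv_preim g0E -orbD.
have g0W : (g0 @: W <= Y)%VS.
  by apply/subvP => _ /memv_imgP[x xW ->]; rewrite memv_preim (subvP sub).
apply: subv_trans (g0W).
have g0WW : (g0 @: W <= W)%VS by apply: subv_trans g0W (Ysub _).
have dimg : \dim (g0 @: W) = \dim W by apply: limg_dim_eq; rewrite g0ker capv0.
suff -> : (g0 @: W)%VS = W by [].
by apply/eqP; rewrite eqEdim g0WW dimg leqnn.
Qed.

Lemma color_span (r : nat) : exists L : nat, forall c : nat -> 'I_r,
  exists i, forall n, orb n \in <<[seq orb n' | n' <- iota 0 L.+1 & c n' == i]>>%VS.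
Proof.
have [W hW] := hull_ex 1.
have [L LP] := hilbert_cube r (\dim W).
exists L => c; have [n0 [ss [sz ss1 ssL cs]]] := LP c.
exists (c n0) => n.
have : orb n \in W by have := hW.1 n; rewrite mul1n.
apply: subvP; apply: subv_trans (cube_span n0 hW ss1 sz) _.
apply: sub_span => _ /mapP[n' n's ->]; apply: map_f.
by rewrite mem_filter cs // eqxx mem_iota /= ltnS (allP ssL).
Qed.

End Orbits.

(* [N] minimizes the dimension of the span of the [orb (N * n)]. *)
Lemma nondegenerate_power (F : fieldType) (V : vectType F) (h : 'End(V)) (v : V) :
  exists2 N, (0 < N)%N & forall h' : 'End(V), (forall x, h' x = iter N h x) ->
    nondegenerate h' v.
Proof.
pose P d := `[< exists N W, [/\ (0 < N)%N, is_hull h v N W & \dim W = d] >].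
have Pex : exists d, P d.
  by have [W hW] := hull_ex h v 1; exists (\dim W); apply/asboolP; exists 1%N, W.
case: (ex_minnP Pex) => d /asboolP[N [W [N0 hW dW]]] dmin.
exists N => // h' h'E.
have orbE n : orb h' v n = orb h v (N * n).
  elim: n => [|n IHn]; first by rewrite muln0.
  by rewrite mulnS (orbD h) /= -h'E -IHn.
have hullE M X : is_hull h' v M X <-> is_hull h v (N * M) X.
  split=> -[H1 H2]; split=> [n|X' H].
  - by rewrite -mulnA -orbE.
  - by apply: H2 => n; rewrite orbE mulnA.
  - by rewrite orbE mulnA.
  - by apply: H2 => n; rewrite -mulnA -orbE.
move=> M X M0 /hullE; rewrite muln1 => hX; apply/hullE.
have [Y hY] := hull_ex h v (N * M).
suff -> : X = Y by [].
have YX : (Y <= X)%VS by apply: hY.2 => n; rewrite -mulnA hX.1.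
have WX : (W <= X)%VS by apply: hW.2 => n; apply: hX.1.
have XW : (X <= W)%VS by apply: hX.2 => n; apply: hW.1.
apply/esym/eqP; rewrite eqEdim YX /=; apply: leq_trans (dimvS XW) _.
rewrite dW; apply: dmin; apply/asboolP; exists (N * M)%N, Y; split=> //.
by rewrite muln_gt0 N0.
Qed.

Lemma orb_hull_late (F : fieldType) (V : vectType F) (h : 'End(V)) (v : V) (a : nat) :
  lker h = 0%VS ->
  exists s : seq nat, all (leq a) s /\ v \in <<[seq orb h v n | n <- s]>>%VS.
Proof.
move=> hinj; have [s sX Xs] := finite_spanning_subset (fun x => exists2 n, (a <= n)%N & x = orb h v n).
have [W hW] := hull_ex h v 1.
have WS : (W <= << s >>)%VS.
  apply: (hull_shift hinj (a := a) hW) => n; rewrite muln1 mul1n.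
  by apply: Xs; exists (a + n)%N => //; rewrite leq_addr.
have vs : v \in << s >>%VS by apply: (subvP WS); apply: (hW.1 0%N).
have /choice[f fP] (x : V) : exists n, x \in s -> (a <= n)%N /\ x = orb h v n.
  case: (boolP (x \in s)) => [/sX[n]|_]; [by exists n|by exists 0%N].
exists (map f s); split; first by apply/allP => _ /mapP[x /fP[? _] ->].
have -> // : [seq orb h v n | n <- map f s] = s.
by rewrite -map_comp -[RHS]map_id; apply/eq_in_map => x /fP[_ e] /=; rewrite -e.
Qed.

(** * The real-valued modulus and bounds for linear functionals *)

Section Norm.
Variable R : rcfType.
Local Notation nrm := (@Normc.normc R).

Lemma nrm_ge0 (x : R[i]) : 0 <= nrm x.
Proof. by case: x => a b; apply: sqrtr_ge0. Qed.

Lemma nrm_eq0 (x : R[i]) : (nrm x == 0) = (x == 0).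
Proof.
by apply/eqP/eqP => [/Normc.eq0_normc|->] //; exact: Normc.normc0.
Qed.

Lemma nrm_gt0 (x : R[i]) : (0 < nrm x) = (x != 0).
Proof. by rewrite lt_neqAle nrm_ge0 andbT eq_sym nrm_eq0. Qed.

Lemma nrm_sum (I : Type) (s : seq I) (P : pred I) (f : I -> R[i]) :
  nrm (\sum_(i <- s | P i) f i) <= \sum_(i <- s | P i) nrm (f i).
Proof.
elim/big_rec2: _ => [|i y x _ le_xy]; first by rewrite Normc.normc0.
by apply: le_trans (le_normcD _ _) _; rewrite lerD2l.
Qed.

Lemma nrm_prod (I : Type) (s : seq I) (P : pred I) (f : I -> R[i]) :
  nrm (\prod_(i <- s | P i) f i) = \prod_(i <- s | P i) nrm (f i).
Proof. by apply: big_morph; [exact: Normc.normcM|exact: Normc.normc1]. Qed.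

Lemma nrmX (x : R[i]) n : nrm (x ^+ n) = nrm x ^+ n.
Proof.
by elim: n => [|n IH]; rewrite ?expr0 ?Normc.normc1 // !exprS Normc.normcM IH.
Qed.

(** The constant is the sum of the moduli of the coordinates of [x], hence the same for all
    functionals; this is the source of every uniformity in group elements below. *)
Lemma span_bound (V : vectType R[i]) (X : seq V) (x : V) : x \in <<X>>%VS ->
  exists2 K : R, 0 <= K & forall f : V -> R[i], (forall a x y, f (a *: x + y) = a * f x + f y) ->
    nrm (f x) <= K * \sum_(y <- X) nrm (f y).
Proof.
move=> xX; have xE := coord_span (X := in_tuple X) xX; pose c i := coord (in_tuple X) i x.
exists (\sum_i nrm (c i)) => [|f flin]; first by apply: sumr_ge0 => i _; exact: nrm_ge0.
have f0 : f 0 = 0.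
  by have := flin (-1) 0 0; rewrite scaler0 addr0 mulN1r addNr.
have fsum : f x = \sum_i c i * f X`_i.
  rewrite xE; elim/big_rec2: _ => // i y1 y2 _ <-; exact: flin.
rewrite fsum; apply: le_trans (nrm_sum _ _ _) _; rewrite mulr_suml.
apply: ler_sum => i _; rewrite Normc.normcM ler_wpM2l ?nrm_ge0 //.
rewrite (big_nth 0) big_mkord (bigD1 i) //= lerDl.
by apply: sumr_ge0 => j _; exact: nrm_ge0.
Qed.

End Norm.

(** * Dominant matrix coefficients *)

Section Representative.
Variables (F : fieldType) (G : groupType).

Definition mx_hom D (Th : G -> 'M[F]_D) :=
  Th 1%g = 1%:M /\ forall g h, Th (g * h)%g = Th g *m Th h.

Definition rep_fun (f : G -> F) := exists D (Th : G -> 'M[F]_D) (u : 'rV_D) (v : 'cV_D),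
  mx_hom Th /\ forall g, f g = (u *m Th g *m v) 0 0.

(** One representation serves the whole family, so that a single spanning relation bounds all its
    members. *)
Definition rep_fam (r : nat) (f : 'I_r -> G -> F) :=
  exists D (Th : G -> 'M[F]_D) (u : 'I_r -> 'rV_D) (v : 'I_r -> 'cV_D),
  mx_hom Th /\ forall i g, f i g = (u i *m Th g *m v i) 0 0.

Lemma mx_hom_block D D' (Th : G -> 'M[F]_D) (Th' : G -> 'M[F]_D') :
  mx_hom Th -> mx_hom Th' -> mx_hom (fun g => block_mx (Th g) 0 0 (Th' g)).
Proof.
move=> [h1 hM] [h1' hM']; split=> [|g h]; first by rewrite h1 h1' -scalar_mx_block.
by rewrite mulmx_block !mul0mx !mulmx0 !addr0 !add0r hM hM'.
Qed.

Lemma rep_fam_intro r (f : 'I_r -> G -> F) : (forall i, rep_fun (f i)) -> rep_fam f.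
Proof.
elim: r f => [|r IH] f fP.
  exists 0%N, (fun _ => 1%:M), (fun _ => 0), (fun _ => 0); split.
    by split=> // g h; rewrite mul1mx.
  by case.
have [D [Th [u [v [Thom fE]]]]] := IH (fun i => f (lift ord0 i)) (fun i => fP _).
have [D' [Th' [u' [v' [Thom' fE']]]]] := fP ord0.
exists (D' + D)%N, (fun g => block_mx (Th' g) 0 0 (Th g)).
exists (fun i => if unlift ord0 i is Some j then row_mx 0 (u j) else row_mx u' 0).
exists (fun i => if unlift ord0 i is Some j then col_mx 0 (v j) else col_mx v' 0).
split; first exact: mx_hom_block.
move=> i g; case: unliftP => [j ->|->].
  by rewrite mul_row_block mul_row_col ?(mulmx0, mul0mx, add0r) fE.
by rewrite mul_row_block mul_row_col ?(mulmx0, mul0mx, addr0) fE'.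
Qed.

Lemma rep_fun_ext f g : f =1 g -> rep_fun f -> rep_fun g.
Proof.
by move=> fg [D [Th [u [v [H E]]]]]; exists D, Th, u, v; split=> // x; rewrite -fg.
Qed.

Lemma rep_fun_const c : rep_fun (fun _ => c).
Proof.
exists 1%N, (fun _ => 1%:M), c%:M, 1%:M; split; first by split=> // *; rewrite mul1mx.
by move=> _; rewrite !mulmx1 mxE eqxx.
Qed.

Lemma rep_fun_add f g : rep_fun f -> rep_fun g -> rep_fun (fun x => f x + g x).
Proof.
move=> [D [Th [u [v [H E]]]]] [D' [Th' [u' [v' [H' E']]]]].
exists (D + D')%N, (fun g => block_mx (Th g) 0 0 (Th' g)), (row_mx u u'), (col_mx v v').
split; first exact: mx_hom_block.
by move=> x; rewrite mul_row_block mul_row_col !mulmx0 addr0 add0r mxE -E -E'.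
Qed.

(** A product of matrix coefficients is a coefficient of the tensor product. *)
Lemma rep_fun_mul f g : rep_fun f -> rep_fun g -> rep_fun (fun x => f x * g x).
Proof.
move=> [D [Th [u [v [[H1 HM] E]]]]] [D' [Th' [u' [v' [[H1' HM'] E']]]]].
exists (D * D')%N, (fun g => Th g *t Th' g), (u *t u'), (v *t v').
split; first split.
- rewrite H1 H1'; apply/matrixP => i j.
  case: (mxtens_indexP i) => i0 i1; case: (mxtens_indexP j) => j0 j1.
  rewrite tensmxE !mxE (inj_eq (can_inj (@mxtens_indexK _ _))) xpair_eqE.
  by case: eqP; case: eqP; rewrite ?mulr1 ?mulr0.
- by move=> x y; rewrite HM HM' tensmx_mul.
move=> x; rewrite E E' -tensmxE.
have -> : (u *m Th x *m v) *t (u' *m Th' x *m v') = (u *t u') *m (Th x *t Th' x) *m (v *t v').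
  by rewrite !tensmx_mul.
by congr (fun_of_matrix _ _ _); apply: val_inj.
Qed.

Lemma rep_fun_sum (I : Type) (s : seq I) (P : pred I) (f : I -> G -> F) :
  (forall i, P i -> rep_fun (f i)) -> rep_fun (fun x => \sum_(i <- s | P i) f i x).
Proof.
move=> fP; elim: s => [|i s IH].
  by apply: rep_fun_ext (rep_fun_const 0) => x; rewrite big_nil.
case Pi: (P i); last by apply: rep_fun_ext IH => x; rewrite big_cons Pi.
by apply: rep_fun_ext (rep_fun_add (fP _ Pi) IH) => x; rewrite big_cons Pi.
Qed.

Lemma rep_fun_entry D (Th : G -> 'M[F]_D) i j : mx_hom Th -> rep_fun (fun g => Th g i j).
Proof.
move=> H; exists D, Th, (delta_mx 0 i), (delta_mx j 0); split=> // g.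
by rewrite -rowE -colE !mxE.
Qed.

Definition rep_poly (f : G -> {poly F}) := forall n, rep_fun (fun g => (f g)`_n).

Lemma rep_poly_const c : rep_poly (fun _ => c).
Proof. by move=> n; exact: rep_fun_const. Qed.

Lemma rep_poly_ext f g : f =1 g -> rep_poly f -> rep_poly g.
Proof. by move=> fg H n; apply: rep_fun_ext (H n) => x; rewrite fg. Qed.

Lemma rep_polyD f g : rep_poly f -> rep_poly g -> rep_poly (fun x => f x + g x).
Proof.
by move=> Hf Hg n; apply: rep_fun_ext (rep_fun_add (Hf n) (Hg n)) => x; rewrite coefD.
Qed.

Lemma rep_polyM f g : rep_poly f -> rep_poly g -> rep_poly (fun x => f x * g x).
Proof.
move=> Hf Hg n; apply: rep_fun_ext (fun x => esym (coefM (f x) (g x) n)) _.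
by apply: rep_fun_sum => i _; apply: rep_fun_mul.
Qed.

Lemma rep_poly_sum (I : Type) (s : seq I) (P : pred I) (f : I -> G -> {poly F}) :
  (forall i, P i -> rep_poly (f i)) -> rep_poly (fun x => \sum_(i <- s | P i) f i x).
Proof.
move=> fP n; apply: rep_fun_ext (fun x => esym (coef_sum _ _ _ n)) _.
by apply: rep_fun_sum => i Pi; exact: fP.
Qed.

Lemma rep_poly_prod (I : Type) (s : seq I) (P : pred I) (f : I -> G -> {poly F}) :
  (forall i, P i -> rep_poly (f i)) -> rep_poly (fun x => \prod_(i <- s | P i) f i x).
Proof.
move=> fP; elim: s => [|i s IH].
  by apply: rep_poly_ext (rep_poly_const 1) => x; rewrite big_nil.
case Pi: (P i); last by apply: rep_poly_ext IH => x; rewrite big_cons Pi.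
by apply: rep_poly_ext (rep_polyM (fP _ Pi) IH) => x; rewrite big_cons Pi.
Qed.

Lemma rep_poly_det D (A : G -> 'M[{poly F}]_D) :
  (forall i j, rep_poly (fun g => A g i j)) -> rep_poly (fun g => \det (A g)).
Proof.
move=> AP; apply: rep_poly_sum => s _; apply: rep_polyM; first exact: rep_poly_const.
by apply: rep_poly_prod => i _.
Qed.

End Representative.

Lemma sandwich_linear (F : fieldType) (D : nat) (u : 'rV[F]_D) (A B : 'M[F]_D)
    (v : 'cV[F]_D) (a : F) (X Y : 'M[F]_D) :
  (u *m (A *m (a *: X + Y) *m B) *m v) 0 0 =
  a * (u *m (A *m X *m B) *m v) 0 0 + (u *m (A *m Y *m B) *m v) 0 0.
Proof.
rewrite mulmxDr mulmxDl mulmxDr mulmxDl -scalemxAr -scalemxAl -scalemxAr -scalemxAl.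
by rewrite mxE mxE.
Qed.

Section PowerSpans.
Variables (F : fieldType) (G : groupType) (D : nat) (Th : G -> 'M[F]_D).
Hypothesis Thom : mx_hom Th.

(** The orbit of the identity matrix under this endomorphism is the sequence of the [Th (x ^+ n)],
    which brings the orbit lemmas to bear on powers of [x]. *)
Definition rmul (x : G) : 'End('M[F]_D) := linfun (mulmxr (Th x)).

Lemma rmulE x A : rmul x A = A *m Th x.
Proof. by rewrite lfunE. Qed.

Lemma lker_rmul x : lker (rmul x) = 0%VS.
Proof.
apply/eqP/lker0P => A B; rewrite !rmulE => /(congr1 (mulmx^~ (Th x^-1%g))).
by rewrite -!mulmxA -Thom.2 mulgV Thom.1 !mulmx1.
Qed.

Lemma orb_rmul x n : orb (rmul x) 1%:M n = Th (x ^+ n)%g.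
Proof.
elim: n => [|n IH]; first by rewrite /orb /= expg0 Thom.1.
by rewrite /orb iterS -/(orb _ _ _) IH rmulE expgSr Thom.2.
Qed.

Lemma power_color_span (x : G) (r : nat) : exists2 N, (0 < N)%N &
  exists L : nat, forall c : nat -> 'I_r, exists i, forall n,
  Th ((x ^+ N) ^+ n)%g \in <<[seq Th ((x ^+ N) ^+ m)%g | m <- iota 0 L.+1 & c m == i]>>%VS.
Proof.
have [N N0 nd] := nondegenerate_power (rmul x) 1%:M.
exists N => //; have iterE A : rmul (x ^+ N)%g A = iter N (rmul x) A.
  elim: N {N0 nd} A => [|N IH] A; first by rewrite rmulE expg0 Thom.1 mulmx1.
  by rewrite iterS -IH !rmulE expgSr Thom.2 mulmxA.
have [L LP] := color_span (lker_rmul _) (nd _ iterE) r.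
exists L => c; have [i iP] := LP c; exists i => n.
have := iP n; rewrite orb_rmul.
by under eq_map do rewrite orb_rmul.
Qed.

(** Lets estimates that hold only for large exponents bound the value at exponent 0. *)
Lemma one_late_powers (x : G) (a : nat) : exists s : seq nat,
  all (leq a) s /\ Th 1%g \in <<[seq Th (x ^+ m)%g | m <- s]>>%VS.
Proof.
have [s [sa s1]] := orb_hull_late 1%:M a (lker_rmul x).
exists s; split=> //; rewrite Thom.1.
by under eq_map do rewrite -orb_rmul.
Qed.

End PowerSpans.

Section Dominance.
Variables (R : rcfType) (G : groupType) (r D : nat) (Th : G -> 'M[R[i]]_D).
Variables (u : 'I_r.+1 -> 'rV[R[i]]_D) (v : 'I_r.+1 -> 'cV[R[i]]_D).
Hypothesis Thom : mx_hom Th.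
Local Notation nrm := (@Normc.normc R).

Definition mxcoef i g := (u i *m Th g *m v i) 0 0.
Local Notation tau := mxcoef.

(** A linear relation between matrices survives multiplication from both sides, so [K] is
    independent of [g] and [h]. *)
Lemma mxcoef_bound (x y : G) (s : seq nat) : Th x \in <<[seq Th (y ^+ m)%g | m <- s]>>%VS ->
  exists2 K : R, 0 <= K & forall i g h,
    nrm (tau i (g * x * h)%g) <= K * \sum_(m <- s) nrm (tau i (g * y ^+ m * h)%g).
Proof.
move=> /span_bound[K K0 KP]; exists K => // i g h.
have := KP (fun X => (u i *m (Th g *m X *m Th h) *m v i) 0 0).
rewrite big_map /tau !Thom.2; under [in X in (_ -> X) -> _]eq_bigr do rewrite -!Thom.2.
by apply=> a X Y; exact: sandwich_linear.
Qed.

Variables (y : G) (L : nat).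
Hypothesis spanL : forall c : nat -> 'I_r.+1, exists i, forall n,
  Th (y ^+ n)%g \in <<[seq Th (y ^+ m)%g | m <- iota 0 L.+1 & c m == i]>>%VS.

(** A substitute for the modulus of [tau i g]: a single value may vanish, whereas this sum changes
    by a bounded factor when [g] becomes [g * y]. *)
Definition window i g : R := \sum_(m <- iota 0 L.+1) nrm (tau i (g * y ^+ m)%g).

Lemma window_ge0 i g : 0 <= window i g.
Proof. by apply: sumr_ge0 => m _; exact: nrm_ge0. Qed.

Lemma le_window i g m : (m <= L)%N -> nrm (tau i (g * y ^+ m)%g) <= window i g.
Proof.
move=> mL; have mi : m \in iota 0 L.+1 by rewrite mem_iota add0n ltnS mL.
rewrite /window (big_rem _ mi) /= lerDl.
by apply: sumr_ge0 => *; exact: nrm_ge0.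
Qed.

Lemma window_all n : exists2 K : R, 0 <= K &
  forall i g, nrm (tau i (g * y ^+ n)%g) <= K * window i g.
Proof.
have [j jP] := spanL (fun _ => ord0).
have : Th (y ^+ n)%g \in <<[seq Th (y ^+ m)%g | m <- iota 0 L.+1]>>%VS.
  apply: (subvP (sub_span _)) (jP n).
  by move=> X /mapP[m]; rewrite mem_filter => /andP[_ mi] ->; exact: map_f.
move=> /mxcoef_bound[K K0 KP]; exists K => // i g.
by have := KP i g 1%g; rewrite mulg1; under eq_bigr do rewrite mulg1.
Qed.

Lemma window_color : exists2 K : R, 1 <= K & forall c : nat -> 'I_r.+1, exists j,
  forall i g, window i g <= K * \sum_(m <- iota 0 L.+1 | c m == j) nrm (tau i (g * y ^+ m)%g).
Proof.
(* Only the restriction of a coloring to the window matters; there are finitely many of these, so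
   the sum of their constants serves all colorings. *)
have ex (c : {ffun 'I_L.+1 -> 'I_r.+1}) : exists K, 0 <= K /\ exists j, forall i g,
    window i g <= K * \sum_(m <- iota 0 L.+1 | c (inord m) == j) nrm (tau i (g * y ^+ m)%g).
  have [j jP] := spanL (fun m => c (inord m)).
  have /choice[Kf KfP] (n : nat) : exists K, 0 <= K /\ forall i g, nrm (tau i (g * y ^+ n)%g)
      <= K * \sum_(m <- iota 0 L.+1 | c (inord m) == j) nrm (tau i (g * y ^+ m)%g).
    have /mxcoef_bound[K K0 KP] := jP n; exists K; split=> // i g.
    by have := KP i g 1%g; rewrite mulg1 big_filter; under eq_bigr do rewrite mulg1.
  exists (\sum_(n <- iota 0 L.+1) Kf n); split.
    by apply: sumr_ge0 => n _; have [] := KfP n.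
  exists j => i g; rewrite /window mulr_suml; apply: ler_sum => n _.
  by have [_] := KfP n; apply.
have [Kf KfP] := choice ex.
exists (1 + \sum_c Kf c) => [|c].
  by rewrite lerDl sumr_ge0 // => c _; case: (KfP c).
pose cf : {ffun 'I_L.+1 -> 'I_r.+1} := [ffun m : 'I_L.+1 => c m].
have [_ [j jP]] := KfP cf; exists j => i g; apply: le_trans (jP i g) _.
have -> : \sum_(m <- iota 0 L.+1 | cf (inord m) == j) nrm (tau i (g * y ^+ m)%g)
    = \sum_(m <- iota 0 L.+1 | c m == j) nrm (tau i (g * y ^+ m)%g).
  rewrite big_seq_cond [RHS]big_seq_cond; apply: eq_bigl => m.
  case: (boolP (m \in _)) => [|_]; last by rewrite !andFb.
  by rewrite mem_iota add0n ffunE => mL; rewrite inordK.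
apply: ler_wpM2r; first by apply: sumr_ge0 => m _; exact: nrm_ge0.
rewrite (bigD1 cf) //= addrCA lerDl addr_ge0 //.
by apply: sumr_ge0 => d _; case: (KfP d).
Qed.

(** Consecutive windows differ in one value at each end. The new last value is bounded by spanning;
    the lost first one by writing the identity through positive powers of [y]. *)
Lemma window_shift : exists2 K : R, 1 <= K & forall i g,
  window i (g * y)%g <= K * window i g /\ window i g <= K * window i (g * y)%g.
Proof.
have [K1 K10 K1P] := window_all L.+1.
have [s [s1 sP]] := one_late_powers Thom y 1.
have [K2 K20 K2P] := mxcoef_bound sP.
have /choice[Kf KfP] (n : nat) : exists K, 0 <= K /\
    forall i g, nrm (tau i (g * y ^+ n)%g) <= K * window i g.
  by have [K K0 KP] := window_all n; exists K.
pose K3 := K2 * \sum_(m <- s) Kf m.-1.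
have K30 : 0 <= K3.
  by rewrite mulr_ge0 // sumr_ge0 // => m _; case: (KfP m.-1).
have yS g n : (g * y * y ^+ n = g * y ^+ n.+1)%g by rewrite -mulgA -expgS.
have split_window i g : window i g = nrm (tau i g) + \sum_(m <- iota 0 L) nrm (tau i (g * y * y ^+ m)%g).
  rewrite /window /= big_cons expg0 mulg1; congr (_ + _).
  by rewrite (iotaDl 1 0) big_map; apply: eq_bigr => m _; rewrite yS.
have split_window' i g : window i (g * y)%g =
    \sum_(m <- iota 0 L) nrm (tau i (g * y * y ^+ m)%g) + nrm (tau i (g * y ^+ L.+1)%g).
  by rewrite /window -addn1 iotaD big_cat big_seq1 /= add0n yS addn1.
exists (1 + (K1 + K3)) => [|i g]; first by rewrite lerDl addr_ge0.
have w0 := window_ge0 i g; have w0' := window_ge0 i (g * y)%g.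
have h1 : nrm (tau i g) <= K3 * window i (g * y)%g.
  have := K2P i g 1%g; rewrite !mulg1 => /le_trans; apply.
  rewrite /K3 -mulrA ler_wpM2l // mulr_suml big_seq [X in _ <= X]big_seq.
  apply: ler_sum => m ms; have m0 := allP s1 _ ms.
  rewrite mulg1; have [_ /(_ i (g * y)%g)] := KfP m.-1.
  by rewrite yS prednK.
clearbody K3; have h2 := K1P i g; have t1 := nrm_ge0 (tau i g).
have t2 := nrm_ge0 (tau i (g * y ^+ L.+1)%g).
move: (split_window i g) (split_window' i g) w0 w0' h1 h2 t1 t2.
move: (\sum_(m <- _) _) (window i g) (window i (g * y)%g) (nrm _) (nrm _).
move=> S w w' t t' -> -> w0 w0' h1 h2 t0 t0'.
by split; nra.
Qed.

End Dominance.

(** * Sequences negligible against a geometric one *)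

Section Negligible.
Variable R : realFieldType.

Definition eventually_nat (P : nat -> Prop) := exists N, forall n, (N <= n)%N -> P n.

Lemma eventually_and P Q : eventually_nat P -> eventually_nat Q ->
  eventually_nat (fun n => P n /\ Q n).
Proof.
move=> [N NP] [M MP]; exists (maxn N M) => n; rewrite geq_max => /andP[Nn Mn].
by split; [exact: NP|exact: MP].
Qed.

Definition negligible (mu : R) (f : nat -> R) :=
  forall e, 0 < e -> eventually_nat (fun n => f n <= e * mu ^+ n).

Lemma negligible0 mu : 0 < mu -> negligible mu (fun _ => 0).
Proof. by move=> mu0 e e0; exists 0%N => n _; rewrite mulr_ge0 ?exprn_ge0 ?ltW. Qed.

Lemma negligible_le mu f g : (forall n, f n <= g n) -> negligible mu g -> negligible mu f.
Proof.
by move=> fg gn e /gn[N NP]; exists N => n /NP; apply: le_trans.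
Qed.

Lemma negligibleD mu f g : negligible mu f -> negligible mu g ->
  negligible mu (fun n => f n + g n).
Proof.
move=> Hf Hg e e0; have e2 : 0 < e / 2 by lra.
have [N NP] := eventually_and (Hf _ e2) (Hg _ e2).
exists N => n /NP[h1 h2]; lra.
Qed.

Lemma negligibleZ mu c f : 0 < mu -> 0 <= c -> negligible mu f ->
  negligible mu (fun n => c * f n).
Proof.
move=> mu0 c0 Hf; have [->|c1] := eqVneq c 0.
  by apply: negligible_le (negligible0 mu0) => n; rewrite mul0r.
have {}c0 : 0 < c by rewrite lt_neqAle eq_sym c1.
move=> e e0; have [N NP] := Hf (e / c) (divr_gt0 e0 c0).
by exists N => n /NP; rewrite -ler_pdivlMl // mulrA [c^-1 * e]mulrC.
Qed.

Lemma negligible_sum (I : Type) (s : seq I) mu (f : I -> nat -> R) : 0 < mu ->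
  (forall i, negligible mu (f i)) -> negligible mu (fun n => \sum_(i <- s) f i n).
Proof.
move=> mu0 H; elim: s => [|i s IH].
  by apply: negligible_le (negligible0 mu0) => n; rewrite big_nil.
by apply: negligible_le (negligibleD (H i) IH) => n; rewrite big_cons.
Qed.

Lemma negligible_seq (I : eqType) (s : seq I) mu (f : I -> nat -> R) : 0 < mu ->
  (forall i, i \in s -> negligible mu (f i)) -> negligible mu (fun n => \sum_(i <- s) f i n).
Proof.
move=> mu0; elim: s => [|i s IH] H.
  by apply: negligible_le (negligible0 mu0) => n; rewrite big_nil.
have Hs : negligible mu (fun n => \sum_(i <- s) f i n).
  by apply: IH => j js; apply: H; rewrite inE js orbT.
by apply: negligible_le (negligibleD (H i (mem_head _ _)) Hs) => n; rewrite big_cons.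
Qed.

Lemma negligible_shift mu f k : 0 < mu -> negligible mu f ->
  negligible mu (fun n => f (n + k)%N).
Proof.
move=> mu0 Hf e e0; have muk : 0 < mu ^+ k by rewrite exprn_gt0.
have [N NP] := Hf (e / mu ^+ k) (divr_gt0 e0 muk).
exists N => n Nn; have := NP (n + k)%N (leq_trans Nn (leq_addr _ _)).
by rewrite exprD [X in _ * X]mulrC mulrA divfK // gt_eqF.
Qed.

Lemma negligible_absurd mu c f : 0 < mu -> 0 < c ->
  eventually_nat (fun n => c * mu ^+ n <= f n) -> ~ negligible mu f.
Proof.
move=> mu0 c0 Hf /(_ (c / 2)) Hg; have c2 : 0 < c / 2 by lra.
have [N /(_ N (leqnn N))[h1 h2]] := eventually_and Hf (Hg c2).
have : 0 < mu ^+ N by rewrite exprn_gt0.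
nra.
Qed.

End Negligible.

Section Dominance.
Variables (R : rcfType) (G : groupType) (r D : nat) (Th : G -> 'M[R[i]]_D).
Variables (u : 'I_r.+1 -> 'rV[R[i]]_D) (v : 'I_r.+1 -> 'cV[R[i]]_D).
Hypothesis Thom : mx_hom Th.
Local Notation nrm := (@Normc.normc R).
Local Notation tau := (mxcoef Th u v).
Variables (x y : G) (L : nat).
Hypothesis spanL : forall c : nat -> 'I_r.+1, exists i, forall n,
  Th (y ^+ n)%g \in <<[seq Th (y ^+ m)%g | m <- iota 0 L.+1 & c m == i]>>%VS.
Hypothesis dom : forall e : R, 0 < e -> eventually_nat (fun p => forall q, exists i,
  tau i (x ^+ p * y ^+ q)%g != 0 /\ forall j, j != i ->
  nrm (tau j (x ^+ p * y ^+ q)%g) <= e * nrm (tau i (x ^+ p * y ^+ q)%g)).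
Variables (i0 i1 : 'I_r.+1) (mu nu c c' : R).
Hypotheses (mu0 : 0 < mu) (nu0 : 0 < nu) (c0 : 0 < c) (c'0 : 0 < c').
Hypothesis low_x : eventually_nat (fun p => c * mu ^+ p <= nrm (tau i0 (x ^+ p)%g)).
Hypothesis low_y : eventually_nat (fun q => c' * nu ^+ q <= nrm (tau i1 (y ^+ q)%g)).
Hypothesis negl_x : forall i g, i != i0 -> negligible mu (fun p => nrm (tau i (x ^+ p * g)%g)).
Hypothesis negl_y : forall i g, i != i1 -> negligible nu (fun q => nrm (tau i (g * y ^+ q)%g)).

Local Notation window := (window Th u v y L).

(* The coloring of exponents by dominant index has a spanning color on every
   window, which then dominates the window; consecutive windows have comparable
   values, so they share their dominant index. *)
Lemma window_dominance : exists2 K : R, 0 < K & eventually_nat (fun p => exists i, forall q j,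
  j != i -> window j (x ^+ p * y ^+ q)%g <= K * window i (x ^+ p * y ^+ q)%g).
Proof.
have [K1 K1_1 K1P] := window_color u v Thom spanL.
have [K2 K2_1 K2P] := window_shift u v Thom spanL.
have K10 : 0 < K1 by lra.
have K20 : 0 < K2 by lra.
(* With [K1 * e * K2 = 1/2], different dominant indices of two consecutive windows would each be at
   most half of the other. *)
pose e := (2 * K1 * K2)^-1; have e0 : 0 < e by rewrite invr_gt0 !mulr_gt0.
have eK : K1 * e * K2 = 2^-1.
  by rewrite /e; field; rewrite !gt_eqF.
clearbody e; have Ke0 : 0 < K1 * e by rewrite mulr_gt0.
have Ke1 : K1 * e < 1 by nra.
exists (K1 * e) => //; have [P PP] := dom e0; exists P => p Pp.
set w := fun q => (x ^+ p * y ^+ q)%g.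
have /choice[col colP] (q : nat) := PP p Pp q.
pose Dm q i := 0 < window i (w q) /\
  forall j, j != i -> window j (w q) <= K1 * e * window i (w q).
have wS q m : (w q * y ^+ m)%g = w (q + m)%N by rewrite /w -mulgA -expgnDr.
have DmE q : exists i, Dm q i.
  (* The coloring is by the index that dominates at exponent [q + m]; at the exponents of color [i]
     every other index is small. *)
  have [i iP] := K1P (fun m => col (q + m)%N); exists i.
  have small j : j != i -> window j (w q) <= K1 * e * window i (w q).
    move=> ji; apply: le_trans (iP j (w q)) _; rewrite -mulrA ler_pM2l //.
    rewrite /window mulr_sumr [X in _ <= X](bigID (fun m => col (q + m)%N == i)) /=.
    apply: ler_wpDr.
      by apply: sumr_ge0 => m _; rewrite mulr_ge0 ?nrm_ge0 // ltW.
    apply: ler_sum => m /eqP cm; rewrite wS; have [_ /(_ j)] := colP (q + m)%N.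
    by rewrite cm; apply.
  split=> //; rewrite lt_neqAle window_ge0 andbT eq_sym; apply/negP => /eqP w0.
  have [nz _] := colP q; move: nz; rewrite -nrm_gt0 ltNge => /negP; apply.
  have := le_window Th u v y (col q) (w q) (leq0n L); rewrite wS addn0 => /le_trans; apply.
  have [->|/small] := eqVneq (col q) i; first by rewrite w0.
  by rewrite w0 mulr0.
have wy q : (w q * y)%g = w q.+1 by rewrite -[y in LHS]expg1 wS addn1.
have DmS q i j : Dm q i -> Dm q.+1 j -> i = j.
  move=> [wi0 iP] [wj0 jP]; apply/eqP; case: eqVneq => // ij.
  have ji : j != i by rewrite eq_sym.
  have h1 := iP _ ji; have h2 := jP _ ij.
  have [h3 _] := K2P j (w q); have [_ h4] := K2P i (w q); move: h3 h4; rewrite wy => h3 h4.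
  move: h1 h2 h3 h4 wi0 wj0; move: (window i (w q)) (window i (w q.+1)) (window j (w q)) (window j (w q.+1)).
  move=> a a' b b' h1 h2 h3 h4 a0 b'0.
  have h5 : a <= K2 * (K1 * e * b') by apply: le_trans h4 _; rewrite ler_pM2l.
  have h6 : K2 * (K1 * e * b') = 2^-1 * b' by rewrite -eK; ring.
  have h7 : b' <= K2 * (K1 * e * a) by apply: le_trans h3 _; rewrite ler_pM2l.
  have h8 : K2 * (K1 * e * a) = 2^-1 * a by rewrite -eK; ring.
  lra.
have [i D0] := DmE 0%N; exists i => q.
suff : Dm q i by case.
elim: q => [|q IH]; first exact: D0.
have [j jP] := DmE q.+1.
by rewrite (DmS _ _ _ IH jP).
Qed.

(* For [q = 0] the index [i0] dominates; a second spanning argument, now in the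
   powers of [x], lets [q] tend to infinity at only finitely many exponents [p]. *)
Lemma dominant_index_eq : i0 = i1.
Proof.
apply/eqP; case: eqVneq => // i01.
have [K K0 [P0 P0P]] := window_dominance.
have negl_wx i : i != i0 -> negligible mu (fun p => window i (x ^+ p)%g).
  by move=> ii; apply: negligible_sum => // m; exact: negl_x.
have negl_wy i p : i != i1 -> negligible nu (fun q => window i (x ^+ p * y ^+ q)%g).
  move=> ii; apply: negligible_sum => // m.
  have := negligible_shift m nu0 (negl_y (x ^+ p)%g ii).
  by apply: negligible_le => q; rewrite -mulgA -expgnDr.
have le_w i g : nrm (tau i g) <= window i g.
  by have := le_window Th u v y i g (leq0n L); rewrite expg0 mulg1.
(* At [q = 0], any other dominant index would bound [tau i0 (x ^+ p)] by a sequence negligible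
   against [mu ^+ p], contrary to [low_x]. *)
have [P1 dom0] : eventually_nat (fun p => forall q j, j != i0 ->
    window j (x ^+ p * y ^+ q)%g <= K * window i0 (x ^+ p * y ^+ q)%g).
  pose f p := K * \sum_(i <- rem i0 (index_enum 'I_r.+1)) window i (x ^+ p)%g.
  have fn : negligible mu f.
    apply: negligibleZ (ltW K0) _ => //; apply: negligible_seq => // i.
    by rewrite mem_rem_uniq ?index_enum_uniq // inE => /andP[ii _]; exact: negl_wx.
  have c2 : 0 < c / 2 by rewrite divr_gt0.
  have [P1 P1P] := eventually_and low_x (fn _ c2).
  exists (maxn P0 P1) => p; rewrite geq_max => /andP[p0 p1].
  have [i iP] := P0P p p0; have [lo hi] := P1P p p1.
  suff <- : i = i0 by [].
  apply/eqP; case: eqVneq => // ii0; exfalso.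
  have := iP 0%N i0; rewrite expg0 mulg1 eq_sym => /(_ ii0) h.
  have : window i (x ^+ p)%g <= \sum_(j <- rem i0 (index_enum 'I_r.+1)) window j (x ^+ p)%g.
    have ir : i \in rem i0 (index_enum 'I_r.+1).
      by rewrite mem_rem_uniq ?index_enum_uniq // inE ii0 mem_index_enum.
    by rewrite (big_rem _ ir) /= lerDl sumr_ge0 // => *; exact: window_ge0.
  rewrite -(ler_pM2l K0) => h'; have h2 := le_w i0 (x ^+ p)%g.
  have mup : 0 < mu ^+ p by rewrite exprn_gt0.
  have cmu : 0 < c * mu ^+ p by rewrite mulr_gt0.
  have := le_trans lo (le_trans h2 (le_trans h (le_trans h' hi))).
  rewrite mulrAC; move: (c * mu ^+ p) cmu => t t0; lra.
have [s [sP s1]] := one_late_powers Thom x P1.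
have [K' K'0 K'P] := mxcoef_bound u v Thom s1.
exfalso; apply: (negligible_absurd nu0 c'0 low_y).
pose f q := K' * \sum_(p <- s) (K * window i0 (x ^+ p * y ^+ q)%g).
apply: (negligible_le (g := f)) => [q|].
  have := K'P i1 1%g (y ^+ q)%g; rewrite !mul1g => /le_trans; apply.
  rewrite ler_wpM2l // big_seq [X in _ <= X]big_seq; apply: ler_sum => p ps.
  rewrite mul1g; apply: le_trans (le_w _ _) _; apply: dom0; first exact: (allP sP).
  by rewrite eq_sym.
apply: negligibleZ => //; apply: negligible_sum => // p.
by apply: negligibleZ (ltW K0) _ => //; exact: negl_wy.
Qed.

End Dominance.

(** * Growth of characteristic coefficients of products *)

Lemma seq_argmin (R : realDomainType) (T : eqType) (f : T -> R) (s : seq T) : s != [::] ->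
  exists2 x, x \in s & forall y, y \in s -> f x <= f y.
Proof.
elim: s => // a [|b s] IH _.
  by exists a; rewrite ?mem_head // => y; rewrite inE => /eqP->.
have [x xs xP] := IH isT; have [ax|xa] := leP (f a) (f x).
  exists a; rewrite ?mem_head // => y; rewrite inE => /orP[/eqP->//|/xP]; exact: le_trans.
exists x; first by rewrite inE xs orbT.
by move=> y; rewrite inE => /orP[/eqP->|/xP //]; exact: ltW.
Qed.

Lemma similar_det (A : idomainType) d (P M T : 'M[A]_d) :
  \det P != 0 -> P *m M = T *m P -> \det M = \det T.
Proof.
by move=> P0 /(congr1 determinant); rewrite !det_mulmx mulrC => /(mulIf P0).
Qed.

Lemma det_map_polyC (F : fieldType) d (P : 'M[F]_d) :
  P \in unitmx -> \det (map_mx (@polyC F) P) != 0.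
Proof. by move=> Pu; rewrite det_map_mx polyC_eq0 -unitfE -unitmxE. Qed.

Lemma similar_char_poly (F : fieldType) d (P M T : 'M[F]_d) :
  P \in unitmx -> P *m M = T *m P -> char_poly M = char_poly T.
Proof.
move=> /det_map_polyC P0 PM; apply: similar_det P0 _.
rewrite /char_poly_mx mulmxBr mulmxBl -!map_mxM PM; congr (_ - _).
by rewrite scalar_mxC.
Qed.

Section Triangular.
Variable R : rcfType.
Local Notation C := R[i].
Local Notation nrm := (@Normc.normc R).

Lemma lblock_char_poly d (z : C) (w : 'cV[C]_d) (M : 'M[C]_d) :
  char_poly (block_mx (z%:M : 'M[_]_(1, 1)) 0 w M) = ('X - z%:P) * char_poly M.
Proof.
rewrite /char_poly /char_poly_mx map_block_mx map_scalar_mx !raddf0.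
rewrite (_ : 'X%:M = block_mx ('X%:M : 'M[_]_(1, 1)) 0 0 'X%:M); last exact: scalar_mx_block.
rewrite opp_block_mx add_block_mx !oppr0 !addr0 det_lblock.
by rewrite -raddfB /= det_scalar1.
Qed.

(** The first new basis vector is a left eigenvector for an eigenvalue of least modulus; splitting
    off the least one first makes the moduli on the diagonal increase downwards. *)
Lemma min_eigen_block d (M : 'M[C]_(1 + d)) : exists (Q : 'M[C]_(1 + d)) z w M',
  [/\ Q \in unitmx, Q *m M = block_mx (z%:M : 'M[_]_(1, 1)) 0 w M' *m Q &
    forall y, root (char_poly M) y -> nrm z <= nrm y].
Proof.
have [s sE] := closed_field_poly_normal (char_poly M).
rewrite (monicP (char_poly_monic M)) scale1r in sE.
have s0 : s != [::].
  by apply/eqP => s0; have := size_char_poly M; rewrite sE s0 big_nil size_poly1.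
have [z zs zmin] := seq_argmin nrm s0.
have /eigenvalueP[p pM p0] : eigenvalue M z.
  by rewrite eigenvalue_root_char sE root_prod_XsubC.
pose Q := row_ebase p.
have Qu : Q \in unitmx := row_ebase_unit p.
have rk : \rank p = 1%N by rewrite rank_rV p0.
have [c c0 pE] : exists2 c, c != 0 & p = c *: usubmx Q.
  have := mulmx_ebase p; rewrite rk (mx11_scalar (col_ebase p)) mul_scalar_mx -scalemxAl.
  set c := _ 0 0 => <-; exists c.
    have := col_ebase_unit p; rewrite (mx11_scalar (col_ebase p)) -/c unitmxE det_scalar1.
    by rewrite unitfE.
  congr (_ *: _); rewrite -[in LHS](vsubmxK (row_ebase p)).
  rewrite (_ : pid_mx 1 = row_mx 1%:M 0); last first.
    apply/matrixP => i j; rewrite !mxE ord1 /=; case: splitP => k /= jk; rewrite !mxE.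
      by rewrite ord1 in jk *; rewrite jk.
    by rewrite jk.
  by rewrite mul_row_col mul1mx mul0mx addr0.
pose S := Q *m M *m invmx Q.
have SE : Q *m M = S *m Q by rewrite mulmxKV.
have up : usubmx S = row_mx z%:M 0.
  have : usubmx S = z *: usubmx (1%:M : 'M[_]_(1 + d)).
    rewrite -(mulmxV Qu) -!mul_usub_mx.
    have : c *: (usubmx Q *m M) = c *: (z *: usubmx Q).
      by rewrite scalemxAl -pE pM pE scalerA mulrC -scalerA.
    by move/(scalerI c0) => ->; rewrite scalemxAl.
  move=> ->; rewrite (scalar_mx_block _ _ (1 : C)) /block_mx col_mxKu scale_row_mx scaler0.
  by rewrite scalemx1.
exists Q, z, (lsubmx (dsubmx S)), (rsubmx (dsubmx S)); split=> //.
  by rewrite SE -[S in LHS]vsubmxK up -[dsubmx S in LHS]hsubmxK.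
by move=> y; rewrite sE root_prod_XsubC; exact: zmin.
Qed.

(** A lower triangular form that replaces the Jordan form: a row only meets rows with smaller
    diagonal modulus, and its off-diagonal mass is at most [e] times its diagonal modulus. Powers
    are thereby controlled row by row. *)
Definition adapted (e : R) d (T : 'M[C]_d) :=
  [/\ is_trig_mx T, (forall l m, T l m != 0 -> nrm (T m m) <= nrm (T l l)) &
      forall l, \sum_m nrm (T l m) <= (1 + e) * nrm (T l l)].

Lemma adapted_triangular (e : R) d (M : 'M[C]_d) : 0 < e -> M \in unitmx ->
  exists (P T : 'M[C]_d), [/\ P \in unitmx, P *m M = T *m P & adapted e T].
Proof.
elim: d e M => [|d IH] e M e0 Mu.
  exists 1%:M, M; split; rewrite ?unitmx1 ?mulmx1 ?mul1mx //; split; try by case.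
  by apply/is_trig_mxP; case.
rewrite -[d.+1]/(1 + d)%N in M Mu *.
have [Q [z [w [M' [Qu QM zmin]]]]] := min_eigen_block M.
have [z0 M'u] : z != 0 /\ M' \in unitmx.
  have Q0 : \det Q != 0 by rewrite -unitfE -unitmxE.
  move: Mu; rewrite !unitmxE (similar_det Q0 QM) det_lblock det_scalar1 !unitfE.
  by rewrite mulf_eq0 negb_or => /andP.
have charM : char_poly M = ('X - z%:P) * char_poly M'.
  by rewrite (similar_char_poly Qu QM) lblock_char_poly.
have e2 : 0 < e / 2 by lra.
have [P' [T' [P'u PM' [Ttrig Tle Tsum]]]] := IH _ _ e2 M'u.
have char_T' : char_poly M' = \prod_l ('X - (T' l l)%:P).
  by rewrite (similar_char_poly P'u PM') char_poly_trig.
have T'0 l : T' l l != 0.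
  have P0 : \det P' != 0 by rewrite -unitfE -unitmxE.
  move: M'u; rewrite unitmxE (similar_det P0 PM') det_trig // unitfE.
  by move/prodf_neq0; apply.
have zT' l : nrm z <= nrm (T' l l).
  apply: zmin; rewrite charM rootM char_T' (bigD1 l) //= rootM !root_XsubC eqxx.
  by rewrite orTb orbT.
pose w' := P' *m w.
(* Scaling the smaller block by [del = 1 / (1 + S)] scales the new column by [del] and brings its
   entries below [e / 2] times the diagonal ones; the other half of [e] is spent inside the smaller
   block. *)
pose S := \sum_l nrm (w' l 0) / (e / 2 * nrm (T' l l)).
have S0 : 0 <= S.
  by apply: sumr_ge0 => l _; rewrite divr_ge0 ?nrm_ge0 // mulr_ge0 ?nrm_ge0 // ltW.
pose del : R := (1 + S)^-1.
have del0 : 0 < del by rewrite invr_gt0; lra.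
have delw l : del * nrm (w' l 0) <= e / 2 * nrm (T' l l).
  have pos : 0 < e / 2 * nrm (T' l l) by rewrite mulr_gt0 // nrm_gt0.
  rewrite /del mulrC ler_pdivrMr; last by lra.
  rewrite -ler_pdivrMl // mulrC; apply: le_trans (_ : S <= _); last by lra.
  rewrite /S (bigD1 l) //= lerDl sumr_ge0 // => j _.
  by rewrite divr_ge0 ?nrm_ge0 // mulr_ge0 ?nrm_ge0 // ltW.
pose dl := real_complex R del.
have dl0 : dl != 0 by rewrite fmorph_eq0 gt_eqF.
have nrm_dl : nrm dl = del by rewrite /dl /= expr0n addr0 sqrtr_sqr ger0_norm // ltW.
exists (block_mx (1%:M : 'M[_]_(1, 1)) 0 0 (dl *: P') *m Q), (block_mx (z%:M : 'M[_]_(1, 1)) 0 (dl *: w') T').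
split.
- rewrite unitmx_mul Qu andbT unitmxE det_lblock det1 mul1r detZ unitrM.
  by rewrite -unitmxE P'u andbT unitrX // unitfE.
- rewrite -mulmxA QM !mulmxA; congr (_ *m _).
  rewrite !mulmx_block !mul1mx !mul0mx !mulmx0 !mulmx1 !addr0 !add0r.
  by rewrite -!scalemxAl -scalemxAr PM'.
split.
- by rewrite is_trig_block_mx // scalar_mx_is_trig Ttrig eqxx.
- move=> l m; rewrite -(splitK l) -(splitK m).
  case: (fintype.split l) => {}l; case: (fintype.split m) => {}m /=.
  + by rewrite !ord1 lexx.
  + by rewrite block_mxEur mxE eqxx.
  + by move=> _; rewrite !ord1 block_mxEul block_mxEdr !mxE eqxx mulr1n; exact: zT'.
  + by rewrite !block_mxEdr; exact: Tle.
- move=> l; rewrite -(splitK l) big_split_ord /= big_ord1.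
  case: (fintype.split l) => {}l /=.
  + rewrite !ord1 !block_mxEul big1 => [|m _]; last by rewrite block_mxEur mxE Normc.normc0.
    by rewrite addr0 mxE mulrDl mul1r lerDl mulr_ge0 ?nrm_ge0 // ltW.
  rewrite block_mxEdl !block_mxEdr mxE Normc.normcM nrm_dl.
  under eq_bigr do rewrite block_mxEdr.
  have := Tsum l; have := delw l; rewrite /w'.
  move: (\sum_m _) (nrm (T' l l)) (del * _) => x y t h1 h2; lra.
Qed.

End Triangular.

Section Majorant.
Variable R : rcfType.
Local Notation C := R[i].
Local Notation nrm := (@Normc.normc R).

Definition majorant (f : {poly C}) (g : {poly R}) := forall n, nrm f`_n <= g`_n.

Lemma majorantD f g f' g' : majorant f g -> majorant f' g' -> majorant (f + f') (g + g').
Proof.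
move=> h h' n; rewrite !coefD; apply: le_trans (le_normcD _ _) _; exact: lerD.
Qed.

Lemma majorantM f g f' g' : majorant f g -> majorant f' g' -> majorant (f * f') (g * g').
Proof.
move=> h h' n; rewrite !coefM; apply: le_trans (nrm_sum _ _ _) _.
by apply: ler_sum => i _; rewrite Normc.normcM ler_pM ?nrm_ge0.
Qed.

Lemma majorant0 : majorant 0 0.
Proof. by move=> n; rewrite !coef0 Normc.normc0. Qed.

Lemma majorant1 : majorant 1 1.
Proof.
by move=> n; rewrite !coef1; case: eqP => _; rewrite ?Normc.normc0 ?Normc.normc1.
Qed.

Lemma majorant_sum (I : Type) (s : seq I) (P : pred I) f g :
  (forall i, P i -> majorant (f i) (g i)) ->
  majorant (\sum_(i <- s | P i) f i) (\sum_(i <- s | P i) g i).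
Proof.
move=> H; elim/big_rec2: _ => [|i y1 y2 Pi IH]; first exact: majorant0.
by apply: majorantD => //; exact: H.
Qed.

Lemma majorant_prod (I : Type) (s : seq I) (P : pred I) f g :
  (forall i, P i -> majorant (f i) (g i)) ->
  majorant (\prod_(i <- s | P i) f i) (\prod_(i <- s | P i) g i).
Proof.
move=> H; elim/big_rec2: _ => [|i y1 y2 Pi IH]; first exact: majorant1.
by apply: majorantM => //; exact: H.
Qed.

Lemma majorant_sign (b : bool) f g : majorant f g -> majorant ((-1) ^+ b * f) g.
Proof.
case: b => H; last by rewrite expr0 mul1r.
by move=> n; rewrite expr1 mulN1r coefN normcN.
Qed.

Definition one_plus (A : nzRingType) (N : nat) (z : A) : {poly A} := 1 + z *: 'X^N.

(** The bounds depend on the row only, so each of the [d!] permutations contributes the same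
    product. *)
Lemma majorant_det d (A : 'M[{poly C}]_d) (g : 'I_d -> {poly R}) :
  (forall i j, majorant (A i j) (g i)) -> majorant (\det A) ((d`!)%:R *: \prod_i g i).
Proof.
move=> H; rewrite /determinant.
have -> : (d`!)%:R *: \prod_i g i = \sum_(s : 'S_d) \prod_i g i.
  by rewrite sumr_const scaler_nat; congr (_ *+ _); rewrite -card_Sn.
apply: majorant_sum => s _; apply: majorant_sign.
by apply: majorant_prod => i _.
Qed.

(** For [N > 0] the coefficient of [X^(N i)] is the [i]-th elementary symmetric function of the
    eigenvalues. *)
Definition detpoly d (N : nat) (M : 'M[C]_d) : {poly C} :=
  \det (1%:M + 'X^N *: map_mx polyC M).

Lemma detpoly_similar d N (P M T : 'M[C]_d) :
  P \in unitmx -> P *m M = T *m P -> detpoly N M = detpoly N T.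
Proof.
move=> /det_map_polyC P0 PM; apply: similar_det P0 _.
by rewrite mulmxDr mulmxDl mulmx1 mul1mx -scalemxAr -scalemxAl -!map_mxM PM.
Qed.

Lemma detpoly_trig d N (T : 'M[C]_d) : is_trig_mx T ->
  detpoly N T = \prod_l one_plus N (T l l).
Proof.
move=> /is_trig_mxP Tt; rewrite /detpoly det_trig.
  by apply: eq_bigr => l _; rewrite !mxE eqxx /one_plus mulrC -mul_polyC.
apply/is_trig_mxP => i j ij; rewrite !mxE Tt // mulr0 addr0.
by rewrite -val_eqE (ltn_eqF ij).
Qed.

(** Eigenvalues are only known through a factorization of the characteristic polynomial; this makes
    their enumeration irrelevant in symmetric expressions. *)
Lemma char_poly_perm d (M : 'M[C]_d) (z z' : 'I_d -> C) :
  char_poly M = \prod_l ('X - (z l)%:P) -> char_poly M = \prod_l ('X - (z' l)%:P) ->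
  perm_eq (codom z) (codom z').
Proof.
move=> -> h; apply: prod_XsubC_eq.
by rewrite /codom !big_image.
Qed.

Lemma perm_codom_prod d (A : comNzRingType) (z z' : 'I_d -> C) (f : C -> A) :
  perm_eq (codom z) (codom z') -> \prod_l f (z l) = \prod_l f (z' l).
Proof.
move=> zz'; have h (y : 'I_d -> C) : \prod_l f (y l) = \prod_(x <- codom y) f x.
  by rewrite /codom big_image.
by rewrite !h; apply: perm_big.
Qed.

Lemma detpolyE d N (M : 'M[C]_d) (z : 'I_d -> C) : M \in unitmx ->
  char_poly M = \prod_l ('X - (z l)%:P) -> detpoly N M = \prod_l one_plus N (z l).
Proof.
move=> Mu zE; have [P [T [Pu PM [Tt _ _]]]] := adapted_triangular ltr01 Mu.
rewrite (detpoly_similar N Pu PM) detpoly_trig //.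
apply: (perm_codom_prod (one_plus N)); apply: (char_poly_perm _ zE).
by rewrite (similar_char_poly Pu PM) char_poly_trig.
Qed.

Lemma similar_expr d (P M T : 'M[C]_d) p : P *m M = T *m P -> P *m M ^+ p = T ^+ p *m P.
Proof.
move=> PM; elim: p => [|p IH]; first by rewrite !expr0 mulmx1 mul1mx.
by rewrite !exprS -!mulmxE mulmxA PM -mulmxA IH mulmxA.
Qed.

Lemma trig_expr d (T : 'M[C]_d) p : is_trig_mx T ->
  is_trig_mx (T ^+ p) /\ forall l, (T ^+ p) l l = T l l ^+ p.
Proof.
move=> Tt; elim: p => [|p [/is_trig_mxP IHt IH]].
  by rewrite expr0; split=> [|l]; rewrite ?scalar_mx_is_trig // mxE eqxx.
move/is_trig_mxP in Tt; rewrite exprS -mulmxE; split.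
  apply/is_trig_mxP => i j ij; rewrite mxE big1 // => k _.
  have [ik|ki] := ltnP i k; first by rewrite Tt ?mul0r.
  by rewrite IHt ?mulr0 //; apply: leq_ltn_trans ij.
move=> l; rewrite mxE (bigD1 l) //= IH exprS big1 ?addr0 // => k kl.
have [lk|kl'] := ltnP l k; first by rewrite Tt ?mul0r.
by rewrite IHt ?mulr0 // ltn_neqAle kl' andbT.
Qed.

Lemma char_poly_expr d (M : 'M[C]_d) (z : 'I_d -> C) p : M \in unitmx ->
  char_poly M = \prod_l ('X - (z l)%:P) -> char_poly (M ^+ p) = \prod_l ('X - (z l ^+ p)%:P).
Proof.
move=> Mu zE; have [P [T [Pu PM [Tt _ _]]]] := adapted_triangular ltr01 Mu.
have [Tpt Tp] := trig_expr p Tt.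
rewrite (similar_char_poly Pu (similar_expr p PM)) char_poly_trig //.
rewrite (eq_bigr (fun l => 'X - (T l l ^+ p)%:P)) => [|l _]; last by rewrite Tp.
apply: (perm_codom_prod (fun x => 'X - (x ^+ p)%:P)); apply: (char_poly_perm _ zE).
by rewrite (similar_char_poly Pu PM) char_poly_trig.
Qed.

(** Row [l] of [T * T ^+ p] only involves rows [k] of [T ^+ p] with [T l k] nonzero, whose bounds by
    induction are at most that of row [l]. *)
Lemma adapted_expr e d (T : 'M[C]_d) p l : 0 < e -> adapted e T ->
  \sum_m nrm ((T ^+ p) l m) <= ((1 + e) * nrm (T l l)) ^+ p.
Proof.
move=> e0 [_ Tle Tsum]; elim: p l => [|p IH] l.
  rewrite !expr0 (bigD1 l) //= big1 => [|m ml]; last first.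
    by rewrite mxE eq_sym (negbTE ml) Normc.normc0.
  by rewrite mxE eqxx Normc.normc1 addr0.
apply: (@le_trans _ _ (\sum_m \sum_k nrm (T l k) * nrm ((T ^+ p) k m))).
  apply: ler_sum => m _; rewrite exprS -mulmxE mxE; apply: le_trans (nrm_sum _ _ _) _.
  by under eq_bigr do rewrite Normc.normcM.
rewrite exchange_big /= exprS.
have e1 : 0 <= 1 + e by lra.
apply: le_trans (ler_wpM2r _ (Tsum l)); last by rewrite exprn_ge0 // mulr_ge0 ?nrm_ge0.
rewrite mulr_suml; apply: ler_sum => k _; rewrite -mulr_sumr.
have [->|Tlk] := eqVneq (T l k) 0; first by rewrite Normc.normc0 !mul0r.
apply: ler_wpM2l; first exact: nrm_ge0.
apply: le_trans (IH k) _; apply: lerXn2r; rewrite ?nnegrE ?mulr_ge0 ?nrm_ge0 //.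
by apply: ler_wpM2l => //; exact: Tle.
Qed.

(** In an adapted basis each row of the product is at most a constant times a power of [1 + e] times
    its own eigenvalue modulus, and the Leibniz formula multiplies the row bounds. The loss [1 + e]
    is later taken small against the gap. *)
Lemma detpoly_growth d N (M x : 'M[C]_d) (z : 'I_d -> C) (e : R) : 0 < e -> M \in unitmx ->
  char_poly M = \prod_l ('X - (z l)%:P) ->
  exists2 K : R, 0 <= K & forall p, majorant (detpoly N (M ^+ p *m x))
    (K *: \prod_l one_plus N (((1 + e) * nrm (z l)) ^+ p)).
Proof.
move=> e0 Mu zE; have [P [T [Pu PM Tad]]] := adapted_triangular e0 Mu.
have [Tt _ _] := Tad.
pose Y := P *m x *m invmx P.
(* The summand 1 lets [K] also bound the entries of the identity matrix in [1 + X^N T^p Y]. *)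
pose K := 1 + \sum_i \sum_j nrm (Y i j).
have K1 : 1 <= K.
  by rewrite lerDl; apply: sumr_ge0 => i _; apply: sumr_ge0 => j _; exact: nrm_ge0.
have YK i j : nrm (Y i j) <= K.
  rewrite /K (bigD1 i) //= (bigD1 j) //=.
  have h1 : 0 <= \sum_(i0 < d | i0 != i) \sum_j0 nrm (Y i0 j0).
    by apply: sumr_ge0 => k _; apply: sumr_ge0 => m _; exact: nrm_ge0.
  have h2 : 0 <= \sum_(i0 < d | i0 != j) nrm (Y i i0).
    by apply: sumr_ge0 => m _; exact: nrm_ge0.
  move: h1 h2; move: (\sum_(_ | _) _) (\sum_(_ | _) _) (nrm _) => a b c; lra.
exists ((d`!)%:R * K ^+ d) => [|p].
  by rewrite mulr_ge0 ?ler0n // exprn_ge0 //; lra.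
have -> : detpoly N (M ^+ p *m x) = detpoly N (T ^+ p *m Y).
  apply: detpoly_similar (Pu) _.
  by rewrite mulmxA (similar_expr p PM) -[LHS]mulmxA -[RHS]mulmxA /Y mulmxKV.
have -> : \prod_l one_plus N (((1 + e) * nrm (z l)) ^+ p) =
    \prod_l one_plus N (((1 + e) * nrm (T l l)) ^+ p).
  apply: (perm_codom_prod (fun x => one_plus N (((1 + e) * nrm x) ^+ p))).
  apply: (char_poly_perm zE).
  by rewrite (similar_char_poly Pu PM) char_poly_trig.
have -> : ((d`!)%:R * K ^+ d) *: \prod_l one_plus N (((1 + e) * nrm (T l l)) ^+ p) =
    (d`!)%:R *: \prod_l (K *: one_plus N (((1 + e) * nrm (T l l)) ^+ p)).
  by rewrite scaler_prod prodr_const card_ord scalerA.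
apply: majorant_det => i j n.
pose r := ((1 + e) * nrm (T i i)) ^+ p; have r0 : 0 <= r.
  by rewrite exprn_ge0 // mulr_ge0 ?nrm_ge0 //; lra.
have entry : nrm ((T ^+ p *m Y) i j) <= K * r.
  rewrite mxE; apply: le_trans (nrm_sum _ _ _) _.
  apply: (@le_trans _ _ (\sum_k nrm ((T ^+ p) i k) * K)).
    by apply: ler_sum => k _; rewrite Normc.normcM ler_wpM2l ?nrm_ge0.
  by rewrite -mulr_suml mulrC ler_wpM2l ?adapted_expr //; lra.
have -> : (1%:M + 'X^N *: map_mx polyC (T ^+ p *m Y)) i j =
    (i == j)%:R%:P + (T ^+ p *m Y) i j *: 'X^N.
  rewrite mxE [in X in X + _]mxE [in X in _ + X]mxE [in X in _ + X]mxE.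
  by rewrite rmorph_nat -mul_polyC mulrC.
rewrite coefD coefZ coefC /one_plus coefZ coefD coef1 coefZ -/r.
apply: le_trans (le_normcD _ _) _; rewrite mulrDr; apply: lerD.
  case: (n == 0%N); rewrite ?Normc.normc0 ?mulr0 ?lexx // mulr1.
  by case: (i == j); rewrite ?Normc.normc0 ?Normc.normc1 ?mulr1; lra.
rewrite !coefXn; case: (n == N); rewrite ?mulr0 ?Normc.normc0 ?mulr0 // !mulr1.
exact: entry.
Qed.

End Majorant.

Lemma coef_prod_one_plus (A : comNzRingType) (I : finType) (N : I -> nat) (x : I -> A) n :
  (\prod_a one_plus (N a) (x a))`_n =
  \sum_(T : {set I} | (\sum_(a in T) N a == n)%N) \prod_(a in T) x a.
Proof.
rewrite /one_plus; under eq_bigr do rewrite addrC.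
rewrite bigA_distr coef_sum [RHS]big_mkcond; apply: eq_bigr => T _.
have -> : \prod_i (if i \in T then x i *: 'X^(N i) else 1) =
    (\prod_(i in T) x i) *: 'X^(\sum_(i in T) N i)%N.
  rewrite -big_mkcond /= scaler_prod; congr (_ *: _).
  by rewrite (big_morph (fun n => 'X^n : {poly A}) (fun a b => exprD _ a b) (expr0 _)).
rewrite coefZ coefXn eq_sym; case: eqP => _; by rewrite ?mulr1 ?mulr0.
Qed.

Section Archimedean.
Variable R : realType.

Lemma pow_unbounded (x K : R) : 1 < x -> eventually_nat (fun n => K <= x ^+ n).
Proof.
move=> x1; have B n : 1 + n%:R * (x - 1) <= x ^+ n.
  elim: n => [|n IH]; first by rewrite mul0r addr0 expr0.
  have n0 : 0 <= n%:R :> R by rewrite ler0n.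
  have x0 : 0 <= x by lra.
  have := ler_wpM2l x0 IH; have := mulr_ge0 n0 (sqr_ge0 (x - 1)).
  rewrite [x ^+ n.+1]exprS -natr1; move: (x * x ^+ n) (n%:R : R) => y t h1 h2; nra.
have x10 : 0 < x - 1 by lra.
exists (Num.bound (K / (x - 1))) => n Nn.
apply: le_trans (B n).
have [K0|K0] := ltP K 0.
  have : 0 <= n%:R * (x - 1) by rewrite mulr_ge0 ?ler0n // ltW.
  lra.
have := archi_boundP (divr_ge0 K0 (ltW x10)); rewrite ltr_pdivrMr // => h.
have : (Num.bound (K / (x - 1)))%:R <= n%:R :> R by rewrite ler_nat.
nra.
Qed.

Lemma negligible_geometric (mu rho K : R) : 0 < mu -> 0 <= rho < 1 -> 0 <= K ->
  negligible mu (fun n => K * (rho * mu) ^+ n).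
Proof.
move=> mu0 /andP[rho0 rho1] K0 e e0.
have [->|rhon0] := eqVneq rho 0.
  exists 1%N => n n1; rewrite mul0r expr0n gtn_eqF //= mulr0.
  by rewrite mulr_ge0 ?exprn_ge0 ?ltW.
have {}rho0 : 0 < rho by rewrite lt_neqAle eq_sym rhon0.
have [N NP] : eventually_nat (fun n => K / e <= (rho^-1) ^+ n).
  by apply: pow_unbounded; rewrite invf_gt1.
exists N => n /NP; rewrite exprMn mulrA => h.
rewrite ler_pM2r ?exprn_gt0 //; move: h; rewrite exprVn ler_pdivrMr // mulrC.
by rewrite ler_pdivlMr ?exprn_gt0.
Qed.

Lemma small_exponent (L : R) k : 1 < L -> exists2 e, 0 < e & (1 + e) ^+ k < L.
Proof.
move=> L1; have B n (e : R) : 0 <= e -> e <= 1 -> (1 + e) ^+ n <= 1 + 2 ^+ n * e.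
  (* The intermediate term is the chord of the convex function [(1 + e)^n] over the interval from 0
     to 1. *)
  move=> e0 e1; apply: (@le_trans _ _ (1 + (2 ^+ n - 1) * e)); last by nra.
  elim: n => [|n IH]; first by rewrite !expr0; lra.
  rewrite !exprS; have b1 : 1 <= 2 ^+ n :> R by rewrite exprn_ege1 // ler1n.
  move: IH b1; move: ((1 + e) ^+ n) (2 ^+ n) => a b IH b1.
  have := ler_wpM2l (addr_ge0 ler01 e0) IH.
  have : 0 <= (b - 1) * e * (1 - e) by rewrite !mulr_ge0 //; lra.
  nra.
have b1 : 1 <= 2 ^+ k :> R by rewrite exprn_ege1 // ler1n.
have b0 : 0 < 2 * 2 ^+ k :> R by lra.
pose e := Num.min 1 ((L - 1) / (2 * 2 ^+ k)).
have e0 : 0 < e by rewrite lt_min ltr01 divr_gt0 //; lra.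
have e1 : e <= 1 by rewrite ge_min lexx.
have : e <= (L - 1) / (2 * 2 ^+ k) by rewrite ge_min lexx orbT.
rewrite ler_pdivlMr // => h; exists e => //.
apply: le_lt_trans (B k e (ltW e0) e1) _; lra.
Qed.

End Archimedean.

(** * Index sets separated by a multiplicative gap *)

Section Separated.
Variables (R : realFieldType) (I : finType).

(** A common threshold, rather than a comparison of all pairs, makes products over sets of equal
    size easy to compare; [separatedP] relates the two for non-empty [T]. *)
Definition separated (T : {set I}) (L : R) (x : I -> R) :=
  exists2 th, 0 < th & (forall a, a \in T -> th <= x a) /\ (forall b, b \notin T -> L * x b <= th).

Lemma separated_le T L L' x : (forall a, 0 <= x a) -> L' <= L -> separated T L x -> separated T L' x.
Proof.
move=> x0 LL [th th0 [h1 h2]]; exists th => //; split=> // b /h2.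
by apply: le_trans; rewrite ler_wpM2r.
Qed.

Lemma separated_exp T L x p : (forall a, 0 <= x a) -> 0 <= L -> separated T L x ->
  separated T (L ^+ p) (fun a => x a ^+ p).
Proof.
move=> x0 L0 [th th0 [h1 h2]]; exists (th ^+ p); first by rewrite exprn_gt0.
split=> [a /h1|b /h2].
  by move=> h; apply: lerXn2r; rewrite ?nnegrE // ltW.
by move=> h; rewrite -exprMn; apply: lerXn2r; rewrite ?nnegrE ?mulr_ge0 // ltW.
Qed.

Lemma separated_prod T T' L x : (forall a, 0 <= x a) -> 1 <= L -> separated T L x ->
  T' != T -> #|T'| = #|T| -> L * \prod_(a in T') x a <= \prod_(a in T) x a.
Proof.
move=> x0 L1 [th th0 [h1 h2]] TT' cTT'.
have L0 : 0 < L by lra.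
rewrite (big_setID T) /= [X in _ <= X](big_setID T') /= finset.setIC mulrCA.
apply: ler_wpM2l; first by apply: prodr_ge0.
have cD : #|T' :\: T| = #|T :\: T'|.
  by apply/eqP; rewrite -(eqn_add2l #|T' :&: T|) cardsID finset.setIC cardsID cTT'.
(* At least one element is exchanged, so at least one factor [L] is gained; the other [r] exchanges
   lose nothing as [1 <= L]. *)
have [r rE] : exists r, #|T :\: T'| = r.+1.
  case e : #|T :\: T'| => [|r]; last by exists r.
  move/eqP: e; rewrite cards_eq0 finset.setD_eq0 => sTT'; move: TT'; rewrite eq_sym eqEcard sTT' cTT'.
  by rewrite leqnn.
have le1 : \prod_(a in T' :\: T) x a <= (th / L) ^+ r.+1.
  rewrite -rE -cD -prodr_const; apply: ler_prod => b; rewrite inE x0 => /andP[bT _] /=.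
  by rewrite ler_pdivlMr // mulrC; exact: h2.
have le2 : th ^+ r.+1 <= \prod_(a in T :\: T') x a.
  rewrite -rE -prodr_const; apply: ler_prod => b; rewrite inE => /andP[_ bT].
  by rewrite ltW //= h1.
apply: le_trans le2; apply: le_trans (ler_wpM2l (ltW L0) le1) _.
rewrite exprMn mulrCA ler_piMr ?exprn_ge0 ?(ltW th0) //.
rewrite exprS mulrA divff ?gt_eqF // mul1r exprn_ile1 ?invr_ge0 ?(ltW L0) //.
by rewrite invf_le1.
Qed.

Lemma separated_prod_gt0 T L x : separated T L x -> 0 < \prod_(a in T) x a.
Proof.
by move=> [th th0 [h1 _]]; apply: prodr_gt0 => a /h1; exact: lt_le_trans.
Qed.

End Separated.

(** * Coefficients that count eigenvalues by block *)

Section Blocks.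
Variables (R : realType) (G : groupType) (m : nat) (d : 'I_m -> nat).
Local Notation C := R[i].
Local Notation nrm := (@Normc.normc R).
Local Notation I := {j : 'I_m & 'I_(d j)}.
Local Notation ix := (existT (fun j => ordinal (d j))).
Variable A : forall j, G -> 'M[C]_(d j).
Hypothesis Ahom : forall j, mx_hom (A j).
Variable z : G -> I -> C.
Hypothesis zE : forall g j, char_poly (A j g) = \prod_l ('X - (z g (ix j l))%:P).

Variables (j0 : 'I_m) (k : nat).

Lemma block_unit j g : A j g \in unitmx.
Proof.
have [h1 hM] := Ahom j; have := hM g (g^-1)%g; rewrite mulgV h1.
by move=> /esym/mulmx1_unit[].
Qed.

Lemma block_exp j g p : A j (g ^+ p)%g = A j g ^+ p.
Proof.
elim: p => [|p IH]; first by rewrite expg0 expr0 (Ahom j).1.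
by rewrite expgS exprS (Ahom j).2 IH.
Qed.

Definition occ (T : {set I}) : nat := #|[set a in T | tag a == j0]|.

(* With these exponents the coefficient of [X^(k + (#|I| + 1) i)] in [blockpoly]
   collects the [k]-sets of eigenvalues with exactly [i] elements in block [j0]. *)
Definition weight (j : 'I_m) : nat := 1 + #|{: I}|.+1 * (j == j0).

Definition blockpoly g : {poly C} := \prod_j detpoly (weight j) (A j g).

Definition tau (i : 'I_#|{: I}|.+1) g := (blockpoly g)`_(k + #|{: I}|.+1 * i).

Lemma prod_tagged (K : comNzRingType) (f : I -> K) :
  \prod_a f a = \prod_j \prod_l f (ix j l).
Proof. by rewrite (sig_big_dep _ _ (fun j l => f (ix j l))) /=; apply: eq_bigr => -[]. Qed.

Lemma weight_sum (T : {set I}) : (\sum_(a in T) weight (tag a) = #|T| + #|{: I}|.+1 * occ T)%N.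
Proof.
rewrite big_split /= sum1_card -big_distrr /=; congr (_ + _ * _)%N.
rewrite /occ -sum1_card big_mkcond [RHS]big_mkcond; apply: eq_bigr => a _.
by rewrite inE; case: (a \in T); case: (tag a == j0).
Qed.

Lemma occ_lt T : (occ T < #|{: I}|.+1)%N.
Proof. by rewrite ltnS max_card. Qed.

Lemma weightP (T : {set I}) (i : 'I_#|{: I}|.+1) : (k <= #|{: I}|)%N ->
  (\sum_(a in T) weight (tag a) == k + #|{: I}|.+1 * i)%N = (#|T| == k) && (occ T == i).
Proof.
move=> kI; rewrite weight_sum; have cT : (#|T| <= #|{: I}|)%N by exact: max_card.
apply/eqP/andP => [h|[/eqP-> /eqP-> //]].
have h1 := congr1 (modn^~ #|{: I}|.+1) h; have h2 := congr1 (divn^~ #|{: I}|.+1) h.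
move: h1 h2; rewrite /= ![(_ + _ * _)%N]addnC ![(#|_|.+1 * _)%N]mulnC !modnMDl !divnMDl //.
by rewrite !modn_small ?ltnS // !divn_small ?ltnS // !addn0 => -> ->.
Qed.

Hypothesis kI : (k <= #|{: I}|)%N.

(** The enumeration [y] is left free: for a power of [x], the powers of the eigenvalues of [x] are
    used instead of [z (x ^+ p)]. *)
Lemma tauE g (y : I -> C) i :
  (forall j, char_poly (A j g) = \prod_l ('X - (y (ix j l))%:P)) ->
  tau i g = \sum_(T : {set I} | (#|T| == k) && (occ T == i)) \prod_(a in T) y a.
Proof.
move=> yE; rewrite /tau /blockpoly.
have -> : \prod_j detpoly (weight j) (A j g) = \prod_(a : I) one_plus (weight (tag a)) (y a).
  rewrite prod_tagged; apply: eq_bigr => j _.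
  by rewrite (detpolyE _ (block_unit j g) (yE j)).
by rewrite coef_prod_one_plus; apply: eq_bigl => T; exact: weightP.
Qed.

(** Turns estimates with the power on the left, as in [tau_decay], into estimates with the power on
    the right. *)
Lemma tau_conj i g h : tau i (h * g)%g = tau i (g * h)%g.
Proof.
rewrite /tau; suff -> : blockpoly (h * g)%g = blockpoly (g * h)%g by [].
apply: eq_bigr => j _; apply/esym; apply: (detpoly_similar _ (block_unit j h)).
by rewrite -!(Ahom j).2 mulgA.
Qed.

Lemma tau_rep : rep_fam tau.
Proof.
have H : rep_poly blockpoly.
  apply: rep_poly_prod => j _; apply: rep_poly_det => a b.
  have h : rep_poly (fun g => ((a == b)%:R : {poly C}) + 'X^(weight j) * (A j g a b)%:P).
    apply: rep_polyD; first exact: rep_poly_const.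
    apply: rep_polyM; first exact: rep_poly_const.
    case=> [|n].
      by apply: rep_fun_ext (rep_fun_entry a b (Ahom j)) => g; rewrite coefC.
    by apply: rep_fun_ext (rep_fun_const _ 0) => g; rewrite coefC.
  by apply: rep_poly_ext h => g; rewrite !mxE.
by apply: rep_fam_intro => i; apply: H.
Qed.

Local Notation K0 := (#|{set I}|%:R : R).

Lemma K0_ge1 : 1 <= K0.
Proof. by rewrite ler1n; apply/card_gt0P; exists finset.set0. Qed.

Lemma sum_le_K0 (P : pred {set I}) (f : {set I} -> R) (b : R) : 0 <= b ->
  (forall T, P T -> f T <= b) -> \sum_(T | P T) f T <= K0 * b.
Proof.
move=> b0 fb; apply: le_trans (ler_sum _ fb) _.
rewrite sumr_const -[X in X <= _]mulr_natl ler_wpM2r // ler_nat.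
exact: max_card.
Qed.

(** The product over [T] exceeds that over any other [k]-set by [L], and there are at most [K0] of
    these: they sum to at most [K0 / L] times the product over [T]. *)
Lemma tau_separated g (y : I -> C) (T : {set I}) (L : R) :
  (forall j, char_poly (A j g) = \prod_l ('X - (y (ix j l))%:P)) ->
  #|T| = k -> 1 <= L -> separated T L (nrm \o y) ->
  (forall i : 'I_#|{: I}|.+1, i != occ T :> nat -> L * nrm (tau i g) <= K0 * \prod_(a in T) nrm (y a)) /\
  (forall i : 'I_#|{: I}|.+1, i = occ T :> nat ->
    (L - K0) * \prod_(a in T) nrm (y a) <= L * nrm (tau i g)).
Proof.
move=> yE Tk L1 sep; set mu := \prod_(a in T) _.
have mu0 : 0 < mu := separated_prod_gt0 sep.
have L0 : 0 < L by lra.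
have small T' : T' != T -> #|T'| == k -> \prod_(a in T') nrm (y a) <= L^-1 * mu.
  move=> T'T /eqP T'k; rewrite ler_pdivlMl //.
  by apply: (separated_prod _ L1 sep T'T); rewrite ?Tk // => a; exact: nrm_ge0.
have b0 : 0 <= L^-1 * mu by rewrite mulr_ge0 ?invr_ge0 ?(ltW L0) ?(ltW mu0).
split=> i iT; rewrite (tauE i yE).
  rewrite -ler_pdivlMl // mulrCA; apply: le_trans (nrm_sum _ _ _) _.
  apply: sum_le_K0 => // T' /andP[T'k T'i]; rewrite nrm_prod; apply: small => //.
  by apply: contraNneq iT => <-; rewrite (eqP T'i).
rewrite (bigD1 T) /=; last by rewrite Tk iT !eqxx.
set S := \sum_(_ | _) _.
have SB : nrm S <= K0 * (L^-1 * mu).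
  apply: le_trans (nrm_sum _ _ _) _; apply: sum_le_K0 => // T' /andP[/andP[T'k _] T'T].
  by rewrite nrm_prod; exact: small.
have : mu <= nrm (\prod_(a in T) y a + S) + nrm S.
  rewrite /mu -nrm_prod -(normcN S).
  by apply: le_trans (le_normcD _ _); rewrite addrK.
move=> h; rewrite -ler_pdivrMl // mulrBl mulrBr mulrA mulVf ?gt_eqF // mul1r mulrCA.
move: h SB; move: (nrm _) (nrm _) (K0 * _) => a b c; lra.
Qed.

(** The eigenvalues of [x ^+ p * g] are unknown, but the majorant of the coefficient runs over
    [k]-sets other than [T], each of which loses [L ^+ p]. The loss [(1 + e) ^+ (k * p)] does not
    make up for this, by the choice of [e]. *)
Lemma tau_decay x (T : {set I}) (L : R) (i : 'I_#|{: I}|.+1) g : #|T| = k -> 1 < L -> separated T L (nrm \o z x) ->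
  i != occ T :> nat -> negligible (\prod_(a in T) nrm (z x a)) (fun p => nrm (tau i (x ^+ p * g)%g)).
Proof.
move=> Tk L1 sep iT; set mu := \prod_(a in T) _.
have mu0 : 0 < mu := separated_prod_gt0 sep.
have L0 : 0 < L by lra.
have [e e0 eL] := small_exponent k L1.
have e1 : 0 <= 1 + e by lra.
have /choice[K KP] (j : 'I_m) : exists K, 0 <= K /\ forall p, majorant
    (detpoly (weight j) (A j x ^+ p *m A j g))
    (K *: \prod_l one_plus (weight j) (((1 + e) * nrm (z x (ix j l))) ^+ p)).
  by have [K K_ge0 KP] := detpoly_growth (weight j) (A j g) e0 (block_unit j x) (zE x j); exists K.
apply: (negligible_le (g := fun p => \prod_j K j * K0 * ((1 + e) ^+ k / L * mu) ^+ p)); last first.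
  apply: negligible_geometric => //.
    by rewrite divr_ge0 ?exprn_ge0 ?(ltW L0) //= ltr_pdivrMr ?mul1r.
  by rewrite mulr_ge0 ?prodr_ge0 ?ler0n // => j _; case: (KP j).
move=> p; have maj : majorant (blockpoly (x ^+ p * g)%g)
    (\prod_j K j *: \prod_(a : I) one_plus (weight (tag a)) (((1 + e) * nrm (z x a)) ^+ p)).
  rewrite prod_tagged -scaler_prod; apply: majorant_prod => j _.
  by rewrite (Ahom j).2 block_exp; have [_] := KP j; apply.
apply: le_trans (maj _) _; rewrite coefZ coef_prod_one_plus -mulrA.
apply: ler_wpM2l; first by apply: prodr_ge0 => j _; case: (KP j).
apply: sum_le_K0; first by rewrite exprn_ge0 // !mulr_ge0 ?invr_ge0 ?exprn_ge0 ?(ltW L0) ?(ltW mu0).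
move=> T'; rewrite weightP // => /andP[/eqP T'k /eqP T'i].
have T'T : T' != T by apply: contraNneq iT => <-; rewrite T'i.
rewrite prodrXl; apply: lerXn2r.
- by rewrite nnegrE; apply: prodr_ge0 => a _; rewrite mulr_ge0 ?nrm_ge0.
- by rewrite nnegrE !mulr_ge0 ?invr_ge0 ?exprn_ge0 ?(ltW L0) ?(ltW mu0).
rewrite big_split /= prodr_const T'k -mulrA; apply: ler_wpM2l; first by rewrite exprn_ge0.
rewrite ler_pdivlMl //; apply: (separated_prod _ (ltW L1) sep T'T); rewrite ?Tk //.
by move=> a; exact: nrm_ge0.
Qed.

Lemma tau_lower x (T : {set I}) (L : R) (i : 'I_#|{: I}|.+1) : #|T| = k -> 1 < L ->
  separated T L (nrm \o z x) -> i = occ T :> nat ->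
  eventually_nat (fun p => 2^-1 * (\prod_(a in T) nrm (z x a)) ^+ p <= nrm (tau i (x ^+ p)%g)).
Proof.
move=> Tk L1 sep iT; have [N NP] := pow_unbounded (2 * K0) L1.
exists N => p /NP hp.
have Lp1 : 1 <= L ^+ p by rewrite exprn_ege1 // ltW.
have yE j : char_poly (A j (x ^+ p)%g) = \prod_l ('X - (z x (ix j l) ^+ p)%:P).
  by rewrite block_exp (char_poly_expr p (block_unit j x) (zE x j)).
have sep' : separated T (L ^+ p) (nrm \o (fun a => z x a ^+ p)).
  have L0 : 0 <= L by lra.
  have [th th0 [h1 h2]] := separated_exp p (fun a => nrm_ge0 (z x a)) L0 sep.
  by exists th => //; split=> [a /h1|a /h2] /=; rewrite nrmX.
have [_ /(_ i iT)] := tau_separated yE Tk Lp1 sep'.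
rewrite (eq_bigr (fun a => nrm (z x a) ^+ p)) => [|a _]; last by rewrite nrmX.
rewrite prodrXl.
set mu := (\prod_(a in T) _) ^+ p; set t := nrm _; have mu0 : 0 < mu by rewrite exprn_gt0 //; exact: separated_prod_gt0 sep.
have k1 := K0_ge1.
have t0 : 0 <= t := nrm_ge0 _.
move: (L ^+ p) (K0) mu t hp Lp1 mu0 k1 t0 => l c mu t hp Lp1 mu0 k1 t0 h.
have : (l - l / 2) * mu <= l * t by apply: le_trans h; rewrite ler_pM2r //; lra.
have -> : (l - l / 2) * mu = l * (2^-1 * mu) by field.
by rewrite ler_pM2l //; lra.
Qed.

(** [N] depends on [y] and not on [x], so that several [x] can be compared with one power of [y]. *)
Theorem occ_eq (y : G) : exists2 N, (0 < N)%N & forall x (Tx Ty : {set I}) (Lx Ly : R),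
  #|Tx| = k -> #|Ty| = k -> 1 < Lx -> 1 < Ly ->
  separated Tx Lx (nrm \o z x) -> separated Ty Ly (nrm \o z (y ^+ N)%g) ->
  (forall L, eventually_nat (fun p => forall q, exists T : {set I},
     #|T| = k /\ separated T L (nrm \o z (x ^+ p * (y ^+ N) ^+ q)%g))) ->
  occ Tx = occ Ty.
Proof.
have [D [Th [u [v [Thom tauTh]]]]] := tau_rep.
have [N N0 [L spanL]] := power_color_span Thom y #|{: I}|.+1.
exists N => // x Tx Ty Lx Ly Txk Tyk Lx1 Ly1 sepx sepy gap.
pose i0 := Ordinal (occ_lt Tx); pose i1 := Ordinal (occ_lt Ty).
suff : i0 = i1 by move/(congr1 val).
have coefE i g : mxcoef Th u v i g = tau i g by rewrite tauTh.
have k1 := K0_ge1.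
apply: (@dominant_index_eq R G _ D Th u v Thom x (y ^+ N)%g L spanL _ i0 i1
  (\prod_(a in Tx) nrm (z x a)) (\prod_(a in Ty) nrm (z (y ^+ N)%g a)) 2^-1 2^-1).
(* With gap factor [M], the dominant coefficient times [M] is at least [M - K0 = K0 / e] times the
   top product, and each other one times [M] at most [K0] times it, whence the ratio [e]. *)
- move=> e e0; pose M := K0 + K0 / e.
  have K0e : 0 < K0 / e by rewrite divr_gt0 //; exact: lt_le_trans ltr01 k1.
  have M1 : 1 <= M by apply: le_trans k1 _; rewrite lerDl ltW.
  have [P PP] := gap M; exists P => p /PP gapP q; have [T [Tk sepT]] := gapP q.
  exists (Ordinal (occ_lt T)).
  have [up low] := tau_separated (zE _) Tk M1 sepT.
  have /= {}low := low (Ordinal (occ_lt T)) erefl.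
  have mu0 := separated_prod_gt0 sepT.
  have M0 : 0 < M := lt_le_trans ltr01 M1.
  have MK : M - K0 = K0 / e by rewrite /M addrC addKr.
  rewrite MK in low.
  have pos : 0 < M * nrm (tau (Ordinal (occ_lt T)) (x ^+ p * (y ^+ N) ^+ q)%g).
    by apply: lt_le_trans low; rewrite mulr_gt0.
  split; first by rewrite coefE -nrm_gt0; move: pos; rewrite pmulr_rgt0.
  move=> j jT; rewrite !coefE -(ler_pM2l M0).
  apply: le_trans (up j jT) _.
  rewrite mulrCA -ler_pdivrMl //; apply: le_trans low.
  by rewrite mulrA [e^-1 * _]mulrC.
- exact: separated_prod_gt0 sepx.
- exact: separated_prod_gt0 sepy.
- by rewrite invr_gt0.
- by rewrite invr_gt0.
- have [P PP] := tau_lower (i := i0) Txk Lx1 sepx erefl.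
  by exists P => p /PP; rewrite coefE.
- have [P PP] := tau_lower (i := i1) Tyk Ly1 sepy erefl.
  by exists P => p /PP; rewrite coefE.
- move=> i g ii; have := tau_decay g Txk Lx1 sepx (i := i).
  by move=> H; apply: negligible_le (H ii) => p; rewrite coefE.
- move=> i g ii; have := tau_decay g Tyk Ly1 sepy (i := i).
  by move=> H; apply: negligible_le (H ii) => p; rewrite coefE tau_conj.
Qed.

End Blocks.

(** * Hyperbolic groups *)

Section HyperbolicGroup.
Variables (R : realType) (G : groupType) (len : G -> R) (D : R).
Hypothesis len_ge0 : forall g, 0 <= len g.
Hypothesis len1 : len 1%g = 0.
Hypothesis lenV : forall g, len (g^-1)%g = len g.
Hypothesis lenM : forall g h, len (g * h)%g <= len g + len h.
Hypothesis D_ge0 : 0 <= D.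

Local Notation dist x y := (len (x^-1 * y)%g).

Hypothesis four_point : forall x y z w,
  dist x z + dist y w <= dist x y + dist z w + D \/
  dist x z + dist y w <= dist y z + dist x w + D.

Lemma distC x y : dist x y = dist y x.
Proof. by rewrite -lenV invgM invgK. Qed.

Lemma dist_triangle y x z : dist x z <= dist x y + dist y z.
Proof. by have := lenM (x^-1 * y)%g (y^-1 * z)%g; rewrite mulgA mulgK. Qed.

Lemma dist1 x : dist 1%g x = len x.
Proof. by rewrite invg1 mul1g. Qed.

Lemma distM g x y : dist (g * x)%g (g * y)%g = dist x y.
Proof. by rewrite invgM mulgA mulgVK. Qed.

(** A local-to-global principle. In the four-point inequality for [x 0], [x n], [x n.+1], [x n.+2],
    one alternative contradicts the induction hypothesis and the other is the claim. *)
Lemma chain_growth (x : nat -> G) (s : R) : 0 < s ->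
  (forall i, dist (x i) (x i.+1) + D + s <= dist (x i) (x i.+2)) ->
  (forall i, dist (x i.+1) (x i.+2) + D + s <= dist (x i) (x i.+2)) ->
  forall n, dist (x 0%N) (x n) + s <= dist (x 0%N) (x n.+1).
Proof.
have D0 := D_ge0; move=> s0 h1 h2; elim=> [|n IH].
  have := dist_triangle (x 1%N) (x 0%N) (x 2%N); have := h2 0%N.
  rewrite mulVg len1; lra.
have e1 := h1 n; have e2 := h2 n.
by have [e3|e3] := four_point (x 0%N) (x n) (x n.+1) (x n.+2); lra.
Qed.

Section PowerOfLoxodromic.
Variables (ga : G) (psi : G -> R).
Hypothesis psiM : {morph psi : g h / (g * h)%g >-> g + h}.
Hypothesis psi_ga : psi ga != 0.
Hypothesis proper : forall r : R, exists s : seq G, forall g, len g <= r -> g \in s.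

Lemma psi1 : psi 1%g = 0.
Proof. by have := psiM 1%g 1%g; rewrite mulg1; lra. Qed.

Lemma psiV g : psi (g^-1)%g = - psi g.
Proof. by have := psiM g g^-1%g; rewrite mulgV psi1; lra. Qed.

Lemma psiX g n : psi (g ^+ n)%g = n%:R * psi g.
Proof.
elim: n => [|n IH]; first by rewrite expg0 psi1 mul0r.
by rewrite expgS psiM IH -natr1 mulrDl mul1r addrC.
Qed.

Local Notation h n := (len (ga ^+ n)%g).
Hypothesis h_growth : forall n, h n + (D + 1) <= h n.+1.

Lemma h_mono a b : (a <= b)%N -> h a <= h b.
Proof.
have D0 := D_ge0; move=> /subnK <-; elim: (b - a)%N => [|c IH]; first by rewrite add0n.
by rewrite addSn; have := h_growth (c + a); lra.
Qed.

Lemma h_linear a n : h a + n%:R <= h (n + a)%N.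
Proof.
have D0 := D_ge0; elim: n => [|n IH]; first by rewrite add0n; lra.
by rewrite addSn -natr1; have := h_growth (n + a); lra.
Qed.

Lemma h_subadd a b : h (a + b)%N <= h a + h b.
Proof. by rewrite expgnDr. Qed.

Lemma expg_dist a b : (a <= b)%N -> dist (ga ^+ a)%g (ga ^+ b)%g = h (b - a)%N.
Proof. by move=> ab; rewrite -{1}(subnKC ab) expgnDr mulKg. Qed.

Definition Kc : R := 2 * h 1%N + D.

(** The two middle points [ga ^+ a] and [ga ^+ a.+1] overlap on purpose: growth by [D + 1] at each
    step then excludes the first alternative, and one unit step is paid for twice by [2 * h 1]. *)
Lemma h_almost_additive a c : h a + h c <= h (a + c)%N + Kc.
Proof.
have D0 := D_ge0; move: (four_point 1%g (ga ^+ a)%g (ga ^+ a.+1)%g (ga ^+ (a.+1 + c))%g).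
rewrite !dist1 !expg_dist; try lia.
rewrite (_ : a.+1 + c - a = c.+1)%N; last lia.
rewrite (_ : a.+1 + c - a.+1 = c)%N; last lia.
rewrite (_ : a.+1 - a = 1)%N; last lia.
have e1 := h_growth a; have e2 := h_growth c; have := h_subadd 1 (a + c).
by rewrite add1n -addSn /Kc => e3 [e|e]; lra.
Qed.

Definition Rc : R := h 1%N + 3 * D + Kc.

(* The Gromov products of [g ga^N] and [ga^N] are unbounded, i.e. [g] fixes the
   attracting point of [ga]. *)
Definition fellow_unbounded (g : G) := forall B : R, exists N,
  B < h N + len (g * ga ^+ N)%g - dist (ga ^+ N)%g (g * ga ^+ N)%g.

Lemma h_near (l : R) N : 0 <= l -> l <= h N -> exists i, [/\ (i <= N)%N, l <= h i & h i <= l + h 1%N].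
Proof.
move=> l0 lN; have ex : exists i, l <= h i by exists N.
case: (ex_minnP ex) => i li imin; exists i; split=> //; first exact: imin.
case: i li imin => [|i] li imin.
  by rewrite expg0 len1; have := len_ge0 (ga ^+ 1)%g; lra.
have : h i < l by rewrite ltNge; apply/negP => /imin; rewrite ltnn.
by have := h_subadd i 1; rewrite addn1; lra.
Qed.

(** For large [N], the point [x] lies near a geodesic from 1 to [g * ga ^+ N], which follows the
    powers of [ga] for longer than [len x]. The power at distance about [len x] from 1 is then close
    to [x]; the last four-point inequality produces the summands of [Rc]. *)
Lemma fellow_close (g : G) : fellow_unbounded g -> exists n0, forall n, (n0 <= n)%N ->
  exists i, dist (ga ^+ i)%g (g * ga ^+ n)%g <= Rc.
Proof.
have D0 := D_ge0; move=> unb.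
(* Beyond [len g + D], one alternative of the four-point inequality in [step2] is impossible. *)
pose n0 := (Num.bound (len g + D)).+1; exists n0 => n n0n.
have n_big : len g + D < n%:R.
  apply: lt_le_trans (archi_boundP (addr_ge0 (len_ge0 g) D_ge0)) _.
  by rewrite ler_nat ltnW.
set x := (g * ga ^+ n)%g.
have [N] := unb (2 * (len x + h n + h 1%N)).
set y := (g * ga ^+ N)%g; set u := (ga ^+ N)%g => BN.
have t1 := dist_triangle u 1%g y; rewrite !dist1 in t1.
have hx := len_ge0 x; have hn := len_ge0 (ga ^+ n)%g; have h1 := len_ge0 (ga ^+ 1)%g.
have hN : len x + h n + h 1%N < h N by rewrite -/u; lra.
have nN : (n <= N)%N.
  by rewrite leqNgt; apply/negP => /ltnW/h_mono; lra.
have dgx : dist g x = h n by rewrite /x mulKg.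
have dgy : dist g y = h N by rewrite /y mulKg.
have dxy : dist x y = h (N - n)%N by rewrite /x /y distM expg_dist.
have add1 := h_almost_additive n (N - n); rewrite subnKC // in add1.
have lin := h_linear (N - n) n; rewrite subnKC // in lin.
have step2 : len x + dist x y <= len y + D + Kc.
  by have := four_point 1%g g x y; rewrite !dist1 dgx dgy dxy => -[e|e]; lra.
have [i [iN ih1 ih2]] : exists i, [/\ (i <= N)%N, len x <= h i & h i <= len x + h 1%N].
  by apply: h_near => //; lra.
exists i; set t := (ga ^+ i)%g; rewrite distC.
have dtu : dist t u = h (N - i)%N by rewrite /t /u expg_dist.
have add2 := h_almost_additive i (N - i); rewrite subnKC // in add2.
have Kc0 : 0 <= Kc by rewrite /Kc; lra.
have stepA : dist x u <= h N - len x + 2 * D + Kc.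
  have := four_point x y u 1%g; rewrite !(distC _ 1%g) !dist1 (distC y u).
  by move: hN BN; rewrite -/u => hN BN [e|e]; lra.
have := four_point x u t 1%g; rewrite !(distC _ 1%g) !dist1 (distC u t) dtu.
by move: stepA add2 ih1 ih2; rewrite /Rc -/t -/u => e1 e2 e3 e4 [e|e]; lra.
Qed.

(** By [fellow_close] and properness, [ga ^- f n * g * ga ^+ n] takes the same value at two
    exponents [n]. Applying [psi] shows that [f] increases by the same amount [t] as [n], so [g]
    commutes with [ga ^+ t]; at a multiple of [t] the value is then a power of [ga] times [g]. *)
Lemma fellow_coset : exists s : seq G, forall g, fellow_unbounded g ->
  exists b n, b \in s /\ (g = ga ^+ n * b \/ g = ga ^- n * b)%g.
Proof.
have [s sP] := proper Rc; exists s => g /fellow_close[n0 close].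
have /choice[f fP] (n : nat) : exists i, (n0 <= n)%N -> (ga ^- i * (g * ga ^+ n))%g \in s.
  have [n0n|] := leqP n0 n; last by exists 0%N.
  by have [i ile] := close n n0n; exists i => _; exact: sP.
pose b n := (ga ^- f n * (g * ga ^+ n))%g.
have bE n : (ga ^+ f n * b n = g * ga ^+ n)%g by rewrite /b mulVKg.
have [t t0 comm] : exists2 t, (0 < t)%N & (g * ga ^+ t = ga ^+ t * g)%g.
  have idxlt n : (index (b (n0 + n)%N) s < size s)%N by rewrite index_mem fP // leq_addr.
  pose idx (n : 'I_(size s).+1) : 'I_(size s) := Ordinal (idxlt n).
  have /injectivePn[n1 [n2 n12 idx12]] : ~~ injectiveb idx.
    by apply/negP => /injectiveP/leq_card; rewrite !card_ord ltnn.
  wlog lt12 : n1 n2 n12 idx12 / (n1 < n2)%N.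
    move=> W; case: (ltngtP n1 n2) => [| |/val_inj e]; first exact: W.
      by apply: W; rewrite // eq_sym.
    by rewrite e eqxx in n12.
  have b12 : b (n0 + n1)%N = b (n0 + n2)%N.
    have := congr1 val idx12 => /= e.
    have bs k : b (n0 + k)%N \in s by apply: fP; exact: leq_addr.
    by rewrite -(nth_index 1%g (bs n1)) e nth_index.
  set n := (n0 + n1)%N in b12; set n' := (n0 + n2)%N in b12.
  have nn' : (n < n')%N by rewrite ltn_add2l.
  exists (n' - n)%N; first by rewrite subn_gt0.
  have e1 := bE n; have e2 := bE n'; rewrite -b12 in e2.
  have fE : f n' = (f n + (n' - n))%N.
    have p1 := congr1 psi e1; have p2 := congr1 psi e2.
    rewrite !psiM !psiX in p1 p2.
    have : ((f n')%:R + n%:R) * psi ga = ((f n)%:R + n'%:R) * psi ga by lra.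
    move/(mulIf psi_ga); rewrite -!natrD => /eqP; rewrite eqr_nat => /eqP.
    lia.
  apply: (mulIg (ga ^+ n)%g); rewrite -[LHS]mulgA -expgnDr subnK; last exact: ltnW.
  by rewrite -e2 fE addnC expgnDr -!mulgA e1.
have commX q : (g * ga ^+ (t * q) = ga ^+ (t * q) * g)%g.
  elim: q => [|q IH]; first by rewrite muln0 expg0 mulg1 mul1g.
  by rewrite mulnS expgnDr mulgA comm -mulgA IH mulgA.
pose n := (t * n0)%N; exists (b n), (maxn (f n) n - minn (f n) n)%N.
have nn0 : (n0 <= n)%N by rewrite /n leq_pmull.
split; first exact: fP.
have gE : (ga ^+ f n * b n = ga ^+ n * g)%g by rewrite bE commX.
case: (leqP (f n) n) => fn; [right|left]; move: gE.
  have -> : (ga ^+ n = ga ^+ f n * ga ^+ (n - f n))%g by rewrite -expgnDr subnKC.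
  by rewrite -mulgA => /mulgI ->; rewrite mulKg.
have -> : (ga ^+ f n = ga ^+ n * ga ^+ (f n - n))%g by rewrite -expgnDr subnKC // ltnW.
by rewrite -mulgA => /mulgI <-.
Qed.

End PowerOfLoxodromic.
End HyperbolicGroup.

Section HyperbolicGroup.
Variables (R : realType) (G : groupType) (len : G -> R) (D : R).
Hypothesis len_ge0 : forall g, 0 <= len g.
Hypothesis len1 : len 1%g = 0.
Hypothesis lenV : forall g, len (g^-1)%g = len g.
Hypothesis lenM : forall g h, len (g * h)%g <= len g + len h.
Hypothesis D_ge0 : 0 <= D.
Local Notation dist x y := (len (x^-1 * y)%g).
Hypothesis four_point : forall x y z w,
  dist x z + dist y w <= dist x y + dist z w + D \/
  dist x z + dist y w <= dist y z + dist x w + D.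
Hypothesis proper : forall r : R, exists s : seq G, forall g, len g <= r -> g \in s.
Variables (psi : G -> R) (C : R).
Hypothesis psiM : {morph psi : g h / (g * h)%g >-> g + h}.
Hypothesis psi_len : forall g, `|psi g| <= C * len g.

(** Otherwise the length of [ga ^+ (2 ^ i)] would grow at most linearly in [i], whereas [psi] grows
    like [2 ^ i] and is bounded by a multiple of the length. *)
Lemma len_doubling (ga : G) (X : R) : psi ga != 0 ->
  exists2 M, (0 < M)%N & len (ga ^+ M)%g + X <= len (ga ^+ (M + M))%g.
Proof.
move=> pga; apply: contrapT => H.
have C0 : 0 <= C.
  have := psi_len ga; have := len_ge0 ga; have : 0 < `|psi ga| by rewrite normr_gt0.
  move: `|_| (len _) => a b; nra.
have up i : len (ga ^+ (2 ^ i))%g <= len ga + i%:R * `|X|.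
  elim: i => [|i IH]; first by rewrite expg1; lra.
  have : ~ (len (ga ^+ (2 ^ i))%g + X <= len (ga ^+ (2 ^ i + 2 ^ i))%g).
    by move=> h; apply: H; exists (2 ^ i)%N => //; rewrite expn_gt0.
  move/negP; rewrite -ltNge addnn -mul2n -expnS => h.
  rewrite -natr1; have := ler_norm X; lra.
have lo i : (2 ^ i)%:R * `|psi ga| <= C * (len ga + i%:R * `|X|).
  apply: le_trans (ler_wpM2l C0 (up i)).
  by apply: le_trans (psi_len _); rewrite (psiX psiM) normrM ger0_norm ?ler0n.
have sq i : (i * i <= 4 * 2 ^ i)%N.
  by elim: i => // i IH; rewrite expnS; case: i IH => [|[|[|[|i]]]] //= IH; nia.
have p0 : 0 < `|psi ga| by rewrite normr_gt0.
have g0 := len_ge0 ga; have X0 := normr_ge0 X.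
pose K := 4 * (C * (len ga + `|X|)) / `|psi ga|.
have K0 : 0 <= K by apply: divr_ge0; [rewrite !mulr_ge0 // addr_ge0|exact: ltW].
have := archi_boundP K0; set n := Num.bound _ => nK.
have n1 : 1 <= n%:R :> R.
  by rewrite ler1n lt0n; apply/eqP => n0; rewrite n0 in nK; lra.
have e1 : n%:R * n%:R <= 4 * (2 ^ n)%:R :> R.
  by rewrite -!natrM ler_nat sq.
have e2 : 4 * (2 ^ n)%:R * `|psi ga| <= 4 * (C * (len ga + n%:R * `|X|)).
  by rewrite -mulrA ler_pM2l // lo.
have e3 : 4 * (C * (len ga + n%:R * `|X|)) <= n%:R * (4 * (C * (len ga + `|X|))).
  have : C * (len ga + n%:R * `|X|) <= C * (n%:R * (len ga + `|X|)).
    apply: ler_wpM2l => //; rewrite mulrDr lerD2r ler_peMl //.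
  move: (C * (len ga + n%:R * `|X|)) => t; lra.
have e4 : n%:R * n%:R * `|psi ga| <= n%:R * (4 * (C * (len ga + `|X|))).
  by apply: le_trans e3; apply: le_trans e2; rewrite ler_wpM2r.
move: nK; rewrite /K ltr_pdivrMr // => nK.
move: e4; rewrite -mulrA ler_pM2l; last by lra.
by rewrite leNgt nK.
Qed.

(** Conjugation changes the length of every power by at most [2 * len h], so it cannot affect the
    linear rate of growth. *)
Lemma len_conj_power (w : G) (s : R) : (forall n, n%:R * s <= len (w ^+ n)%g) ->
  forall N h, (0 < N)%N -> 0 <= s -> s <= len ((w ^+ N) ^ h)%g.
Proof.
move=> grow N h N0 s0; rewrite leNgt; apply/negP => small.
set c := len _ in small.
have up n : len (((w ^+ N) ^ h) ^+ n)%g <= n%:R * c.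
  elim: n => [|n IH]; first by rewrite expg0 len1 mul0r.
  by rewrite expgS -natr1; have := lenM ((w ^+ N) ^ h)%g (((w ^+ N) ^ h) ^+ n)%g; rewrite -/c; lra.
have up2 n : len (w ^+ (N * n))%g <= n%:R * c + 2 * len h.
  have -> : (w ^+ (N * n) = h * (((w ^+ N) ^ h) ^+ n) * h^-1)%g.
    by rewrite -conjXg conjgE !mulgA mulgV mul1g mulgK expgnA.
  have := lenM (h * (((w ^+ N) ^ h) ^+ n))%g h^-1%g; have := lenM h (((w ^+ N) ^ h) ^+ n)%g.
  by rewrite lenV; have := up n; lra.
have ineq n : n%:R * (s - c) <= 2 * len h.
  have := up2 n; have := grow (N * n)%N; rewrite natrM.
  have : n%:R * s <= N%:R * n%:R * s.
    by rewrite ler_wpM2r // ler_peMl ?ler0n // ler1n.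
  move: (N%:R * _ * _) (len _) => a b; lra.
have sc : 0 < s - c by rewrite subr_gt0.
have h0 : 0 <= 2 * len h / (s - c) by apply: divr_ge0; [rewrite mulr_ge0|exact: ltW].
have := archi_boundP h0; rewrite ltr_pdivrMr // ltNge.
by rewrite ineq.
Qed.

Hypothesis not_vc : ~ virtually_cyclic G.

(* [eta] is a commutator of a large power of [ga0] with an element [g] that moves
   both of its fixed points at infinity. *)
Lemma kernel_large_translation (ga0 : G) (B : R) : psi ga0 != 0 ->
  exists2 eta, psi eta = 0 & forall N h, (0 < N)%N -> B <= len ((eta ^+ N) ^ h)%g.
Proof.
move=> pga0; have D0 := D_ge0.
(* The excess [2 * D + 1] is what [chain_growth] needs to make the powers of [ga] grow by [D + 1] at
   each step. *)
have [M M0 MX] := len_doubling (2 * D + 1) pga0.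
pose ga := (ga0 ^+ M)%g.
have pga : psi ga != 0.
  by rewrite (psiX psiM) mulf_neq0 // pnatr_eq0 -lt0n.
have growth (x : G) : len (x ^+ 2)%g = len (ga ^+ 2)%g -> len x = len ga ->
    forall n, len (x ^+ n)%g + (D + 1) <= len (x ^+ n.+1)%g.
  move=> x2 x1 n.
  have ga2 : len ga + (2 * D + 1) <= len (ga ^+ 2)%g by rewrite /ga -expgnA muln2 -addnn.
  have dE i : dist (x ^+ i)%g (x ^+ i.+1)%g = len ga by rewrite expgSr mulKg.
  have dE2 i : dist (x ^+ i)%g (x ^+ i.+2)%g = len (ga ^+ 2)%g.
    by rewrite -addn2 expgnDr mulKg.
  have H := @chain_growth _ _ _ _ len1 lenM D_ge0 four_point (fun i => x ^+ i)%g (D + 1).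
  have := H _ _ _ n; rewrite !expg0 !invg1 !mul1g; apply.
  - by lra.
  - by move=> i; rewrite dE dE2; lra.
  - by move=> i; rewrite dE dE2; lra.
have grow1 := growth ga erefl erefl.
have grow2 : forall n, len (ga^-1 ^+ n)%g + (D + 1) <= len (ga^-1 ^+ n.+1)%g.
  by apply: growth; rewrite ?expVgn lenV.
have pgaV : psi ga^-1%g != 0 by rewrite (psiV psiM) oppr_eq0.
have [s1 s1P] := fellow_coset len_ge0 len1 lenV lenM D_ge0 four_point psiM pga proper grow1.
have [s2 s2P] := fellow_coset len_ge0 len1 lenV lenM D_ge0 four_point psiM pgaV proper grow2.
(* If every element fixed one of the two points, finitely many cosets of the powers of [ga] would
   cover the group. Inverses are taken because [fellow_coset] has the power on the left and
   [virtually_cyclic] on the right. *)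
have [g [ng1 ng2]] : exists g, ~ fellow_unbounded len ga g /\ ~ fellow_unbounded len ga^-1%g g.
  apply: contrapT => H; apply: not_vc; exists ga, (map invg (s1 ++ s2)) => g.
  have key x : (exists b n, b \in s1 ++ s2 /\ (x = ga ^+ n * b \/ x = ga ^- n * b)%g) ->
      exists2 t, t \in map invg (s1 ++ s2) &
      exists n : nat, (x^-1 = t * ga ^+ n \/ x^-1 = t * ga ^- n)%g.
    move=> [b [n [bs E]]]; exists b^-1%g; first exact: map_f.
    exists n; case: E => ->; [right|left]; by rewrite invgM ?invgK.
  rewrite -[g]invgK; apply: key.
  have [/s1P[b [n [bs E]]]|n1] := pselect (fellow_unbounded len ga g^-1%g).
    by exists b, n; rewrite mem_cat bs.
  have [/s2P[b [n [bs E]]]|n2] := pselect (fellow_unbounded len ga^-1%g g^-1%g).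
    exists b, n; rewrite mem_cat bs orbT; split=> //.
    by rewrite expVgn invgK in E; case: E; auto.
  by exfalso; apply: H; exists g^-1%g.
have [B1 B1P] : exists B, forall N, len (ga ^+ N)%g + len (g * ga ^+ N)%g -
    dist (ga ^+ N)%g (g * ga ^+ N)%g <= B.
  apply: contrapT => H; apply: ng1 => b; apply: contrapT => H'; apply: H; exists b => N.
  by rewrite leNgt; apply/negP => h; apply: H'; exists N.
have [B2 B2P] : exists B, forall N, len (ga^-1 ^+ N)%g + len (g * ga^-1 ^+ N)%g -
    dist (ga^-1 ^+ N)%g (g * ga^-1 ^+ N)%g <= B.
  apply: contrapT => H; apply: ng2 => b; apply: contrapT => H'; apply: H; exists b => N.
  by rewrite leNgt; apply/negP => h; apply: H'; exists N.
pose s := `|B| + 1; have s0 : 0 < s by rewrite /s; have := normr_ge0 B; lra.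
have sB : B <= s by rewrite /s; have := ler_norm B; lra.
have g0 := len_ge0 g.
have [N NP] : exists N, `|B1| + `|B2| + 4 * len g + D + s <= len (ga ^+ N)%g.
  have pos : 0 <= `|B1| + `|B2| + 4 * len g + D + s.
    by rewrite !addr_ge0 ?mulr_ge0 // ltW.
  exists (Num.bound (`|B1| + `|B2| + 4 * len g + D + s)).
  have := h_linear D_ge0 grow1 0 (Num.bound (`|B1| + `|B2| + 4 * len g + D + s)).
  by rewrite expg0 len1 addn0; have := archi_boundP pos; lra.
pose a := (ga ^+ N)%g; pose b := (g * a^-1 * g^-1)%g; pose w := (a * b)%g.
have psiw : psi w = 0.
  by rewrite /w /b !psiM !(psiV psiM); lra.
exists w => // n h n0; apply: le_trans sB _; apply: len_conj_power => //; last exact: ltW.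
have lb : len b <= len a + 2 * len g.
  have := lenM (g * a^-1)%g g^-1%g; have := lenM g a^-1%g; rewrite !lenV /b; lra.
have aV : (ga^-1 ^+ N)%g = a^-1%g by rewrite expVgn.
have lga (x : G) : len x - len g <= len (g * x)%g.
  have := lenM g^-1%g (g * x)%g; rewrite mulKg lenV; lra.
(* Up to [len g], the length of [w] is the distance from [a^-1] to [g * a^-1]; the bound [B2] on
   their Gromov products makes it nearly [2 * len a]. Likewise [B1] for [b * a]. *)
have lw : len a + D + s <= len w /\ len b + D + s <= len w.
  have e1 := B2P N; rewrite aV invgK lenV in e1.
  have e2 := lenM (a * (g * a^-1) * g^-1)%g g; rewrite mulgVK in e2.
  have e3 := lga a^-1%g; rewrite lenV in e3; have e4 := ler_norm B2; have e5 := normr_ge0 B1.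
  have wE : w = (a * (g * a^-1) * g^-1)%g by rewrite /w /b !mulgA.
  by rewrite -wE in e2; move: NP; rewrite -/a => NP; lra.
have lbw : len a + D + s <= len (b * a)%g /\ len b + D + s <= len (b * a)%g.
  have e1 := B1P N; rewrite -/a in e1.
  have e2 := lenM (a^-1 * (g * a) * g^-1)%g g; rewrite mulgVK in e2.
  have e3 := lga a; have e4 := ler_norm B1; have e5 := normr_ge0 B2.
  have bE : len (b * a)%g = len (a^-1 * (g * a) * g^-1)%g.
    by rewrite -lenV /b !invgM !invgK !mulgA.
  by rewrite -bE in e2; move: NP; rewrite -/a => NP; lra.
(* The prefixes of the word [abab...]; their two kinds of junctions, [a * b] and [b * a], were just
   shown to be long. *)
pose x i := if odd i then (w ^+ i./2 * a)%g else (w ^+ i./2)%g.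
have xS i : (x i.+1 = x i * if odd i then b else a)%g.
  rewrite /x /= uphalf_half; case: (odd i) => //=.
  by rewrite add1n expgSr /w mulgA.
have x1 i : dist (x i) (x i.+1) = if odd i then len b else len a.
  by rewrite xS mulKg; case: odd.
have x2 i : dist (x i) (x i.+2) = if odd i then len (b * a)%g else len w.
  by rewrite !xS -mulgA mulKg /=; case: odd.
have cg : forall n, dist (x 0%N) (x n) + s <= dist (x 0%N) (x n.+1).
  apply: (chain_growth len1 lenM D_ge0 four_point s0) => i; rewrite x2 x1 /=.
    by case: odd; lra.
  by case: odd => /=; lra.
have x0 i : dist (x 0%N) (x i) = len (x i) by rewrite /x /= expg0 invg1 mul1g.
have lin i : i%:R * s <= len (x i).
  elim: i => [|i IH]; first by rewrite mul0r.
  by have := cg i; rewrite !x0 -natr1; lra.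
move=> i; have := lin i.*2; rewrite /x odd_double doubleK.
apply: le_trans; rewrite ler_wpM2r ?(ltW s0) // ler_nat -addnn leq_addr //.
Qed.

End HyperbolicGroup.

(** * Word metrics, conjugacy length and homomorphisms to the reals *)

Lemma leastP (P : set nat) n : P n -> P (least P) /\ forall k, P k -> (least P <= k)%N.
Proof.
move=> Pn; rewrite /least; case: xgetP => [x _ []//|H].
have ex : exists n, `[< P n >] by exists n; apply/asboolP.
case: (ex_minnP ex) => k /asboolP Pk kmin; exfalso; apply: (H k).
by split=> // l Pl; apply: kmin; apply/asboolP.
Qed.

Section WordMetric.
Variables (G : groupType) (S : seq G).
Hypothesis genS : generates S.

Lemma word_lengthP g : is_word S (word_length S g) g.
Proof. by have [n gn] := genS g; have [] := leastP (P := [set n | is_word S n g]) gn. Qed.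

Lemma word_length_le n g : is_word S n g -> (word_length S g <= n)%N.
Proof. by move=> gn; have [_] := leastP (P := [set n | is_word S n g]) gn; apply. Qed.

Lemma word_length1 : word_length S 1%g = 0%N.
Proof.
apply/eqP; rewrite -leqn0; apply: word_length_le.
by exists [::]; split=> //; rewrite big_nil.
Qed.

Lemma word_lengthM g h : (word_length S (g * h)%g <= word_length S g + word_length S h)%N.
Proof.
apply: word_length_le; have [w [ws wS gE]] := word_lengthP g.
have [w' [ws' wS' hE]] := word_lengthP h; exists (w ++ w').
by split; rewrite ?size_cat ?ws ?ws' ?all_cat ?wS ?wS' ?big_cat ?gE ?hE.
Qed.

Lemma word_lengthV_le g : (word_length S (g^-1)%g <= word_length S g)%N.
Proof.
apply: word_length_le; have [w [ws wS gE]] := word_lengthP g.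
exists (rev (map invg w)); split; first by rewrite size_rev size_map.
  rewrite all_rev all_map; apply: sub_all wS => s /=; by rewrite invgK orbC.
rewrite {}gE {ws wS}; elim: w => [|s w IH]; first by rewrite !big_nil invg1.
by rewrite big_cons invgM IH /= rev_cons -cats1 big_cat big_seq1.
Qed.

Lemma word_lengthV g : word_length S (g^-1)%g = word_length S g.
Proof.
apply/eqP; rewrite eqn_leq word_lengthV_le /= -{1}[g]invgK.
exact: word_lengthV_le.
Qed.

Lemma word_ball_finite n : exists s : seq G, forall g, (word_length S g <= n)%N -> g \in s.
Proof.
suff [s sP] : exists s : seq G, forall k g, (k <= n)%N -> is_word S k g -> g \in s.
  by exists s => g gn; apply: sP gn (word_lengthP g).
elim: n => [|n [s IH]].
  exists [:: 1%g] => k g; rewrite leqn0 => /eqP-> [w [/size0nil-> _ ->]].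
  by rewrite big_nil mem_head.
exists (s ++ [seq (x * y)%g | x <- S ++ map invg S, y <- s]) => k g kn [w [wk wS ->]].
rewrite mem_cat; case: w wk wS => [|x w] wk wS.
  by rewrite (IH 0%N) //; exists [::].
apply/orP; right; rewrite big_cons; apply/allpairsP; exists (x, \prod_(i <- w) i)%g.
move: wS => /= /andP[xS wS]; split=> //.
  rewrite /= mem_cat; case/orP: xS => [->//|xS]; apply/orP; right.
  by apply/mapP; exists x^-1%g; rewrite ?invgK.
by apply: (IH (size w)) => /=; [move: kn; rewrite -wk|exists w].
Qed.

Lemma conj_lengthP g : exists h, conj_length S g = word_length S (g ^ h)%g.
Proof.
have P : [set word_length S (g ^ h)%g | h in [set: G]] (word_length S (g ^ 1)%g) by exists 1%g.
by have [[h _ E] _] := leastP P; exists h; rewrite E.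
Qed.

Lemma conj_length_le g h : (conj_length S g <= word_length S (g ^ h)%g)%N.
Proof.
have P : [set word_length S (g ^ h)%g | h in [set: G]] (word_length S (g ^ h)%g) by exists h.
by have [_] := leastP P; apply.
Qed.

Lemma conj_lengthV_le g : (conj_length S (g^-1)%g <= conj_length S g)%N.
Proof.
have [h ->] := conj_lengthP g; apply: leq_trans (conj_length_le _ h) _.
by rewrite conjVg word_lengthV.
Qed.

Lemma conj_lengthV g : conj_length S (g^-1)%g = conj_length S g.
Proof.
apply/eqP; rewrite eqn_leq conj_lengthV_le /= -{1}[g]invgK.
exact: conj_lengthV_le.
Qed.

Section Hom.
Variables (R : realType) (psi : G -> R).
Hypothesis psiM : {morph psi : g h / (g * h)%g >-> g + h}.

Definition gen_bound : R := \sum_(s <- S) `|psi s|.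

Lemma gen_bound_ge0 : 0 <= gen_bound.
Proof. exact: sumr_ge0. Qed.

Lemma hom_word_length g : `|psi g| <= gen_bound * (word_length S g)%:R.
Proof.
have [w [<- wS ->]] := word_lengthP g; elim: w wS => [|s w IH] /=.
  by rewrite big_nil (psi1 psiM) normr0 mulr0.
move=> /andP[sS /IH le_w]; rewrite big_cons psiM -natr1 mulrDr mulr1.
apply: le_trans (ler_normD _ _) _; rewrite [X in _ <= X]addrC; apply: lerD => //.
have mem t : t \in S -> `|psi t| <= gen_bound.
  by move=> tS; rewrite /gen_bound (big_rem _ tS) /= lerDl; exact: sumr_ge0.
by case/orP: sS => [/mem//|/mem]; rewrite (psiV psiM) normrN.
Qed.

Lemma hom_conj g h : psi (g ^ h)%g = psi g.
Proof. by have := psiM h (g ^ h)%g; rewrite -conjgC psiM; lra. Qed.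

Lemma hom_conj_length g : `|psi g| <= gen_bound * (conj_length S g)%:R.
Proof.
by have [h ->] := conj_lengthP g; rewrite -(hom_conj g h); exact: hom_word_length.
Qed.

End Hom.
End WordMetric.

Lemma conj_length_change (G : groupType) (S S' : seq G) : generates S -> generates S' ->
  exists K, forall g, (conj_length S' g <= K * conj_length S g)%N.
Proof.
move=> gS gS'; exists (\sum_(s <- S) word_length S' s)%N => g.
have [h ->] := conj_lengthP S g; apply: leq_trans (conj_length_le S' g h) _.
move: (g ^ h)%g => {}g; have [w [<- wS ->]] := word_lengthP gS g.
elim: w wS => [|s w IH] /=; first by rewrite big_nil word_length1.
move=> /andP[sS /IH le_w]; rewrite big_cons mulnS.
apply: leq_trans (word_lengthM gS' _ _) _; apply: leq_add => //.
have mem t : t \in S -> (word_length S' t <= \sum_(s <- S) word_length S' s)%N.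
  by move=> tS; rewrite (big_rem _ tS) /= leq_addr.
by case/orP: sS => [/mem//|/mem]; rewrite word_lengthV.
Qed.

Lemma word_hyperbolic_four_point (R : realType) (G : groupType) : word_hyperbolic R G ->
  exists (S : seq G) (D : R), [/\ generates S, 0 <= D & forall x y z w : G,
    let d g h := (word_length S (g^-1 * h)%g)%:R : R in
    d x z + d y w <= d x y + d z w + D \/ d x z + d y w <= d y z + d x w + D].
Proof.
move=> [S genS [D hyp]]; exists S, (2 * `|D|); split=> [//||x y z w d]; first by rewrite mulr_ge0.
have dC a b : d a b = d b a by rewrite /d -word_lengthV // invgM invgK.
have DD := ler_norm D; have := hyp w x y z; rewrite /gromov_product -!/(d _ _).
rewrite minEle; case: ifP => _ h; [left|right]; rewrite ?(dC y z) ?(dC z y); lra.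
Qed.

Lemma kernel_large_conj_length (R : realType) (G : groupType) :
  word_hyperbolic R G -> ~ virtually_cyclic G ->
  exists2 S : seq G, generates S & forall (psi : G -> R) (ga : G) (B : nat),
    {morph psi : g h / (g * h)%g >-> g + h} -> psi ga != 0 ->
    exists2 eta, psi eta = 0 & forall N, (0 < N)%N -> (B <= conj_length S (eta ^+ N)%g)%N.
Proof.
move=> /word_hyperbolic_four_point[S [D [genS D0 fp]]] nvc; exists S => // psi ga B psiM pga.
have := @kernel_large_translation R G (fun g => (word_length S g)%:R) D _ _ _ _ D0 fp _
  psi (gen_bound S psi) psiM _ nvc ga B%:R pga.
case=> [g|||g h|r|g|eta eta0 H].
- by rewrite ler0n.
- by rewrite word_length1.
- by move=> g; rewrite word_lengthV.
- by rewrite -natrD ler_nat word_lengthM.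
- have [s sP] := word_ball_finite genS (Num.bound r); exists s => g gr; apply: sP.
  rewrite -(ler_nat R); apply: ltW; apply: le_lt_trans gr _.
  have [r0|r0] := leP 0 r; first exact: archi_boundP.
  by apply: lt_le_trans r0 _.
- exact: hom_word_length.
exists eta => // N N0; have [h ->] := conj_lengthP S (eta ^+ N)%g.
by have := H N h N0; rewrite ler_nat.
Qed.

(** * Eigenvalues of twists *)

Section CharPolyBlocks.
Variable F : fieldType.

Lemma char_poly_diag_block n1 n2 (A : 'M[F]_n1) (B : 'M[F]_n2) :
  char_poly (block_mx A 0 0 B) = char_poly A * char_poly B.
Proof.
rewrite /char_poly /char_poly_mx map_block_mx !raddf0.
rewrite (_ : 'X%:M = block_mx 'X%:M 0 0 'X%:M); last exact: scalar_mx_block.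
by rewrite opp_block_mx add_block_mx !oppr0 !addr0 det_lblock.
Qed.

Lemma char_poly_cast n n' (e : n = n') (A : 'M[F]_n) :
  char_poly (castmx (e, e) A) = char_poly A.
Proof. by case: n' / e; rewrite castmx_id. Qed.

Lemma char_poly_mxdiag m (d : 'I_m -> nat) (B : forall j, 'M[F]_(d j)) :
  char_poly (\mxdiag_j B j) = \prod_j char_poly (B j).
Proof.
elim: m d B => [|m IH] d B.
  rewrite [RHS]big_ord0; move: (\mxdiag_j B j).
  by rewrite big_ord0 => M; rewrite /char_poly det_mx00.
by rewrite mxdiag_recl char_poly_cast char_poly_diag_block IH big_ord_recl.
Qed.

(** Rectangular matrices are allowed because the dimension of a space and the sum of those of its
    summands are only propositionally equal. *)
Lemma char_poly_change n n' (Q : 'M[F]_(n', n)) (Q' : 'M[F]_(n, n')) M M' : n' = n ->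
  Q' *m Q = 1%:M -> Q *m M = M' *m Q -> char_poly M = char_poly M'.
Proof.
move=> e; case: n / e Q Q' M => Q Q' M Q'Q QM.
have [_ Qu] := mulmx1_unit Q'Q.
have P0 : \det (map_mx (@polyC F) Q) != 0.
  by rewrite det_map_mx polyC_eq0 -unitfE -unitmxE.
apply: (mulfI P0); rewrite [RHS]mulrC -!det_mulmx; congr (\det _).
by rewrite /char_poly_mx mulmxBr mulmxBl -!map_mxM QM scalar_mxC.
Qed.

End CharPolyBlocks.

Import passmx.

Section EndMx.
Variable F : fieldType.
Implicit Types V W : vectType F.

Lemma vbasis_full V : basis_of {:V} (vbasis {:V}).
Proof. exact: vbasisP. Qed.

Lemma end_mx_comp V (f g : 'End(V)) : end_mx (f \o g)%VF = end_mx g *m end_mx f.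
Proof. exact: passmx.mxof_comp (vbasis_full V) _ _. Qed.

Lemma end_mx1 V : end_mx (\1%VF : 'End(V)) = 1%:M.
Proof. by apply: passmx.mxof1; apply: basis_free (vbasis_full V). Qed.

Lemma end_mxZ V a (f : 'End(V)) : end_mx (a *: f) = a *: end_mx f.
Proof. by rewrite /end_mx linearZ. Qed.

Lemma dim_subvs V (U : {vspace V}) : \dim {:subvs_of U} = \dim U.
Proof. by rewrite dimvf. Qed.

End EndMx.

Section Decomposition.
Variables (R : realType) (k : scalar_kind) (V : vectType (scalars R k)).
Variables (m : nat) (U : decomposition V m).

Lemma sumv_pi_summand i j (u : subvs_of (U j)) :
  sumv_pi_for (summand_sum U) i (vsval u) = if i == j then vsval u else 0.
Proof.
have dir : directv (\sum_(j < m) U j) := summand_direct U.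
pose f i := sumv_pi_for (summand_sum U) i (vsval u).
pose g i : V := if i == j then vsval u else 0.
have fU l : true -> f l \in U l by move=> _; exact: memv_sum_pi.
have gU l : true -> g l \in U l.
  by move=> _; rewrite /g; case: eqP => [->|_]; rewrite ?mem0v ?subvsP.
have := directv_sum_unique dir f g fU gU.
have -> : \sum_l f l = vsval u by apply: sumv_pi_sum; rewrite memvf.
have -> : \sum_l g l = vsval u by rewrite -big_mkcond big_pred1_eq.
rewrite eqxx => /esym/forall_inP/(_ i isT)/eqP; exact.
Qed.

Lemma dsum_blocksE B j (u : subvs_of (U j)) :
  dsum_blocks B (vsval u) = vsval (B j u).
Proof.
rewrite /dsum_blocks sum_lfunE (bigD1 j) //= big1 ?addr0 => [|i ij].
  by rewrite !comp_lfunE !lfunE /= sumv_pi_summand eqxx vsvalK.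
by rewrite !comp_lfunE sumv_pi_summand (negbTE ij) !linear0.
Qed.

Lemma end_summand_ext (f g : 'End(V)) :
  (forall j (u : subvs_of (U j)), f (vsval u) = g (vsval u)) -> f = g.
Proof.
move=> fg; apply/lfunP => v.
have vV : v \in fullv by exact: memvf.
rewrite -(sumv_pi_sum (summand_sum U) vV) !linear_sum; apply: eq_bigr => j _ /=.
by rewrite -(vsprojK (memv_sum_pi (summand_sum U) j v)).
Qed.

Lemma blockE (A : 'End(V)) j (u : subvs_of (U j)) : (A @: U j)%VS = U j ->
  vsval (block U A j u) = A (vsval u).
Proof.
move=> AU; rewrite /block lfunE /= vsprojK // -[U j in X in _ \in X]AU.
exact/memv_img/subvsP.
Qed.

Lemma dim_decomposition : (\sum_j \dim {:subvs_of (U j)})%N = \dim {:V}.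
Proof.
have /directvP /= H := summand_direct U.
rewrite (summand_sum U) H; apply: eq_bigr => j _; exact: dim_subvs.
Qed.

(** The stacked matrices of the inclusions of the summands change the basis; those of the
    projections are inverse to them. *)
Lemma char_poly_dsum (B : forall j, 'End(subvs_of (U j))) :
  char_poly (end_mx (dsum_blocks B)) = \prod_j char_poly (end_mx (B j)).
Proof.
rewrite -char_poly_mxdiag.
pose e := vbasis {:V}; pose eb := vbasis_full V.
pose ej j := vbasis {:subvs_of (U j)}; pose ejb j := vbasis_full (subvs_of (U j)).
pose inc j : 'Hom(subvs_of (U j), V) := linfun (@vsval _ _ (U j)).
pose prj j : 'Hom(V, subvs_of (U j)) := (linfun (@vsproj _ _ (U j)) \o sumv_pi_for (summand_sum U) j)%VF.
apply: (@char_poly_change _ _ _ (\mxcol_j passmx.mxof (ej j) e (inc j))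
  (\mxrow_j passmx.mxof e (ej j) (prj j))).
- exact: dim_decomposition.
- rewrite mul_mxrow_mxcol; under eq_bigr do rewrite -(passmx.mxof_comp _ _ (ejb _)).
  rewrite -linear_sum -[RHS](passmx.mxof1 (basis_free eb)); congr (passmx.mxof _ _ _).
  apply: end_summand_ext => j u; rewrite id_lfunE sum_lfunE (bigD1 j) //= big1 ?addr0 => [|i ij].
    by rewrite !comp_lfunE !lfunE /= sumv_pi_summand eqxx vsvalK.
  by rewrite !comp_lfunE sumv_pi_summand (negbTE ij) !linear0.
- rewrite mxcol_mul mul_mxdiag_mxcol; apply/eq_mxcolP => j.
  rewrite -(passmx.mxof_comp _ _ eb) -(passmx.mxof_comp _ _ (ejb j)).
  congr (passmx.mxof _ _ _); apply/lfunP => u.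
  by rewrite !comp_lfunE !lfunE /= dsum_blocksE.
Qed.

End Decomposition.

(** * Gaps between sorted values as separated index sets *)

Section SortedValues.
Variables (R : realType) (I : finType) (x : I -> R) (s : seq R).
Hypothesis sx : perm_eq s [seq x a | a <- enum I].

Local Notation sorted_value i := (nth 0 (sort (fun x y => y <= x) s) i.-1).

Let t := sort (relpre x (fun x y => y <= x)) (enum I).

Let ge_total : total (fun x y : R => y <= x).
Proof. by move=> a b; exact: le_total. Qed.

Let ge_trans : transitive (fun x y : R => y <= x).
Proof. by move=> a b c ab bc; exact: le_trans bc ab. Qed.

Let ge_anti : antisymmetric (fun x y : R => y <= x).
Proof. by move=> a b; rewrite andbC => /le_anti. Qed.

Let size_t : size t = #|I|.
Proof. by rewrite size_sort cardE. Qed.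

Let uniq_t : uniq t.
Proof. by rewrite sort_uniq enum_uniq. Qed.

Let mem_t a : a \in t.
Proof. by rewrite mem_sort mem_enum. Qed.

Let sorted_valueE a0 i : (0 < i <= #|I|)%N -> sorted_value i = x (nth a0 t i.-1).
Proof.
move=> /andP[i0 iI]; have /perm_sortP -> := sx; [|exact: ge_total|exact: ge_trans|exact: ge_anti].
by rewrite sort_map (nth_map a0) // size_t; lia.
Qed.

Let t_mono a0 i j : (i <= j < #|I|)%N -> x (nth a0 t j) <= x (nth a0 t i).
Proof.
move=> /andP[ij jI]; pose e := relpre x (fun x y : R => y <= x).
have et : total e by move=> a b; exact: ge_total.
have er : reflexive e by move=> a; exact: lexx.
have etr : transitive e by move=> a b c; exact: ge_trans.
have st : sorted e t by exact: sort_sorted.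
apply: (sorted_leq_nth etr er a0 st) => //; rewrite inE size_t //.
by apply: leq_ltn_trans jI.
Qed.

Lemma sorted_value_split k : (0 < k < #|I|)%N -> exists T : {set I},
  [/\ #|T| = k, forall a, a \in T -> sorted_value k <= x a &
    forall b, b \notin T -> x b <= sorted_value k.+1].
Proof.
move=> /andP[k0 kI]; have /card_gt0P[a0 _] : (0 < #|I|)%N by lia.
exists [set a in take k t]; split.
- by rewrite cardsE (card_uniqP (take_uniq k uniq_t)) size_take size_t kI.
- move=> a; rewrite inE => ak; rewrite (sorted_valueE a0); last by lia.
  have ai : (index a t < k)%N by rewrite index_ltn.
  rewrite -[X in _ <= x X](nth_index a0 (mem_t a)); apply: t_mono; lia.
- move=> b; rewrite inE => bk; rewrite (sorted_valueE a0); last by lia.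
  have bi : (k <= index b t)%N by move: bk; rewrite in_take // -leqNgt.
  rewrite -[X in x X <= _](nth_index a0 (mem_t b)); apply: t_mono => /=.
  by rewrite bi -size_t index_mem mem_t.
Qed.

Lemma sorted_value_bounds k (T : {set I}) th th' : (0 < k < #|I|)%N -> #|T| = k ->
  (forall a, a \in T -> th <= x a) -> (forall b, b \notin T -> x b <= th') ->
  th <= sorted_value k /\ sorted_value k.+1 <= th'.
Proof.
move=> /andP[k0 kI] Tk hT hT'; have /card_gt0P[a0 _] : (0 < #|I|)%N by lia.
have k1 : (0 < k <= #|I|)%N by rewrite k0 ltnW.
have k2 : (0 < k.+1 <= #|I|)%N by [].
rewrite (sorted_valueE a0 k1) (sorted_valueE a0 k2) /=; split; rewrite leNgt; apply/negP => h.
  (* If the [k]-th value were below [th], the [k] elements of [T] would all be among the first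
     [k - 1] indices. *)
  have sub : T \subset [set a in take k.-1 t].
    apply/fintype.subsetP => a aT; rewrite inE in_take // ltnNge; apply/negP => ia.
    have := hT a aT; rewrite leNgt => /negP; apply; apply: le_lt_trans h.
    rewrite -[X in x X <= _](nth_index a0 (mem_t a)); apply: t_mono.
    by rewrite ia -size_t index_mem mem_t.
  have := subset_leq_card sub; rewrite Tk cardsE (card_uniqP (take_uniq _ uniq_t)) size_take size_t.
  by case: ifP; lia.
have sub : [set a in take k.+1 t] \subset T.
  apply/fintype.subsetP => a; rewrite inE in_take // => ia; apply: contraT => /hT'.
  rewrite leNgt => /negP; case; apply: lt_le_trans h _.
  by rewrite -[X in _ <= x X](nth_index a0 (mem_t a)); apply: t_mono; lia.
have := subset_leq_card sub; rewrite Tk cardsE (card_uniqP (take_uniq _ uniq_t)) size_take size_t.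
by case: ifP; lia.
Qed.

Hypothesis x_gt0 : forall a, 0 < x a.

Lemma sorted_value_gt0 k : (0 < k <= #|I|)%N -> 0 < sorted_value k.
Proof.
move=> /andP[k0 kI]; have /card_gt0P[a0 _] : (0 < #|I|)%N by lia.
by rewrite (sorted_valueE a0) // k0.
Qed.

Lemma sorted_value_gap_ge0 k : (0 < k < #|I|)%N ->
  0 <= ln (sorted_value k / sorted_value k.+1).
Proof.
move=> kI; have /card_gt0P[a0 _] : (0 < #|I|)%N by lia.
have p : 0 < sorted_value k.+1 by apply: sorted_value_gt0; lia.
have k1 : (0 < k <= #|I|)%N by lia.
have k2 : (0 < k.+1 <= #|I|)%N by lia.
rewrite ln_ge0 // ler_pdivlMr // mul1r (sorted_valueE a0 k1) (sorted_valueE a0 k2) /=.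
by apply: t_mono; lia.
Qed.

(** Trades the sorted list, which forgets blocks, for a set of indices that remembers them; such a
    set need not be unique when [r <= 0]. *)
Lemma sorted_value_gapP k r : (0 < k < #|I|)%N ->
  r <= ln (sorted_value k / sorted_value k.+1) <->
  exists2 T : {set I}, #|T| = k & separated T (expR r) x.
Proof.
move=> kI; have pk : 0 < sorted_value k by apply: sorted_value_gt0; lia.
have pk1 : 0 < sorted_value k.+1 by apply: sorted_value_gt0; lia.
have -> : r <= ln (sorted_value k / sorted_value k.+1) <->
    expR r * sorted_value k.+1 <= sorted_value k.
  rewrite -ler_pdivlMr // -[X in _ <-> expR r <= X]lnK ?posrE ?divr_gt0 //.
  by rewrite ler_expR.
split=> [gap|[T Tk [th th0 [h1 h2]]]].
  have [T [Tk h1 h2]] := sorted_value_split kI.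
  exists T => //; exists (sorted_value k) => //; split=> // b /h2 hb.
  by apply: le_trans gap; rewrite ler_pM2l ?expR_gt0.
have h2' b : b \notin T -> x b <= (expR r)^-1 * th.
  by move=> /h2; rewrite ler_pdivlMl ?expR_gt0.
have [e1 e2] := sorted_value_bounds kI Tk h1 h2'.
by apply: le_trans e1; rewrite -ler_pdivlMl ?expR_gt0.
Qed.

End SortedValues.

Section ComplexOfScalar.
Variables (R : realType) (k : scalar_kind).

Lemma complex_of_scalar_zmod : zmod_morphism (@complex_of_scalar R k).
Proof. by case: k => x y //=; rewrite rmorphB. Qed.

Lemma complex_of_scalar_monoid : monoid_morphism (@complex_of_scalar R k).
Proof. by case: k; split=> //= x y; rewrite rmorphM. Qed.

HB.instance Definition _ := GRing.isZmodMorphism.Build (scalars R k) R[i]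
  (@complex_of_scalar R k) complex_of_scalar_zmod.
HB.instance Definition _ := GRing.isMonoidMorphism.Build (scalars R k) R[i]
  (@complex_of_scalar R k) complex_of_scalar_monoid.

Lemma complex_of_scalar_of_real (x : R) :
  complex_of_scalar (scalar_of_real k x) = real_complex R x.
Proof. by case: k. Qed.

End ComplexOfScalar.

Lemma nrm_real (R : realType) (x : R) : Normc.normc (real_complex R x) = `|x|.
Proof. by rewrite /= expr0n /= addr0 sqrtr_sqr. Qed.

Section Eigenvalues.
Variable R : realType.
Local Notation C := R[i].

Lemma char_poly_scale d (M : 'M[C]_d) (z : 'I_d -> C) (c : C) : M \in unitmx ->
  char_poly M = \prod_l ('X - (z l)%:P) ->
  char_poly (c *: M) = \prod_l ('X - (c * z l)%:P).
Proof.
move=> Mu zE; have [P [T [Pu PM [Tt _ _]]]] := adapted_triangular ltr01 Mu.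
have cPM : P *m (c *: M) = (c *: T) *m P by rewrite -scalemxAr PM scalemxAl.
rewrite (similar_char_poly Pu cPM) char_poly_trig; last first.
  by apply/is_trig_mxP => i j ij; rewrite mxE (is_trig_mxP Tt) ?mulr0.
rewrite (eq_bigr (fun l => 'X - (c * T l l)%:P)) => [|l _]; last by rewrite mxE.
apply: (perm_codom_prod (fun x => 'X - (c * x)%:P)); apply: (char_poly_perm _ zE).
by rewrite (similar_char_poly Pu PM) char_poly_trig.
Qed.

Variables (k : scalar_kind) (W : vectType (scalars R k)).

Lemma eigenvaluesE (f : 'End(W)) :
  map_poly (@complex_of_scalar R k) (char_poly (end_mx f)) = \prod_(z <- eigenvalues f) ('X - z%:P).
Proof.
rewrite /eigenvalues; case: closed_field_poly_normal => s /= sE.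
rewrite {1}sE (monicP _) ?scale1r //.
by rewrite map_monic char_poly_monic.
Qed.

Lemma size_eigenvalues (f : 'End(W)) : size (eigenvalues f) = \dim {:W}.
Proof.
have := congr1 size (congr1 polyseq (eigenvaluesE f)).
by rewrite size_map_poly size_char_poly size_prod_XsubC => -[].
Qed.

(** The transpose makes this multiplicative, since [end_mx] acts on row vectors and reverses
    products. *)
Definition complex_mx (f : 'End(W)) : 'M[C]_(\dim {:W}) := (map_mx (@complex_of_scalar R k) (end_mx f))^T.

Lemma char_poly_complex_mx (f : 'End(W)) :
  char_poly (complex_mx f) = \prod_(l < \dim {:W}) ('X - ((eigenvalues f)`_l)%:P).
Proof.
have -> : char_poly (complex_mx f) = map_poly (@complex_of_scalar R k) (char_poly (end_mx f)).
  rewrite map_char_poly /complex_mx /char_poly -[RHS]det_tr; congr (\det _).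
  rewrite /char_poly_mx [RHS]raddfB /= tr_scalar_mx.
  by rewrite ?map_trmx; congr (_ - _); apply/matrixP => i j; rewrite !mxE.
by rewrite eigenvaluesE (big_nth 0) big_mkord size_eigenvalues.
Qed.

Lemma complex_mx_comp (f g : 'End(W)) : complex_mx (f \o g)%VF = complex_mx f *m complex_mx g.
Proof. by rewrite /complex_mx end_mx_comp map_mxM trmx_mul. Qed.

Lemma complex_mx1 : complex_mx \1%VF = 1%:M.
Proof. by rewrite /complex_mx end_mx1 map_mx1 trmx1. Qed.

Lemma complex_mxZ a (f : 'End(W)) : complex_mx (a *: f) = complex_of_scalar a *: complex_mx f.
Proof. by rewrite /complex_mx end_mxZ map_mxZ; apply/matrixP => i j; rewrite !mxE. Qed.

End Eigenvalues.

(** * Moduli of the eigenvalues of a twist *)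

Section Twist.
Variables (R : realType) (k : scalar_kind) (V : vectType (scalars R k)).
Variables (m : nat) (U : decomposition V m) (G : groupType).
Variable zeta : G -> 'End(V).
Hypothesis hzeta : block_normalized U zeta.
Local Notation C := R[i].
Local Notation nrm := (@Normc.normc R).

Definition bdim (j : 'I_m) : nat := \dim {:subvs_of (U j)}.
Local Notation I := {j : 'I_m & 'I_(bdim j)}.

Definition block_mx_of (j : 'I_m) (g : G) : 'M[C]_(bdim j) := complex_mx (block U (zeta g) j).

Definition block_eigen (g : G) (a : I) : C := (eigenvalues (block U (zeta g) (tag a)))`_(tagged a).

Lemma zeta_stable g j : (zeta g @: U j)%VS = U j.
Proof. by have [_ /(_ g)[[_ H] _]] := hzeta; exact: H. Qed.

Lemma block_hom j : mx_hom (block_mx_of j).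
Proof.
have [[z1 zM] _] := hzeta; split=> [|g h]; rewrite /block_mx_of.
  rewrite -complex_mx1; congr (complex_mx _); apply/lfunP => u; apply: subvs_inj.
  by rewrite blockE ?zeta_stable // z1 !id_lfunE.
rewrite -complex_mx_comp; congr (complex_mx _); apply/lfunP => u; apply: subvs_inj.
by rewrite comp_lfunE !blockE ?zeta_stable // zM comp_lfunE.
Qed.

Lemma block_eigenE j g : char_poly (block_mx_of j g) =
  \prod_l ('X - (block_eigen g (existT (fun j => ordinal (bdim j)) j l))%:P).
Proof. exact: char_poly_complex_mx. Qed.

Lemma block_eigen_neq0 g a : block_eigen g a != 0.
Proof.
case: a => j l; have u := block_unit block_hom j g.
have : root (char_poly (block_mx_of j g)) (block_eigen g (existT (fun j => ordinal (bdim j)) j l)).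
  by rewrite block_eigenE (bigD1 l) //= rootM root_XsubC eqxx.
apply: contraTneq => ->; rewrite rootE horner_coef0 char_poly_det.
by rewrite mulf_neq0 ?signr_eq0 // -unitfE -unitmxE.
Qed.

(** [delta] is left out: it scales all eigenvalues by one factor, which ratios do not see. *)
Definition twist (phi : G -> 'rV[R]_m) (j : 'I_m) (g : G) : 'M[C]_(bdim j) :=
  real_complex R (expR (phi g 0 j)) *: block_mx_of j g.

Definition twist_eigen (phi : G -> 'rV[R]_m) (g : G) (a : I) : C :=
  real_complex R (expR (phi g 0 (tag a))) * block_eigen g a.

Definition modulus (phi : G -> 'rV[R]_m) (g : G) (a : I) : R :=
  expR (phi g 0 (tag a)) * nrm (block_eigen g a).

Lemma nrm_twist_eigen phi g a : nrm (twist_eigen phi g a) = modulus phi g a.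
Proof. by rewrite /twist_eigen Normc.normcM nrm_real ger0_norm ?expR_ge0. Qed.

Lemma modulus_gt0 phi g a : 0 < modulus phi g a.
Proof. by rewrite mulr_gt0 ?expR_gt0 ?nrm_gt0 ?block_eigen_neq0. Qed.

Lemma hom_vec1 (phi : G -> 'rV[R]_m) : {morph phi : g h / (g * h)%g >-> g + h} -> phi 1%g = 0.
Proof.
move=> h; have := h 1%g 1%g; rewrite mulg1 => /eqP.
by rewrite -{1}[phi _]addr0 (inj_eq (addrI _)) eq_sym => /eqP.
Qed.

Lemma twist_hom phi j : {morph phi : g h / (g * h)%g >-> g + h} -> mx_hom (twist phi j).
Proof.
move=> phiM; have [h1 hM] := block_hom j; split=> [|g h]; rewrite /twist.
  by rewrite (hom_vec1 phiM) mxE expR0 h1 scale1r.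
by rewrite phiM mxE expRD rmorphM hM -scalemxAl -scalemxAr scalerA.
Qed.

Lemma twist_eigenE phi j g : char_poly (twist phi j g) =
  \prod_l ('X - (twist_eigen phi g (existT (fun j => ordinal (bdim j)) j l))%:P).
Proof. exact: (char_poly_scale _ (block_unit block_hom j g) (block_eigenE j g)). Qed.

Lemma card_index : #|{: I}| = \dim {:V}.
Proof. by rewrite card_tagged -(dim_decomposition U) sumnE big_map big_enum; apply: eq_bigr => j _; rewrite card_ord. Qed.

Lemma eigenvalues_beta (delta : G -> R) phi g :
  perm_eq [seq nrm z | z <- eigenvalues (beta U delta phi zeta g)]
    [seq expR (delta g) * modulus phi g a | a <- enum {: I}].
Proof.
pose c := real_complex R (expR (delta g)).
have : perm_eq (eigenvalues (beta U delta phi zeta g)) [seq c * twist_eigen phi g a | a <- enum {: I}].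
  apply: prod_XsubC_eq; rewrite -eigenvaluesE /beta char_poly_dsum rmorph_prod.
  rewrite big_map big_enum /=.
  have -> : \prod_(a : I) ('X - (c * twist_eigen phi g a)%:P) =
      \prod_j \prod_l ('X - (c * twist_eigen phi g (existT (fun j => ordinal (bdim j)) j l))%:P).
    exact: (prod_tagged (fun a => 'X - (c * twist_eigen phi g a)%:P)).
  apply: eq_bigr => j _; rewrite eigenvaluesE (big_nth 0) big_mkord size_eigenvalues.
  rewrite -char_poly_complex_mx complex_mxZ complex_of_scalar_of_real.
  rewrite (char_poly_scale _ (block_unit block_hom j g) (block_eigenE j g)).
  by apply: eq_bigr => l _; rewrite /c /twist_eigen /= mulrA -rmorphM -expRD.
move/(perm_map nrm); rewrite -map_comp.
rewrite (eq_map (g := fun a => expR (delta g) * modulus phi g a)) // => a /=.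
by rewrite Normc.normcM nrm_twist_eigen /c nrm_real ger0_norm ?expR_ge0.
Qed.

End Twist.

Lemma separated_scale (R : realFieldType) (I : finType) (T : {set I}) (L c : R) (x : I -> R) :
  0 < c -> separated T L (fun a => c * x a) <-> separated T L x.
Proof.
move=> c0; split=> -[th th0 [h1 h2]].
  exists (c^-1 * th); first by rewrite mulr_gt0 ?invr_gt0.
  split=> [a /h1|b /h2]; first by rewrite ler_pdivrMl.
  by rewrite mulrCA -ler_pdivlMl.
exists (c * th); first by rewrite mulr_gt0.
split=> [a /h1 ha|b /h2 hb]; first by rewrite ler_pM2l.
by rewrite mulrCA ler_pM2l.
Qed.

Section Twist.
Variables (R : realType) (k : scalar_kind) (V : vectType (scalars R k)).
Variables (m : nat) (U : decomposition V m) (G : groupType).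
Variable zeta : G -> 'End(V).
Hypothesis hzeta : block_normalized U zeta.
Local Notation C := R[i].
Local Notation nrm := (@Normc.normc R).
Local Notation I := {j : 'I_m & 'I_(bdim U j)}.
Local Notation modulus := (modulus zeta (U := U)).

Lemma scalar_of_realM (x y : R) :
  scalar_of_real k (x * y) = scalar_of_real k x * scalar_of_real k y.
Proof. by case: k => //=; rewrite rmorphM. Qed.

Lemma scalar_of_real1 : scalar_of_real k (1 : R) = 1.
Proof. by case: k. Qed.

Lemma betaE delta phi g j (u : subvs_of (U j)) : beta U delta phi zeta g (vsval u) =
  scalar_of_real k (expR (delta g + phi g 0 j)) *: zeta g (vsval u).
Proof.
by rewrite /beta dsum_blocksE scale_lfunE linearZ /= blockE // (zeta_stable hzeta).
Qed.

Lemma beta_representation delta phi : Hom_real G delta -> Hom_D U G phi ->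
  representation (beta U delta phi zeta).
Proof.
move=> deltaM [phiM _]; have [[z1 zM] _] := hzeta.
have d1 : delta 1%g = 0 := psi1 deltaM.
split=> [|g h]; apply: (end_summand_ext (U := U)) => j u; rewrite ?comp_lfunE !betaE.
  by rewrite d1 (hom_vec1 phiM) mxE addr0 expR0 scalar_of_real1 scale1r z1.
rewrite linearZ /= -(blockE u (zeta_stable hzeta h j)) betaE (blockE u (zeta_stable hzeta h j)).
rewrite scalerA -scalar_of_realM -expRD zM comp_lfunE deltaM phiM mxE.
by congr (scalar_of_real k (expR _) *: _); ring.
Qed.

Variable S0 : seq G.
Hypothesis genS0 : generates S0.

Definition gapped (i : nat) (phi : G -> 'rV[R]_m) (a b : R) := forall g,
  exists2 T : {set I}, #|T| = i & separated T (expR (a * (conj_length S0 g)%:R - b)) (modulus phi g).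

Lemma lambda_gapP i delta phi g r : (0 < i < \dim {:V})%N ->
  r <= ln (lambda i (beta U delta phi zeta g) / lambda i.+1 (beta U delta phi zeta g)) <->
  exists2 T : {set I}, #|T| = i & separated T (expR r) (modulus phi g).
Proof.
rewrite -(card_index U) => iI.
have pos a : 0 < expR (delta g) * modulus phi g a.
  by rewrite mulr_gt0 ?expR_gt0 // modulus_gt0.
have := sorted_value_gapP (eigenvalues_beta hzeta delta phi g) pos r iI.
move=> H; apply: (iff_trans H); split=> -[T Ti sepT]; exists T => //.
  by apply/(separated_scale _ _ _ (expR_gt0 (delta g))).
by apply/separated_scale => //; exact: expR_gt0.
Qed.

(** Removes [delta], the sorting and the choice of generators: a change of generators only costs a
    factor in [a]. *)
Lemma anosov_twistsP theta phi : theta `<=` [set i | (0 < i < \dim {:V})%N] -> Hom_D U G phi ->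
  anosov_twists U theta zeta phi <->
  forall i, theta i -> exists a b, [/\ 0 < a, 0 <= b & gapped i phi a b].
Proof.
move=> thetaD phiD; split=> [[_ H] i ti|H].
  have d0 : Hom_real G (fun _ : G => 0 : R) by move=> g h; rewrite addr0.
  have [_ /(_ S0 genS0 i ti)[a [b [a0 b0 gap]]]] := H _ d0.
  exists a, b; split=> // g; apply/(lambda_gapP (fun _ => 0)); [exact: thetaD|exact: gap].
split=> // delta deltaM; split; first exact: beta_representation.
move=> S genS i ti; have [a [b [a0 b0 gap]]] := H i ti.
have [K KP] := conj_length_change genS0 genS.
have K0 : 0 < K%:R + 1 :> R by rewrite ltr_wpDl ?ler0n.
exists (a / (K%:R + 1)), b; split=> [||g]; rewrite ?divr_gt0 //.
have [T Ti sepT] := gap g; apply/lambda_gapP; first exact: thetaD.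
exists T; first exact: Ti.
apply: (separated_le _ _ sepT) => [c|]; first by apply: ltW; exact: modulus_gt0.
rewrite ler_expR lerD2r mulrAC ler_pdivrMr // -mulrA ler_pM2l //.
have : (conj_length S g)%:R <= K%:R * (conj_length S0 g)%:R :> R by rewrite -natrM ler_nat.
have : 0 <= (conj_length S0 g)%:R :> R by rewrite ler0n.
by rewrite mulrDr mulr1 mulrC; lra.
Qed.

Hypothesis large : forall (psi : G -> R) (ga : G) (B : nat),
  {morph psi : g h / (g * h)%g >-> g + h} -> psi ga != 0 ->
  exists2 eta, psi eta = 0 & forall N, (0 < N)%N -> (B <= conj_length S0 (eta ^+ N)%g)%N.

Local Notation ocn T j := (@occ m (bdim U) j T).

(** [ga] and [ga^-1] are both compared with the same power of [eta]. The exponent [N] comes after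
    [eta], which is why [large] must control all positive powers. *)
Lemma occ_inverse i phi a b (psi : G -> R) ga (T T' : {set I}) (r r' : R) : (i <= \dim {:V})%N ->
  0 < a -> gapped i phi a b -> {morph phi : g h / (g * h)%g >-> g + h} ->
  {morph psi : g h / (g * h)%g >-> g + h} -> psi ga != 0 ->
  0 < r -> 0 < r' -> #|T| = i -> #|T'| = i ->
  separated T (expR r) (modulus phi ga) -> separated T' (expR r') (modulus phi ga^-1%g) ->
  forall j, ocn T j = ocn T' j.
Proof.
move=> iV a0 gap phiM psiM pga r0 r'0 Ti T'i sepT sepT' j.
(* Conjugacy length at least [B] makes [a * B - b] positive, so the index set at [eta ^+ N] is
   separated by a factor greater than 1. *)
pose B := (Num.bound ((`|b| + 1) / a)).+1.
have BP : 0 < a * B%:R - b.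
  have h0 : 0 <= (`|b| + 1) / a by apply: divr_ge0; [rewrite addr_ge0|exact: ltW].
  have := archi_boundP h0; rewrite ltr_pdivrMr // => h1.
  have : (Num.bound ((`|b| + 1) / a))%:R <= B%:R :> R by rewrite ler_nat leqnSn.
  rewrite -(ler_pM2l a0); have := ler_norm b; lra.
have [eta eta0 etaB] := large B psiM pga.
have iI : (i <= #|{: I}|)%N by rewrite card_index.
have [N N0 key] := occ_eq (fun j => twist_hom hzeta j phiM) (fun g j => twist_eigenE hzeta phi j g) j iI eta.
have sepE g T1 L : separated T1 L (nrm \o twist_eigen zeta phi g) <-> separated T1 L (modulus phi g).
  have -> // : nrm \o twist_eigen zeta phi g = modulus phi g.
  by apply/funext => x; exact: nrm_twist_eigen.
have [Te Tei sepTe] := gap (eta ^+ N)%g.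
have re : 0 < a * (conj_length S0 (eta ^+ N)%g)%:R - b.
  apply: lt_le_trans BP _; rewrite lerD2r ler_pM2l // ler_nat; exact: etaB.
have exp_gt1 x : 0 < x -> 1 < expR x :> R by move=> x0; rewrite expR_gt1.
(* The conjugacy length of [w] is at least [p * |psi x| / c], whatever [q] is, and [1 + r <= expR r]
   turns this into any required gap factor [L]. *)
have gapx x : psi x != 0 -> forall L, eventually_nat (fun p => forall q, exists T1 : {set I},
     #|T1| = i /\ separated T1 L (nrm \o twist_eigen zeta phi (x ^+ p * (eta ^+ N) ^+ q)%g)).
  move=> px L; pose c := gen_bound S0 psi + 1.
  have c0 : 0 < c by rewrite ltr_wpDl // gen_bound_ge0.
  have px0 : 0 < `|psi x| by rewrite normr_gt0.
  have h0 : 0 <= (`|L| + `|b|) * c / (a * `|psi x|).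
    apply: divr_ge0; first by apply: mulr_ge0; [exact: addr_ge0|exact: ltW].
    by apply: mulr_ge0; [exact: ltW|exact: normr_ge0].
  exists (Num.bound ((`|L| + `|b|) * c / (a * `|psi x|))) => p pP q.
  set w := (_ * _)%g; have [T1 T1i sepT1] := gap w; exists T1; split=> //; apply/sepE.
  apply: separated_le sepT1 => [d|]; first by rewrite ltW // modulus_gt0.
  apply: le_trans (expR_ge1Dx _); apply: le_trans (_ : `|L| <= _); first exact: ler_norm.
  have psiw : psi w = p%:R * psi x.
    by rewrite /w psiM !(psiX psiM) eta0 !mulr0 addr0.
  have h1 : p%:R * `|psi x| <= c * (conj_length S0 w)%:R.
    have := hom_conj_length genS0 psiM w; rewrite psiw normrM ger0_norm ?ler0n // => h.
    apply: le_trans h _; rewrite /c mulrDl mul1r lerDl ler0n //.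
  have h2 : (`|L| + `|b|) * c <= p%:R * (a * `|psi x|).
    rewrite -ler_pdivrMr ?mulr_gt0 //; apply: ltW; apply: lt_le_trans (archi_boundP h0) _.
    by rewrite ler_nat.
  have h3 : (`|L| + `|b|) * c <= a * (conj_length S0 w)%:R * c.
    apply: le_trans h2 _; rewrite mulrCA -mulrA ler_pM2l //.
    by rewrite [_ * c]mulrC.
  rewrite ler_pM2r // in h3; have := ler_norm b; lra.
have pgaV : psi ga^-1%g != 0 by rewrite (psiV psiM) oppr_eq0.
have sepe := proj2 (sepE _ _ _) sepTe.
rewrite (key ga T Te _ _ Ti Tei (exp_gt1 _ r0) (exp_gt1 _ re) (proj2 (sepE _ _ _) sepT) sepe (gapx _ pga)).
apply/esym.
exact: (key _ T' Te _ _ T'i Tei (exp_gt1 _ r'0) (exp_gt1 _ re) (proj2 (sepE _ _ _) sepT') sepe (gapx _ pgaV)).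
Qed.

End Twist.

Lemma separatedP (R : realFieldType) (I : finType) (T : {set I}) (L : R) (x : I -> R) :
  (0 < #|T|)%N -> (forall a, 0 < x a) ->
  separated T L x <-> forall a b, a \in T -> b \notin T -> L * x b <= x a.
Proof.
move=> /card_gt0P[a0 a0T] x0; split=> [[th th0 [h1 h2]] a b aT bT|H].
  exact: le_trans (h2 b bT) (h1 a aT).
have sT : enum T != [::] by apply: contraTneq a0T => e; rewrite -mem_enum e.
have [a aT amin] := seq_argmin x sT; rewrite mem_enum in aT.
exists (x a) => //; split=> [c cT|b bT]; last exact: H.
by apply: amin; rewrite mem_enum.
Qed.

(** * Exchanging elements between index sets of equal size *)

Section Occ.
Variables (m : nat) (d : 'I_m -> nat).
Local Notation I := {j : 'I_m & 'I_(d j)}.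
Local Notation ocn T j := (@occ m d j T).
Implicit Types T : {set I}.

Lemma occ_lt_ex T T' j : (ocn T' j < ocn T j)%N -> exists a, [/\ a \in T, a \notin T' & tag a = j].
Proof.
move=> lt; apply: contrapT => H; move: lt; rewrite ltnNge => /negP; apply.
apply: subset_leq_card; apply/fintype.subsetP => a; rewrite !inE => /andP[aT aj].
rewrite aj andbT; apply: contraT => aT'; exfalso; apply: H; exists a; split=> //.
exact/eqP.
Qed.

Lemma sum_occ T : (\sum_j ocn T j = #|T|)%N.
Proof.
rewrite -sum1_card (partition_big (fun a : I => tag a) predT) //=.
apply: eq_bigr => j _; rewrite /occ -sum1_card; apply: eq_bigl => a.
by rewrite inE.
Qed.

(** In the second case the exchange happens within one block, where two twists of the same [zeta]
    order the moduli alike; in the first, the blocks [i] and [j] define the homomorphism that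
    compares the twists. *)
Lemma occ_exchange T T' : #|T| = #|T'| -> T <> T' ->
  (exists i j, [/\ ocn T' i < ocn T i & ocn T j < ocn T' j]%N) \/
  (exists a b, [/\ a \in T, a \notin T', b \in T', b \notin T & tag a = tag b]).
Proof.
move=> cTT' TT'; have [e|/existsNP[j0 /eqP ne]] := pselect (forall j, ocn T j = ocn T' j).
  right; have [a [aT aT']] : exists a, a \in T /\ a \notin T'.
    apply: contrapT => H; apply: TT'; apply/eqP; rewrite eqEcard cTT' leqnn andbT.
    apply/fintype.subsetP => a aT; apply: contraT => aT'; exfalso; apply: H; by exists a.
  have lt : (ocn (T :&: T') (tag a) < ocn T (tag a))%N.
    apply: proper_card; apply/properP; split.
      by apply/fintype.subsetP => c; rewrite !inE => /andP[/andP[-> _] ->].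
    by exists a; rewrite !inE ?aT ?(negbTE aT') eqxx.
  rewrite e in lt; have [b [bT' bTT' tb]] := occ_lt_ex lt.
  exists a, b; split=> //; by apply: contra bTT' => bT; rewrite inE bT.
left; have sums : (\sum_j ocn T j = \sum_j ocn T' j)%N by rewrite !sum_occ.
have half S S' : (\sum_j ocn S j = \sum_j ocn S' j)%N -> ocn S j0 != ocn S' j0 ->
    exists i, (ocn S' i < ocn S i)%N.
  move=> sSS' ne'; apply: contrapT => H.
  have le j : (ocn S j <= ocn S' j)%N by rewrite leqNgt; apply/negP => h; apply: H; exists j.
  have lt0 : (ocn S j0 < ocn S' j0)%N by rewrite ltn_neqAle ne' le.
  suff : (\sum_j ocn S j < \sum_j ocn S' j)%N by rewrite sSS' ltnn.
  rewrite (bigD1 j0) //= [X in (_ < X)%N](bigD1 j0) //= -addSn leq_add //.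
  by apply: leq_sum.
have [i iP] := half _ _ sums ne.
have [j jP] : exists j, (ocn T j < ocn T' j)%N by apply: half; rewrite // eq_sym.
by exists i, j.
Qed.

End Occ.

(** * Convex combinations of twists with a gap *)

Section Twist.
Variables (R : realType) (k : scalar_kind) (V : vectType (scalars R k)).
Variables (m : nat) (U : decomposition V m) (G : groupType).
Variable zeta : G -> 'End(V).
Hypothesis hzeta : block_normalized U zeta.
Local Notation nrm := (@Normc.normc R).
Local Notation I := {j : 'I_m & 'I_(bdim U j)}.
Local Notation modulus := (modulus zeta (U := U)).
Local Notation ocn T j := (@occ m (bdim U) j T).
Implicit Types phi : G -> 'rV[R]_m.

Definition log_eigen (g : G) (a : I) : R := ln (nrm (block_eigen zeta g a)).

Definition log_modulus phi (g : G) (a : I) : R := phi g 0 (tag a) + log_eigen g a.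

Lemma modulusE phi g a : modulus phi g a = expR (log_modulus phi g a).
Proof.
rewrite /log_modulus expRD /log_eigen lnK // posrE nrm_gt0.
exact: block_eigen_neq0.
Qed.

Lemma separated_log phi g (T : {set I}) r : (0 < #|T|)%N ->
  separated T (expR r) (modulus phi g) <->
  forall a b, a \in T -> b \notin T -> r + log_modulus phi g b <= log_modulus phi g a.
Proof.
move=> T0; have H := separatedP (expR r) T0 (modulus_gt0 hzeta phi g).
apply: (iff_trans H); split=> h a b aT bT; have := h a b aT bT.
  by rewrite !modulusE -expRD ler_expR.
by rewrite !modulusE -expRD ler_expR.
Qed.

Variable S0 : seq G.
Hypothesis genS0 : generates S0.
Hypothesis large : forall (psi : G -> R) (ga : G) (B : nat),
  {morph psi : g h / (g * h)%g >-> g + h} -> psi ga != 0 ->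
  exists2 eta, psi eta = 0 & forall N, (0 < N)%N -> (B <= conj_length S0 (eta ^+ N)%g)%N.

Local Notation gapped := (@gapped R k V m U G zeta S0).

Lemma gap0 i phi g : (0 < i < \dim {:V})%N ->
  exists2 T : {set I}, #|T| = i & separated T (expR 0) (modulus phi g).
Proof.
move=> iV; apply/(lambda_gapP hzeta (fun _ => 0)) => //.
rewrite -(card_index U) in iV.
apply: (sorted_value_gap_ge0 (eigenvalues_beta hzeta (fun _ => 0) phi g)) => // a.
by rewrite mulr_gt0 ?expR_gt0 ?modulus_gt0.
Qed.

Lemma comb_hom (phi phi' : G -> 'rV[R]_m) i j :
  {morph phi : g h / (g * h)%g >-> g + h} -> {morph phi' : g h / (g * h)%g >-> g + h} ->
  {morph (fun g => phi g 0 i - phi g 0 j + (phi' g 0 j - phi' g 0 i)) : g h / (g * h)%g >-> g + h}.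
Proof. by move=> h h' g g'; rewrite h h' !mxE; ring. Qed.

(* If [T] and [T'] differ at [g], then [psi] below is positive at [g] and, by
   [occ_inverse], at [g^-1]. *)
Lemma gapped_convex i phi phi' (a b a' b' t : R) : (0 < i < \dim {:V})%N ->
  {morph phi : g h / (g * h)%g >-> g + h} -> {morph phi' : g h / (g * h)%g >-> g + h} ->
  0 < a -> 0 < a' -> 0 <= b -> 0 <= b' -> gapped i phi a b -> gapped i phi' a' b' ->
  0 <= t -> t <= 1 ->
  gapped i (fun g => t *: phi g + (1 - t) *: phi' g) (Num.min a a') (Num.max b b').
Proof.
move=> iV phiM phi'M a0 a'0 b0 b'0 gap gap' t0 t1 g.
have iV' : (i <= \dim {:V})%N by lia.
set chi := fun g : G => t *: phi g + (1 - t) *: phi' g; set n : R := (conj_length S0 g)%:R; set r := _ - _.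
have n0 : 0 <= n by rewrite ler0n.
(* For [r <= 0] the set of the [i] largest moduli will do; otherwise both given gaps are positive at
   [g]. *)
have [r0|r0] := leP r 0.
  have [T Ti sepT] := gap0 chi g iV; exists T => //; apply: separated_le sepT => [c|].
    by apply: ltW; exact: modulus_gt0.
  by rewrite ler_expR.
have rle : r <= a * n - b /\ r <= a' * n - b'.
  split; apply: lerB; rewrite ?ler_wpM2r ?ge_min ?le_max ?lexx ?orbT //.
have [T Ti sepT] := gap g; have [T' T'i sepT'] := gap' g.
have pos (S : {set I}) : #|S| = i -> (0 < #|S|)%N by move=> ->; lia.
(* Adding the two gap inequalities for [u] and [v], taken in opposite directions, cancels the
   eigenvalues of [zeta] and leaves the twists alone. *)
have key x (S S' : {set I}) u v (q q' : R) : #|S| = i -> #|S'| = i ->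
    separated S (expR q) (modulus phi x) -> separated S' (expR q') (modulus phi' x) ->
    u \in S -> u \notin S' -> v \in S' -> v \notin S ->
    q + q' <= phi x 0 (tag u) - phi x 0 (tag v) + (phi' x 0 (tag v) - phi' x 0 (tag u)).
  move=> Si S'i /(separated_log _ _ _ (pos _ Si)) h /(separated_log _ _ _ (pos _ S'i)) h'.
  move=> uS uS' vS' vS; have := h u v uS vS; have := h' v u vS' uS'.
  rewrite /log_modulus; lra.
have TT' : T = T'.
  apply: contrapT => ne; have [[p [q [lt1 lt2]]]|[u [v [uT uT' vT' vT e]]]] := occ_exchange (etrans Ti (esym T'i)) ne; last first.
    have := key g T T' u v _ _ Ti T'i sepT sepT' uT uT' vT' vT; rewrite e; lra.
  pose psi x := phi x 0 p - phi x 0 q + (phi' x 0 q - phi' x 0 p).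
  have psiM : {morph psi : x y / (x * y)%g >-> x + y} by exact: comb_hom.
  have [u [uT uT' up]] := occ_lt_ex lt1; have [v [vT' vT vq]] := occ_lt_ex lt2.
  have psig : 0 < psi g.
    have := key g T T' u v _ _ Ti T'i sepT sepT' uT uT' vT' vT.
    rewrite up vq -/(psi g); lra.
  have nV : (conj_length S0 g^-1%g)%:R = n by rewrite conj_lengthV.
  have [Tm Tmi sepTm] := gap g^-1%g; have [Tm' Tm'i sepTm'] := gap' g^-1%g.
  rewrite nV in sepTm sepTm'.
  have psi_neq : psi g != 0 by rewrite gt_eqF.
  have r1 : 0 < a * n - b by lra.
  have r2 : 0 < a' * n - b' by lra.
  have o1 := occ_inverse hzeta genS0 large iV' a0 gap phiM psiM psi_neq r1 r1 Ti Tmi sepT sepTm.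
  have o2 := occ_inverse hzeta genS0 large iV' a'0 gap' phi'M psiM psi_neq r2 r2 T'i Tm'i sepT' sepTm'.
  rewrite o1 o2 in lt1; rewrite o1 o2 in lt2.
  have [x [xT xT' xp]] := occ_lt_ex lt1; have [y [yT' yT yq]] := occ_lt_ex lt2.
  have := key _ _ _ x y _ _ Tmi Tm'i sepTm sepTm' xT xT' yT' yT.
  rewrite xp yq -/(psi _) (psiV psiM); lra.
rewrite -TT' in sepT'; exists T => //; apply/(separated_log _ _ _ (pos _ Ti)) => u v uT vT.
have := (separated_log _ _ _ (pos _ Ti)).1 sepT u v uT vT.
have := (separated_log _ _ _ (pos _ Ti)).1 sepT' u v uT vT.
rewrite /log_modulus /chi !mxE; case: rle.
move: (log_eigen g u) (log_eigen g v) (phi g 0 _) (phi g 0 _) (phi' g 0 _) (phi' g 0 _).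
move: (a * n - b) (a' * n - b') => q q' lu lv x y x' y' rq rq' h' h.
have e1 : 0 <= t * (x + lu - (r + (y + lv))) by rewrite mulr_ge0 //; lra.
have e2 : 0 <= (1 - t) * (x' + lu - (r + (y' + lv))) by rewrite mulr_ge0 //; lra.
clearbody r; nra.
Qed.

End Twist.

(** * Boundedness and stability of twists with a gap *)

Section Twist.
Variables (R : realType) (k : scalar_kind) (V : vectType (scalars R k)).
Variables (m : nat) (U : decomposition V m) (G : groupType).
Variable zeta : G -> 'End(V).
Hypothesis hzeta : block_normalized U zeta.
Local Notation nrm := (@Normc.normc R).
Local Notation I := {j : 'I_m & 'I_(bdim U j)}.
Local Notation modulus := (modulus zeta (U := U)).
Local Notation ocn T j := (@occ m (bdim U) j T).
Local Notation log_eigen := (@log_eigen R k V m U G zeta).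
Implicit Types phi : G -> 'rV[R]_m.

Variable S0 : seq G.
Hypothesis genS0 : generates S0.
Hypothesis large : forall (psi : G -> R) (ga : G) (B : nat),
  {morph psi : g h / (g * h)%g >-> g + h} -> psi ga != 0 ->
  exists2 eta, psi eta = 0 & forall N, (0 < N)%N -> (B <= conj_length S0 (eta ^+ N)%g)%N.

Local Notation gapped := (@gapped R k V m U G zeta S0).

Lemma log_eigen_power g n (a : I) : exists a', log_eigen (g ^+ n)%g a = n%:R * log_eigen g a'.
Proof.
case: a => j l.
have e1 := @block_eigenE R k V m U G zeta j (g ^+ n)%g.
have e2 := char_poly_expr n (block_unit (block_hom hzeta) j g) (@block_eigenE R k V m U G zeta j g).
rewrite -(block_exp (block_hom hzeta)) in e2.
have P := char_poly_perm e1 e2.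
have := codom_f (fun l => block_eigen zeta (g ^+ n)%g (existT (fun j => 'I_(bdim U j)) j l)) l.
rewrite (perm_mem P) => /codomP[l' E]; exists (existT (fun j => 'I_(bdim U j)) j l').
rewrite /log_eigen E nrmX lnXn ?mulr_natl //.
by rewrite nrm_gt0 block_eigen_neq0.
Qed.

Definition eigen_bound (s : G) : R := \sum_a (`|log_eigen s a| + `|log_eigen s^-1%g a|).

Lemma log_eigen_power_bound s n a :
  `|log_eigen (s ^+ n)%g a| <= n%:R * eigen_bound s /\
  `|log_eigen (s ^+ n)^-1%g a| <= n%:R * eigen_bound s.
Proof.
have le1 b : `|log_eigen s b| + `|log_eigen s^-1%g b| <= eigen_bound s.
  rewrite /eigen_bound (bigD1 b) //= lerDl; apply: sumr_ge0 => c _.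
  by rewrite addr_ge0.
rewrite -expVgn; have [b ->] := log_eigen_power s n a.
have [c ->] := log_eigen_power s^-1%g n a.
rewrite !normrM !normr_nat; split; apply: ler_wpM2l; rewrite ?ler0n //.
  by apply: le_trans (le1 b); rewrite lerDl.
by apply: le_trans (le1 c); rewrite lerDr.
Qed.

Lemma inj_existT q : injective (existT (fun j => 'I_(bdim U j)) q).
Proof. by move=> x y /eqP; rewrite eq_Tagged => /eqP. Qed.

(** The gap may be useless at [s], but it is positive at a high power [s ^+ n]. There [phi] and the
    logarithms of the eigenvalues are both of order [n], so [n] cancels. The constant 8 adds 4 for
    the distance to the block [p0] and 4 for the value there. *)
Lemma gapped_bound i phi a b s j : (0 < i < \dim {:V})%N -> Hom_D U G phi ->
  0 < a -> gapped i phi a b -> `|phi s 0 j| <= 8 * eigen_bound s.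
Proof.
move=> iV [phiM phiD] a0 gap.
have EB0 : 0 <= eigen_bound s by apply: sumr_ge0 => c _; rewrite addr_ge0.
(* If [phi s] is nonzero, one of its coordinates is the homomorphism that [occ_inverse] requires. *)
have [->|/eqP/rowP/existsNP[j0 /eqP]] := eqVneq (phi s) 0; first by rewrite mxE normr0 mulr_ge0.
rewrite mxE => psi_s; pose psi g := phi g 0 j0.
have psiM : {morph psi : g h / (g * h)%g >-> g + h} by move=> g h; rewrite /psi phiM mxE.
pose c := gen_bound S0 psi + 1.
have c0 : 0 < c by rewrite ltr_wpDl // gen_bound_ge0.
have ps0 : 0 < `|psi s| by rewrite normr_gt0.
have aps : 0 < a * `|psi s| by rewrite mulr_gt0.
have h0 : 0 <= `|b| * c / (a * `|psi s|).
  by apply: divr_ge0; [apply: mulr_ge0; [exact: normr_ge0|exact: ltW]|exact: ltW].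
pose n := (Num.bound (`|b| * c / (a * `|psi s|))).+1.
pose g := (s ^+ n)%g; pose L : R := (conj_length S0 g)%:R.
have n0 : 0 < n%:R :> R by rewrite ltr0n.
have psig : psi g = n%:R * psi s by rewrite (psiX psiM).
have r0 : 0 < a * L - b.
  have h1 : `|b| * c < n%:R * (a * `|psi s|).
    rewrite -ltr_pdivrMr //; apply: lt_le_trans (archi_boundP h0) _.
    by rewrite ler_nat leqnSn.
  have h2 : n%:R * `|psi s| <= c * L.
    have := hom_conj_length genS0 psiM g; rewrite psig normrM ger0_norm ?ler0n // => h.
    by apply: le_trans h _; rewrite /c mulrDl mul1r lerDl ler0n.
  have h3 : `|b| * c < a * L * c.
    apply: lt_le_trans h1 _; rewrite mulrCA -mulrA ler_pM2l //.
    by rewrite [L * c]mulrC.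
  rewrite ltr_pM2r // in h3; have := ler_norm b; lra.
have iV' : (i <= \dim {:V})%N by case/andP: iV => _ /ltnW.
have psig_neq : psi g != 0 by rewrite psig; apply: mulf_neq0; [exact: lt0r_neq0|exact: psi_s].
have [T Ti sepT] := gap g; have [T' T'i sepT'] := gap g^-1%g.
rewrite (conj_lengthV genS0) -/L in sepT'; rewrite -/L in sepT.
have o1 := occ_inverse hzeta genS0 large iV' a0 gap phiM psiM psig_neq r0 r0 Ti T'i sepT sepT'.
have Tpos : (0 < #|T|)%N by rewrite Ti; case/andP: iV.
have T'pos : (0 < #|T'|)%N by rewrite T'i; case/andP: iV.
have {}sepT := (separated_log hzeta _ _ _ Tpos).1 sepT.
have {}sepT' := (separated_log hzeta _ _ _ T'pos).1 sepT'.
pose Lam := n%:R * eigen_bound s.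
(* A block with an element inside [S] and one with an element outside are compared in one direction
   only; the equal counts at [g] and [g^-1] later supply the other. *)
have in_out x (S : {set I}) p q : (forall u v, u \in S -> v \notin S ->
      a * L - b + log_modulus zeta phi x v <= log_modulus zeta phi x u) ->
    (forall u, `|log_eigen x u| <= Lam) ->
    (0 < ocn S p)%N -> (ocn S q < bdim U q)%N -> phi x 0 q - phi x 0 p <= 2 * Lam.
  move=> sepS bnd pS qS.
  have [u [uS _ up]] : exists u : I, [/\ u \in S, u \notin finset.set0 & tag u = p].
    by apply: occ_lt_ex; rewrite (_ : ocn finset.set0 p = 0%N) //; apply: eq_card0 => w; rewrite !inE.
  have [v [_ vS vq]] : exists v : I, [/\ v \in finset.setT, v \notin S & tag v = q].
    apply: occ_lt_ex; apply: leq_trans qS _.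
    rewrite -[bdim U q]card_ord -(card_imset _ (@inj_existT q)).
    apply: subset_leq_card; apply/fintype.subsetP => _ /imsetP[w _ ->].
    by rewrite !inE /=.
  have := sepS u v uS vS; rewrite /log_modulus up vq.
  have := bnd u; have := bnd v; rewrite !ler_norml => /andP[? ?] /andP[? ?]; lra.
have gV x p : phi x^-1%g 0 p = - phi x 0 p.
  by apply: (psiV (psi := fun x => phi x 0 p)) => y z; rewrite phiM mxE.
have bnd u := (log_eigen_power_bound s n u).1.
have bnd' u := (log_eigen_power_bound s n u).2.
have compare p q : (0 < ocn T p)%N -> (ocn T q < bdim U q)%N ->
    `|phi g 0 q - phi g 0 p| <= 2 * Lam.
  move=> pT qT; rewrite ler_norml; have h1 := in_out g T p q sepT bnd pT qT.
  rewrite (o1 p) in pT; rewrite (o1 q) in qT.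
  have := in_out _ T' p q sepT' bnd' pT qT; rewrite !gV => h2.
  apply/andP; split; lra.
have [p0 p0T] : exists p, (0 < ocn T p)%N.
  apply: contrapT => H; have := sum_occ T; rewrite big1 ?Ti => [|p _].
    by move=> i0; move: iV; rewrite -i0.
  by apply/eqP; rewrite -leqn0 leqNgt; apply/negP => h; apply: H; exists p.
have [q0 q0T] : exists q, (ocn T q < bdim U q)%N.
  apply: contrapT => H; have := sum_occ T; rewrite Ti.
  have : (\sum_q bdim U q <= \sum_q ocn T q)%N.
    by apply: leq_sum => q _; rewrite leqNgt; apply/negP => h; apply: H; exists q.
  rewrite /bdim dim_decomposition => le_dim e.
  by case/andP: iV => _; rewrite -e ltnNge le_dim.
(* A non-empty block either meets [T], and is compared with [p0] through [q0], or misses [T] and is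
   compared with [p0] directly. *)
have near p : (0 < bdim U p)%N -> `|phi g 0 p - phi g 0 p0| <= 4 * Lam.
  move=> dp; have Lam0 : 0 <= Lam by rewrite mulr_ge0 // ltW.
  have [pT|] := ltnP 0 (ocn T p); last first.
    rewrite leqn0 => /eqP pT; have := compare p0 p p0T; rewrite pT => /(_ dp); lra.
  have h1 := compare p q0 pT q0T; have h2 := compare p0 q0 p0T q0T.
  have -> : phi g 0 p - phi g 0 p0 = (phi g 0 q0 - phi g 0 p0) - (phi g 0 q0 - phi g 0 p) by ring.
  apply: le_trans (ler_normB _ _) _; lra.
have [sum0 zero] := phiD g.
have Lam0 : 0 <= Lam by rewrite mulr_ge0 // ltW.
have dV : 0 < (\dim {:V})%:R :> R by rewrite ltr0n; case/andP: iV => _; exact: leq_ltn_trans.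
have dimE p : \dim (U p) = bdim U p by rewrite /bdim dim_subvs.
(* By the trace condition [phi g 0 p0] is minus the average, weighted by dimensions, of the
   differences to the other blocks. *)
have center : `|phi g 0 p0| <= 4 * Lam.
  have e : (\dim {:V})%:R * phi g 0 p0 = - \sum_p (bdim U p)%:R * (phi g 0 p - phi g 0 p0).
    under eq_bigr do rewrite mulrBr.
    rewrite sumrB -mulr_suml -natr_sum /bdim dim_decomposition opprB.
    by under [X in _ - X]eq_bigr do rewrite dim_subvs; rewrite sum0 subr0.
  rewrite -(ler_pM2l dV) -[X in X * `|_|]ger0_norm ?ler0n // -normrM e normrN.
  apply: le_trans (ler_norm_sum _ _ _) _.
  rewrite -(dim_decomposition U) natr_sum mulr_suml; apply: ler_sum => p _.
  rewrite -/(bdim U p) normrM normr_nat; have [->|dp] := posnP (bdim U p).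
    by rewrite !mul0r.
  by rewrite ler_wpM2l ?ler0n // near.
have all p : `|phi g 0 p| <= 8 * Lam.
  have [d0|dp] := posnP (bdim U p).
    have /zero-> : U p = 0%VS by apply/eqP; rewrite -dimv_eq0 dimE d0.
    by rewrite normr0 mulr_ge0.
  have := near p dp; have := center; rewrite -{2}[phi g 0 p](subrK (phi g 0 p0)).
  have := ler_normD (phi g 0 p - phi g 0 p0) (phi g 0 p0); lra.
have := all j.
have -> : phi g 0 j = n%:R * phi s 0 j.
  by apply: (psiX (psi := fun x => phi x 0 j)) => y z; rewrite phiM mxE.
by rewrite normrM ger0_norm ?ler0n // /Lam mulrCA ler_pM2l.
Qed.

(** Each coordinate moves by at most [size S0 * e] times the conjugacy length. A gap compares two
    coordinates and may lose [a / 2], hence the factor 4. *)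
Lemma gapped_perturb i phi (chi : G -> 'rV[R]_m) (a b e : R) : (0 < i)%N ->
  {morph phi : g h / (g * h)%g >-> g + h} -> {morph chi : g h / (g * h)%g >-> g + h} ->
  gapped i phi a b -> (forall s j, s \in S0 -> `|chi s 0 j - phi s 0 j| <= e) ->
  4 * (size S0)%:R * e <= a -> gapped i chi (a / 2) b.
Proof.
move=> i0 phiM chiM gap close ea g; have [T Ti sepT] := gap g; exists T => //.
have Tpos : (0 < #|T|)%N by rewrite Ti.
have {}sepT := (separated_log hzeta _ _ _ Tpos).1 sepT.
set n : R := (conj_length S0 g)%:R in sepT *.
have n0 : 0 <= n by rewrite ler0n.
have small j : `|chi g 0 j - phi g 0 j| <= (size S0)%:R * e * n.
  pose psi x := chi x 0 j - phi x 0 j.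
  have psiM : {morph psi : x y / (x * y)%g >-> x + y}.
    by move=> x y; rewrite /psi chiM phiM !mxE; ring.
  have := hom_conj_length genS0 psiM g => /le_trans; apply; apply: ler_wpM2r => //.
  rewrite /gen_bound big_seq; apply: le_trans (_ : \sum_(s <- S0 | s \in S0) e <= _).
    by apply: ler_sum => s sS; exact: close.
  by rewrite -big_seq big_const_seq count_predT iter_addr addr0 mulr_natl.
apply/(separated_log hzeta _ _ _ Tpos) => u v uT vT.
have h1 := sepT u v uT vT; move: (small (tag u)) (small (tag v)).
rewrite /log_modulus in h1 *; rewrite !ler_norml => /andP[h2 h3] /andP[h4 h5].
have h6 : 4 * (size S0)%:R * e * n <= a * n by rewrite ler_wpM2r.
move: h1 h2 h3 h4 h5 h6; rewrite -!mulrA; move: (_ * (e * n)) => t.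
rewrite [2^-1 * n]mulrC mulrA; move: (a * n) => w *; lra.
Qed.

End Twist.

(** * Charts of the space of homomorphisms *)

Section RowNorm.
Variables (R : realType) (n : nat).

Lemma row_norm_le (v : 'rV[R]_n) (M : R) : 0 <= M -> (forall l, `|v 0 l| <= M) -> `|v| <= M.
Proof.
move=> M0 vM; change (mx_norm v <= M).
have [->//|v0] := eqVneq (mx_norm v) 0.
by have [[i l] /= ->] := mx_norm_neq0 v0; rewrite ord1.
Qed.

Lemma le_row_norm (v : 'rV[R]_n) l : `|v 0 l| <= `|v|.
Proof.
change (`|v 0 l| <= mx_norm v); rewrite mx_normrE.
exact: (le_bigmax _ (fun ij => `|v ij.1 ij.2|) (0, l)).
Qed.

End RowNorm.

Section LinearCombinations.
Variables (R : realType) (E : lmodType R) (n : nat) (f : 'I_n -> E).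

Definition lincomb (v : 'rV[R]_n) : E := \sum_l v 0 l *: f l.

Lemma lincomb_linear : linear lincomb.
Proof.
move=> a v w; rewrite /lincomb scaler_sumr -big_split /=.
by apply: eq_bigr => l _; rewrite !mxE scalerDl scalerA.
Qed.

HB.instance Definition _ := GRing.isLinear.Build R 'rV[R]_n E _ lincomb lincomb_linear.

End LinearCombinations.

Lemma linear_row (R : realType) (E : lmodType R) (n : nat) (L : {linear 'rV[R]_n -> E}) v :
  L v = \sum_l v 0 l *: L (delta_mx 0 l).
Proof. by rewrite {1}[v]row_sum_delta linear_sum; apply: eq_bigr => l _; rewrite linearZ. Qed.

Section HomD.
Variables (R : realType) (k : scalar_kind) (V : vectType (scalars R k)).
Variables (m : nat) (U : decomposition V m) (G : groupType).
Variable S : seq G.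
Hypothesis genS : generates S.

Local Notation E := (G -> 'rV[R]_m).

Lemma Hom_D_comb (a b : R) (phi psi : E) :
  Hom_D U G phi -> Hom_D U G psi -> Hom_D U G (fun g => a *: phi g + b *: psi g).
Proof.
move=> [phiM phiD] [psiM psiD]; split=> [g h|g].
  by rewrite phiM psiM !scalerDr addrACA.
have [s1 z1] := phiD g; have [s2 z2] := psiD g; split=> [|j Uj].
  transitivity (a * (\sum_j (\dim (U j))%:R * phi g 0 j) + b * \sum_j (\dim (U j))%:R * psi g 0 j).
    rewrite !mulr_sumr -big_split /=; apply: eq_bigr => j _; rewrite !mxE; ring.
  by rewrite s1 s2 !mulr0 addr0.
by rewrite !mxE z1 // z2 // !mulr0 addr0.
Qed.

Lemma Hom_D0 : Hom_D U G (fun _ => 0).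
Proof.
split=> [g h|g]; first by rewrite addr0.
by split=> [|j _]; rewrite ?mxE // big1 // => j _; rewrite mxE mulr0.
Qed.

(** A homomorphism is determined by its values on generators, so this linear map embeds [Hom_D] into
    a space of matrices. *)
Definition gen_eval (phi : E) : 'M[R]_(size S, m) := \matrix_(l, j) phi (nth 1%g S l) 0 j.

Lemma gen_eval_inj (phi psi : E) : Hom_D U G phi -> Hom_D U G psi ->
  gen_eval phi = gen_eval psi -> phi = psi.
Proof.
move=> phiD psiD e; apply/funext => g; apply/rowP => j.
have [chiM _] := Hom_D_comb 1 (-1) phiD psiD.
pose chi x := phi x 0 j - psi x 0 j.
have cM : {morph chi : x y / (x * y)%g >-> x + y}.
  by move=> x y; rewrite /chi phiD.1 psiD.1 !mxE; ring.
have := hom_word_length genS cM g; rewrite /gen_bound big_seq big1 ?mul0r => [|s sS].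
  by rewrite normr_le0 subr_eq0 => /eqP.
have lt : (index s S < size S)%N by rewrite index_mem.
have := congr1 (fun M : 'M[R]_(size S, m) => M (Ordinal lt) j) e; rewrite !mxE /= nth_index // => e'.
by rewrite /chi e' subrr normr0.
Qed.

Lemma gen_eval_linear : linear gen_eval.
Proof. by move=> a phi psi; apply/matrixP => l j; rewrite !mxE. Qed.

HB.instance Definition _ := GRing.isLinear.Build R E 'M[R]_(size S, m) _ gen_eval gen_eval_linear.

Lemma Hom_D_lincomb n (f : 'I_n -> E) v : (forall l, Hom_D U G (f l)) -> Hom_D U G (lincomb f v).
Proof.
move=> fD; rewrite /lincomb; elim/big_rec: _ => [|l phi _ phiD]; first exact: Hom_D0.
have := Hom_D_comb (v 0 l) 1 (fD l) phiD; congr (Hom_D U G).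
by apply/funext => g; rewrite scale1r.
Qed.

Lemma Hom_D_finite_dimensional : finite_dimensional (Hom_D U G).
Proof.
have [s sX Xs] := finite_spanning_subset (fun x => exists2 phi, Hom_D U G phi & x = gen_eval phi).
pose W := span s; pose n := \dim W.
have Wim x : x \in W -> exists2 phi, Hom_D U G phi & x = gen_eval phi.
  move=> xW; have := coord_span (X := in_tuple s) xW.
  have /choice[f fP] (i : 'I_(size s)) : exists phi, Hom_D U G phi /\ s`_i = gen_eval phi.
    by have [phi phiD e] := sX _ (mem_nth 0 (ltn_ord i)); exists phi.
  move=> ->; exists (lincomb f (\row_i coord (in_tuple s) i x)).
    by apply: Hom_D_lincomb => l; case: (fP l).
  rewrite /lincomb linear_sum; apply: eq_bigr => i _.
  have [_ e] := fP i; by rewrite linearZ /= -e mxE.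
have /choice[f fP] (l : 'I_n) : exists phi, Hom_D U G phi /\ (vbasis W)`_l = gen_eval phi.
  have [|phi phiD e] := Wim (vbasis W)`_l; last by exists phi.
  by apply: vbasis_mem; apply: mem_nth; rewrite size_tuple.
have fD l : Hom_D U G (f l) by case: (fP l).
have evE v : gen_eval (lincomb f v) = \sum_l v 0 l *: (vbasis W)`_l.
  rewrite /lincomb linear_sum; apply: eq_bigr => l _.
  by have [_ e] := fP l; rewrite linearZ /= -e.
exists n, (lincomb f); split=> [v w e|].
  have fr := basis_free (vbasisP W); apply/rowP => l.
  have := congr1 gen_eval e; rewrite !evE => /(congr1 (coord (vbasis W) l)).
  by rewrite !coord_sum_free.
apply/seteqP; split=> [_ [v _ <-]|phi phiD]; first exact: Hom_D_lincomb.
have phiW : gen_eval phi \in W by apply: Xs; exists phi.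
exists (\row_l coord (vbasis W) l (gen_eval phi)) => //.
apply: gen_eval_inj => //; first exact: Hom_D_lincomb.
rewrite evE [RHS](coord_vbasis phiW); apply: eq_bigr => l _; by rewrite mxE.
Qed.

Variables (n : nat) (L : {linear 'rV[R]_n -> E}).
Hypothesis chartL : linear_chart (Hom_D U G) L.

Lemma chart_Hom_D v : Hom_D U G (L v).
Proof. by have [_ <-] := chartL; exists v. Qed.

Lemma chart_bounded (B : G -> R) : exists K : R, forall v,
  (forall s j, s \in S -> `|L v s 0 j| <= B s) -> `|v| <= K.
Proof.
pose N := lin1_mx (mxvec \o gen_eval \o L).
have NE v : v *m N = mxvec (gen_eval (L v)) by rewrite mul_rV_lin1.
have Nfree : row_free N.
  apply: inj_row_free => v; rewrite NE => /eqP; rewrite mxvec_eq0 => /eqP e.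
  have [Linj _] := chartL; apply: Linj; rewrite linear0.
  apply: gen_eval_inj; [exact: chart_Hom_D|exact: Hom_D0|].
  by rewrite e linear0.
pose C := \sum_(s <- S) `|B s|; have C0 : 0 <= C by apply: sumr_ge0.
pose K := \sum_l \sum_i C * `|pinvmx N i l|.
have K0 l : 0 <= \sum_i C * `|pinvmx N i l| by apply: sumr_ge0 => i _; rewrite mulr_ge0.
exists K => v vB; apply: row_norm_le => [|l]; first by apply: sumr_ge0.
have vE : v = mxvec (gen_eval (L v)) *m pinvmx N by rewrite -NE mulmxKp.
apply: (@le_trans _ _ (\sum_i C * `|pinvmx N i l|)); last first.
  by rewrite /K (bigD1 l) //= lerDl; apply: sumr_ge0.
rewrite [in X in X <= _]vE mxE; apply: le_trans (ler_norm_sum _ _ _) _.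
apply: ler_sum => i _; rewrite normrM ler_wpM2r //.
case: (mxvec_indexP i) => p q; rewrite mxvecE mxE.
have pS : nth 1%g S p \in S by rewrite mem_nth.
apply: le_trans (vB _ q pS) _; apply: le_trans (ler_norm _) _.
by rewrite /C (big_rem _ pS) /= lerDl; apply: sumr_ge0.
Qed.

Lemma chart_small (e : R) : 0 < e -> exists2 r, 0 < r & forall v,
  `|v| < r -> forall s j, s \in S -> `|L v s 0 j| <= e.
Proof.
move=> e0; pose M := \sum_(s <- S) \sum_j \sum_l `|L (delta_mx 0 l) s 0 j|.
have M0 : 0 <= M by do 3 (apply: sumr_ge0 => ? _).
exists (e / (M + 1)) => [|v vr s j sS]; first by rewrite divr_gt0 //; lra.
have -> : L v s 0 j = \sum_l v 0 l * L (delta_mx 0 l) s 0 j.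
  rewrite linear_row fct_sumE summxE; apply: eq_bigr => l _.
  by rewrite mxE.
apply: le_trans (ler_norm_sum _ _ _) _.
apply: (@le_trans _ _ (\sum_l e / (M + 1) * `|L (delta_mx 0 l) s 0 j|)).
  apply: ler_sum => l _; rewrite normrM ler_wpM2r //.
  by apply: ltW; apply: le_lt_trans (le_row_norm v l) vr.
rewrite -mulr_sumr.
have le_M : \sum_l `|L (delta_mx 0 l) s 0 j| <= M.
  rewrite /M (big_rem _ sS) /= (bigD1 j) //= -addrA lerDl addr_ge0 //.
    by do 2 (apply: sumr_ge0 => ? _).
  by do 3 (apply: sumr_ge0 => ? _).
apply: (@le_trans _ _ (e / (M + 1) * M)).
  by rewrite ler_wpM2l // divr_ge0 //; lra.
by rewrite mulrAC ler_pdivrMr; [rewrite ler_pM2l //; lra|lra].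
Qed.

End HomD.

Lemma i01_bounds (R : realType) (t : {i01 R}) :
  0 <= t%:num :> R /\ t%:num <= 1 :> R.
Proof. by split; [exact: ge0 | exact: le1]. Qed.

Lemma open_norm (R : realType) (n : nat) (P : set 'rV[R]_n) :
  (forall v, P v -> exists2 r : R, 0 < r & forall w, `|w - v| < r -> P w) -> open P.
Proof.
move=> h; rewrite openE => v /h[r r0 rP]; apply/nbhs_ballP; exists r => // w.
by rewrite -ball_normE /= distrC; exact: rP.
Qed.

Theorem theorem3 (R : realType) (G : groupType)
    (hyp : word_hyperbolic R G) (nonelem : ~ virtually_cyclic G)
    (k : scalar_kind) (V : vectType (scalars R k))
    (V0 : (0 < \dim {:V})%N)
    (m : nat) (U : decomposition V m)
    (theta : set nat) (theta0 : theta !=set0)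
    (thetaD : theta `<=` [set i | (0 < i < \dim {:V})%N])
    (zeta : G -> 'End(V)) (hzeta : block_normalized U zeta) :
  [/\ finite_dimensional (Hom_D U G),
      anosov_twists U theta zeta `<=` Hom_D U G,
      convex_set (anosov_twists U theta zeta),
      bounded_in (Hom_D U G) (anosov_twists U theta zeta) &
      open_in (Hom_D U G) (anosov_twists U theta zeta)].
Proof.
have [S genS large] := kernel_large_conj_length hyp nonelem.
have iffP phi (phiD : Hom_D U G phi) := anosov_twistsP hzeta genS thetaD phiD.
split.
- exact: Hom_D_finite_dimensional genS.
- by move=> phi [].
- move=> phi psi t /set_mem phiA /set_mem psiA; apply/mem_set.
  have phiD := phiA.1; have psiD := psiA.1.
  pose tt : R := t%:num; have [t0 t1] := i01_bounds t.
  have chiD := Hom_D_comb tt (1 - tt) phiD psiD.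
  change (anosov_twists U theta zeta (fun g => tt *: phi g + (1 - tt) *: psi g)).
  apply/(iffP _ chiD) => i ti.
  have [a [b [a0 b0 gap]]] := (iffP _ phiD).1 phiA i ti.
  have [a' [b' [a'0 b'0 gap']]] := (iffP _ psiD).1 psiA i ti.
  exists (Num.min a a'), (Num.max b b'); split.
  + by rewrite lt_min a0.
  + by rewrite le_max b0.
  + exact: (gapped_convex hzeta genS large (thetaD i ti) phiD.1 psiD.1 a0 a'0 b0 b'0 gap gap' t0 t1).
- move=> n L chartL; have [i ti] := theta0.
  have [K KP] := chart_bounded genS chartL (fun s => 8 * eigen_bound U zeta s).
  exists K; split; first exact: num_real.
  move=> M KM v Av /=; apply: le_trans (ltW KM); apply: KP => s j sS.
  have vD := chart_Hom_D chartL v.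
  have [a [b [a0 b0 gap]]] := (iffP _ vD).1 Av i ti.
  exact: (gapped_bound hzeta genS large s j (thetaD i ti) vD a0 gap).
- move=> n L chartL; apply: open_norm => v Av.
  have vD := chart_Hom_D chartL v.
  have /choice[af afP] (i : 'I_(\dim {:V})) : exists a : R, 0 < a /\
      (theta i -> exists2 b, 0 <= b & gapped U zeta S i (L v) a b).
    (* The default rate 1 outside [theta] keeps all [af i] positive. *)
    have [ti|ti] := pselect (theta i); last by exists 1.
    have [a [b [a0 b0 gap]]] := (iffP _ vD).1 Av i ti.
    by exists a; split=> // _; exists b.
  (* A positive lower bound for all the rates at once, so that one radius works for every index in
     [theta]. *)
  pose A : R := (1 + \sum_i (af i)^-1)^-1.
  have sum_ge0 : 0 <= \sum_i (af i)^-1.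
    by apply: sumr_ge0 => i _; rewrite invr_ge0 ltW //; case: (afP i).
  have A0 : 0 < A by rewrite invr_gt0; lra.
  have Ale i : A <= af i.
    have [ai0 _] := afP i; rewrite -[af i]invrK lef_pV2 ?posrE ?invr_gt0 //; last by lra.
    rewrite (bigD1 i) //=.
    have : 0 <= \sum_(l | l != i) (af l)^-1.
      by apply: sumr_ge0 => l _; rewrite invr_ge0 ltW //; case: (afP l).
    lra.
  pose e := A / (4 * ((size S)%:R + 1)).
  have s0 : 0 <= (size S)%:R :> R by rewrite ler0n.
  have e0 : 0 < e by rewrite divr_gt0 //; lra.
  have eA : 4 * (size S)%:R * e <= A.
    rewrite /e mulrA ler_pdivrMr; last by lra.
    rewrite [_ * A]mulrC ler_pM2l //; lra.
  have [r r0 rP] := chart_small S L e0.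
  exists r; [exact: r0 | move=> w wr].
  change (anosov_twists U theta zeta (L w)).
  have wD := chart_Hom_D chartL w.
  apply/(iffP _ wD) => i ti; have iV := thetaD i ti; have /andP[i0 iV'] := iV.
  have [ai0 /(_ ti)[b b0 gap]] := afP (Ordinal iV').
  exists (af (Ordinal iV') / 2), b; split=> //; first by rewrite divr_gt0.
  apply: (gapped_perturb hzeta genS i0 vD.1 wD.1 gap (e := e)) => [s j sS|].
    have := rP (w - v) wr s j sS; rewrite linearB; congr (`|_| <= _).
    by rewrite !mxE.
  exact: le_trans eA (Ale _).
Qed.
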